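(* Define $v_j=K_{5,1}^{j-3}K_{5,2}^{2-j}$ for $0\le j\le5$. Then: (1) $v_0,v_5$ form a basis for $M_1(\Gamma_1(5))$. (2) $v_0,v_1,\ldots,v_5$ form a basis for $M_1(\Gamma(5))$, and $v_j\in q^{j/5}\mathbb{Z}[[q]]$. (3) $v_0,v_5$ generate the graded algebra of modular forms for $\Gamma_1(5)$, and $v_0,\ldots,v_5$ generate the graded algebra of modular forms for $\Gamma(5)$ (over $\mathbb{C}$). (4) The following decomposition formulas hold: $$v_0(\tau/5)=v_0(\tau)+3v_1(\tau)+4v_2(\tau)+2v_3(\tau)+v_4(\tau),$$ $$v_5(\tau/5)=v_5(\tau)+v_1(\tau)-2v_2(\tau)+4v_3(\tau)-3v_4(\tau).$$
   Context: Let $q=e^{2\pi i\tau}$, $(a;q)_\infty=\prod_{n\ge1}(1-aq^{n-1})$, $(a,b;q)_\infty=(a;q)_\infty(b;q)_\infty$, and for a prime $p$ and $1\le i\le(p-1)/2$, $$K_{p,i}=K_{p,i}(\tau)=q^{\frac{i(i-p)}{2p}}\frac{(q^i,q^{p-i};q^p)_\infty}{(q^p;q^p)_\infty^2},$$ with $q^{x}=e^{2\pi i x\tau}$ for rational $x$. $M_k(\Gamma)$ is the space of holomorphic modular forms of weight $k$ for $\Gamma$; graded algebras are over integer weights. *)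

(* Defs.v *)
From mathcomp Require Import all_boot all_order all_algebra.
From mathcomp Require Import all_classical all_reals all_analysis.
From mathcomp Require Import complex.

Set Implicit Arguments.
Unset Strict Implicit.
Unset Printing Implicit Defensive.

Import Order.TTheory GRing.Theory Num.Theory numFieldNormedType.Exports.

Local Open Scope classical_set_scope.
Local Open Scope ring_scope.
Local Open Scope complex_scope.

Section ModularForms.
Variable R : realType.
Local Notation C := R[i].

Definition upper_half_plane : {pred C} := [pred tau | 0 < complex.Im tau].
Local Notation H := upper_half_plane.

Definition cexp (z : C) : C :=
  (expR (complex.Re z))%:C * (cos (complex.Im z) +i* sin (complex.Im z)).

(* [qpow tau x] is q^x = e^(2 pi i x tau): rational powers of q are determined
   by tau, not by q. *)
Definition qpow (tau : C) (x : rat) : C :=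
  cexp (2 * (pi : R)%:C * (0 +i* 1) * ratr x * tau).

Definition qpochhammer (a q : C) : C :=
  limn ((fun n => \prod_(0 <= m < n) (1 - a * q ^+ m)) : nat -> C^o).

(* Functions on the upper half-plane are represented by total functions
   [C -> C]; their values outside of [H] are irrelevant. *)

Definition holomorphic_on_H (f : C -> C) : Prop :=
  {in H, forall tau, derivable (f : C^o -> C^o) tau 1}.

Definition SL2Z : set 'M[int]_2 := [set g | \det g = 1].

Definition Gamma (N : nat) : set 'M[int]_2 :=
  [set g | SL2Z g /\
    [/\ (g ord0 ord0 = 1 %[mod N])%Z, (g ord0 ord_max = 0 %[mod N])%Z,
        (g ord_max ord0 = 0 %[mod N])%Z & (g ord_max ord_max = 1 %[mod N])%Z]].

Definition Gamma1 (N : nat) : set 'M[int]_2 :=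
  [set g | SL2Z g /\
    [/\ (g ord0 ord0 = 1 %[mod N])%Z,
        (g ord_max ord0 = 0 %[mod N])%Z & (g ord_max ord_max = 1 %[mod N])%Z]].

Definition automorphy (g : 'M[int]_2) (tau : C) : C :=
  (g ord_max ord0)%:~R * tau + (g ord_max ord_max)%:~R.

Definition moebius (g : 'M[int]_2) (tau : C) : C :=
  ((g ord0 ord0)%:~R * tau + (g ord0 ord_max)%:~R) / automorphy g tau.

Definition slash (k : int) (g : 'M[int]_2) (f : C -> C) (tau : C) : C :=
  automorphy g tau ^ (- k) * f (moebius g tau).

(* [f] equals q^r * \sum_(n >= 0) a_n q^(n/h) on the upper half-plane. *)
Definition has_qexp (h : nat) (r : rat) (a : nat -> C) (f : C -> C) : Prop :=
  {in H, forall tau,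
    ((fun n => qpow tau r * \sum_(0 <= m < n) a m * qpow tau (m%:R / h%:R))
       : nat -> C^o) @ \oo --> (f tau : C^o)}.

Definition holomorphic_at_infinity (f : C -> C) : Prop :=
  exists2 h : nat, (0 < h)%N & exists a : nat -> C, has_qexp h 0 a f.

(* M_k(G), for G a congruence subgroup of SL_2(Z); the cusps of G are the
   translates of infinity under SL_2(Z). *)
Definition modular_forms (G : set 'M[int]_2) (k : int) : set (C -> C) :=
  [set f | [/\ holomorphic_on_H f,
               forall g, G g -> {in H, slash k g f =1 f} &
               forall g, SL2Z g -> holomorphic_at_infinity (slash k g f)]].

Definition is_basis (M : set (C -> C)) (vs : seq (C -> C)) : Prop :=
  let comb (c : 'I_(size vs) -> C) (tau : C) :=
    \sum_(i < size vs) c i * nth (fun=> 0) vs i tau in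
  [/\ forall i : 'I_(size vs), M (nth (fun=> 0) vs i),
      forall c, {in H, forall tau, comb c tau = 0} -> forall i, c i = 0 &
      forall f, M f -> exists c, {in H, f =1 comb c}].

(* A graded subalgebra of the direct sum over k : int of the spaces of
   functions on the upper half-plane, given by its homogeneous components. *)
Definition graded_subalgebra (A : int -> set (C -> C)) : Prop :=
  [/\ forall k f g, {in H, f =1 g} -> A k f -> A k g,
      forall k, A k (fun=> 0) /\
        forall (c : C) f g, A k f -> A k g -> A k (fun tau => c * f tau + g tau),
      A 0 (fun=> 1) &
      forall k l f g, A k f -> A l g -> A (k + l) (fun tau => f tau * g tau)].

(* The graded algebra with components [M k] is generated by [S], placed in
   degree 1: it is the least graded subalgebra containing [S]. *)
Definition generated_in_weight1 (M : int -> set (C -> C)) (S : set (C -> C)) :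
    Prop :=
  [/\ graded_subalgebra M, S `<=` M 1 &
      forall A, graded_subalgebra A -> S `<=` A 1 -> forall k, M k `<=` A k].

Definition K (p i : nat) (tau : C) : C :=
  let q := qpow tau in
  q (i%:R * (i%:R - p%:R) / (2 * p%:R)) *
  (qpochhammer (q i%:R) (q p%:R) * qpochhammer (q (p%:R - i%:R)) (q p%:R) /
   qpochhammer (q p%:R) (q p%:R) ^+ 2).

Definition v (j : nat) (tau : C) : C :=
  K 5 1 tau ^ (j%:Z - 3) * K 5 2 tau ^ (2 - j%:Z).

End ModularForms.

(* Main.v *)
(* The functions K 5 i are Klein forms k_(i/5, 0)(5 tau) up to sign, and Klein forms are
   permuted by SL_2(Z) up to the factor (c tau + d)^-1; the only non-elementary input is
   Jacobi's imaginary transformation, obtained from the product of the sine. Hence every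
   v j is in M_1(Gamma(5)), is q^(j/5) times a unit of Z[[q]], and is a unit in q^(1/5) at the
   cusps that are not equivalent to infinity under Gamma_0(5).
     A form of weight -1 on Gamma(5) vanishes: with |F|^2 / Im bounded, the coefficients of F
   are bounded by |F| on lower and lower horizontal lines. Applied to f^5 v_5^(-5k-1) this
   yields a Sturm bound: f in M_k(Gamma(5)) is zero when its first 5k+1 coefficients in
   q^(1/5) vanish. The products of k of the v_j include, for each 0 <= j <= 5k, one with leading
   term q^(j/5), so elimination expresses f through them; for Gamma_1(5), whose forms are
   power series in q, the monomials v_0^(k-i) v_5^i suffice. The decomposition formulas
   follow by comparing six coefficients, since f(tau/5) is in M_k(Gamma(5)) for f in
   M_k(Gamma_1(5)). *)
Require Import Defs.
From mathcomp Require Import all_boot all_order all_algebra.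
From mathcomp Require Import all_classical all_reals all_analysis.
From mathcomp Require Import complex.
From mathcomp Require Import zify ring lra.

Set Implicit Arguments.
Unset Strict Implicit.
Unset Printing Implicit Defensive.

Import Order.TTheory GRing.Theory Num.Theory numFieldNormedType.Exports.

Local Open Scope classical_set_scope.
Local Open Scope ring_scope.
Local Open Scope complex_scope.

(** * Complex sequences and the exponential *)

Section Complex.
Variable R : realType.
Local Notation C := R[i].
Implicit Types (x y z : C) (r s : R).

(** No dimension or valence formula enters. Independence and spanning are both read off from leading
    exponents, and the only upper bound on the spaces is the vanishing in weight -1. The power f^5
    occurs because [v 5] has order 5 in q^(1/5): a zero of f of order 5k+1 then makes up for the
    pole of v_5^(-5k-1). The obstacle in Jacobi's transformation is that the lattice product with
    factors 1 - z^2/w^2 converges only conditionally, so that rows and columns may not be exchanged.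
    For z1^2 + z2^2 = z3^2 the quotient of three such products has factors 1 + O(w^-4), and the
    exchange is legitimate. It yields a multiplicative relation for the defect of the
    transformation, and the triple x, z, x+1 with x = (z^2-1)/2 turns that relation and the period 1
    into triviality. Complex analysis is done on power series alone: derivatives come from division
    of series, coefficient estimates from averages over roots of unity. Units are carried together
    with the series of their inverses, so that negative powers and integrality come at no extra
    cost. *)

Definition nrm z : R := complex.Re `|z|.

Lemma nrmE z : `|z| = (nrm z)%:C.
Proof. by rewrite /nrm normc_def. Qed.

Lemma nrm_sqrt z : nrm z = Num.sqrt (complex.Re z ^+ 2 + complex.Im z ^+ 2).
Proof. by rewrite /nrm normc_def. Qed.

Lemma nrm_ge0 z : 0 <= nrm z.
Proof. by rewrite nrm_sqrt sqrtr_ge0. Qed.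
Hint Resolve nrm_ge0 : core.

Lemma nrmM x y : nrm (x * y) = nrm x * nrm y.
Proof. by apply/complexI; rewrite -nrmE normrM !nrmE rmorphM. Qed.

Lemma nrmD x y : nrm (x + y) <= nrm x + nrm y.
Proof. by rewrite -lecR -nrmE (le_trans (ler_normD _ _))// !nrmE -rmorphD. Qed.

Lemma nrmN x : nrm (- x) = nrm x. Proof. by rewrite /nrm normrN. Qed.

Lemma nrm0 : nrm 0 = 0. Proof. by rewrite /nrm normr0. Qed.

Lemma nrm1 : nrm 1 = 1. Proof. by rewrite /nrm normr1. Qed.

Lemma nrm_eq0 z : (nrm z == 0) = (z == 0).
Proof. by rewrite -[z == 0]normr_eq0 nrmE -(inj_eq (@complexI R)). Qed.

Lemma nrm_gt0 z : (0 < nrm z) = (z != 0).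
Proof. by rewrite lt_neqAle nrm_ge0 andbT eq_sym nrm_eq0. Qed.

Lemma nrmB x y : nrm (x - y) <= nrm x + nrm y.
Proof. by rewrite (le_trans (nrmD _ _))// nrmN. Qed.

Lemma nrmBC x y : nrm (x - y) = nrm (y - x).
Proof. by rewrite -nrmN opprB. Qed.

Lemma nrm_triangle y x z : nrm (x - z) <= nrm (x - y) + nrm (y - z).
Proof. by rewrite (le_trans _ (nrmD _ _))// addrA subrK. Qed.

Lemma nrmV z : nrm z^-1 = (nrm z)^-1.
Proof. by apply/complexI; rewrite -nrmE normfV nrmE fmorphV. Qed.

Lemma nrmX z n : nrm (z ^+ n) = nrm z ^+ n.
Proof. by apply/complexI; rewrite -nrmE normrX nrmE rmorphXn. Qed.

Lemma nrm_real r : nrm r%:C = `|r|.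
Proof. by rewrite nrm_sqrt /= expr0n addr0 sqrtr_sqr. Qed.

Lemma nrm_nat n : nrm n%:R = n%:R.
Proof. by apply/complexI; rewrite -nrmE normr_nat rmorph_nat. Qed.

Lemma nrm_i : nrm 'i = 1.
Proof. by rewrite nrm_sqrt /= expr0n add0r expr1n sqrtr1. Qed.

Lemma Re_le_nrm z : `|complex.Re z| <= nrm z.
Proof. by rewrite nrm_sqrt -sqrtr_sqr ler_wsqrtr // lerDl sqr_ge0. Qed.

Lemma Im_le_nrm z : `|complex.Im z| <= nrm z.
Proof. by rewrite nrm_sqrt -sqrtr_sqr ler_wsqrtr // lerDr sqr_ge0. Qed.

Lemma nrm_le_ReIm z : nrm z <= `|complex.Re z| + `|complex.Im z|.
Proof.
rewrite nrm_sqrt -[leRHS]ger0_norm ?addr_ge0// -sqrtr_sqr ler_wsqrtr //.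
rewrite sqrrD !real_normK ?num_real// lerD2r lerDl.
by rewrite mulrn_wge0 // mulr_ge0.
Qed.

Lemma nrm_sqr z : nrm z ^+ 2 = complex.Re z ^+ 2 + complex.Im z ^+ 2.
Proof. by rewrite nrm_sqrt sqr_sqrtr// addr_ge0 ?sqr_ge0. Qed.

Lemma nrm_sum I (s : seq I) (P : pred I) (F : I -> C) :
  nrm (\sum_(i <- s | P i) F i) <= \sum_(i <- s | P i) nrm (F i).
Proof.
elim/big_rec2: _ => [|i a b _ h]; first by rewrite nrm0.
by rewrite (le_trans (nrmD _ _))// lerD2l.
Qed.

(* Convergence in [C^o], see [cvgCE]; stated over R, and wrapped, to keep unification
   away from the topology of [C^o]. *)
Variant cvgC (u : nat -> C) (l : C) : Prop :=
  CvgC of (fun n => nrm (u n - l)) @ \oo --> (0 : R).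

Lemma cvgCP (u : nat -> C) (l : C) :
  cvgC u l <-> (fun n => nrm (u n - l)) @ \oo --> (0 : R).
Proof. by split=> [[]|]. Qed.

Lemma cvgCE (u : nat -> C) (l : C) :
  ((u : nat -> C^o) @ \oo --> (l : C^o)) <-> cvgC u l.
Proof.
apply: (iff_trans _ (iff_sym (cvgCP u l))).
split=> /cvgrPdist_lt ul; apply/cvgrPdist_lt => e e0.
  have /ul : 0 < e%:C by rewrite ltcR.
  apply: filterS => n; rewrite distrC /= nrmE ltcR sub0r normrN.
  by rewrite ger0_norm.
have er : (complex.Re e)%:C = e by rewrite RRe_real// gtr0_real.
have /ul : 0 < complex.Re e by rewrite -ltcR er.
apply: filterS => n; rewrite sub0r normrN ger0_norm// => h.
by rewrite distrC /= nrmE -er ltcR.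
Qed.

Lemma cvgC_le (u : nat -> C) (l : C) (d : nat -> R) :
  (forall n, nrm (u n - l) <= d n) -> d @ \oo --> (0 : R) ->
  cvgC u l.
Proof.
move=> h d0; apply/cvgCP.
apply: (squeeze_cvgr _ (cvg_cst 0) d0).
by near=> n; rewrite nrm_ge0 h.
Unshelve. all: by end_near. Qed.

Lemma cvgC_nrm (u : nat -> C) (l : C) :
  cvgC u l -> (fun n => nrm (u n)) @ \oo --> nrm l.
Proof.
move=> /cvgCP ul; apply/subr_cvg0/norm_cvg0P.
apply: (squeeze_cvgr _ (cvg_cst 0) ul).
near=> n; rewrite normr_ge0 /= ler_norml.
have := nrmD (u n - l) l; have := nrmD (l - u n) (u n).
by rewrite !subrK nrmBC; lra.
Unshelve. all: end_near. Qed.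

Lemma cvgC_uniq (u : nat -> C) (l l' : C) :
  cvgC u l -> cvgC u (l') ->
  l = l'.
Proof.
move=> /cvgCP h /cvgCP h'; apply/eqP; rewrite -subr_eq0 -nrm_eq0 eq_le nrm_ge0 andbT.
have hh : (fun n => nrm (u n - l) + nrm (u n - l')) @ \oo --> (0 + 0 : R) by apply: cvgD.
rewrite addr0 in hh; apply: (cvgr_to_ge hh).
by near=> n; rewrite /= (le_trans (nrm_triangle (u n) _ _))// nrmBC.
Unshelve. all: end_near. Qed.

Lemma limC_eq (u : nat -> C) (l : C) :
  cvgC u l -> limn (u : nat -> C^o) = l.
Proof.
move=> h; apply: (@cvgC_uniq u _ _ _ h).
by apply/cvgCE/cvg_ex; exists (l : C^o); apply/cvgCE.
Qed.

Lemma cvgC_nrm_le (u : nat -> C) (l : C) (M : R) (N : nat) :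
  cvgC u l ->
  (forall n, (N <= n)%N -> nrm (u n) <= M) -> nrm l <= M.
Proof.
move=> /cvgC_nrm h b; apply: (cvgr_to_le h).
by exists N => // n /= /b.
Qed.

(** Completeness is taken componentwise from [R]. The explicit rate [d] passes to the limit, which
    is what later gives tails of series that are uniform in the point. *)
Lemma cvgC_cauchy (u : nat -> C) (d : nat -> R) :
  (forall n m, (n <= m)%N -> nrm (u m - u n) <= d n) -> d @ \oo --> (0 : R) ->
  exists l, cvgC u l /\ forall n, nrm (l - u n) <= d n.
Proof.
move=> h d0.
have cs (f : C -> R) : (forall x y, f (x - y) = f x - f y) ->
    (forall x, `|f x| <= nrm x) -> cvgn (f \o u).
  move=> fB fn; apply/cauchy_cvgP/cauchy_exP => e e0.
  move/cvgrPdist_lt : d0 => /(_ _ e0) [N _ hN]; exists (f (u N)).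
  exists N => // n /= Nn; rewrite /ball /= -fB.
  rewrite (le_lt_trans (fn _))// nrmBC (le_lt_trans (h _ _ Nn))//.
  by have := hN N (leqnn _); rewrite /= sub0r normrN; apply: le_lt_trans; rewrite ler_norm.
have reB x y : complex.Re (x - y) = complex.Re x - complex.Re y by case: x y => ? ? [].
have imB x y : complex.Im (x - y) = complex.Im x - complex.Im y by case: x y => ? ? [].
have /cvg_ex[/= a ca] := cs _ reB Re_le_nrm.
have /cvg_ex[/= b cb] := cs _ imB Im_le_nrm.
have ul : cvgC u (a +i* b).
  apply/cvgCP; apply: (@squeeze_cvgr _ _ _ _ (cst 0)
      (fun n => `|complex.Re (u n) - a| + `|complex.Im (u n) - b|)).
  - near=> n; rewrite nrm_ge0 (le_trans (nrm_le_ReIm _))//.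
    by rewrite reB imB.
  - exact: cvg_cst.
  - rewrite -[0]addr0; apply: cvgD.
      by apply/norm_cvg0P/subr_cvg0.
    by apply/norm_cvg0P/subr_cvg0.
exists (a +i* b); split=> // n.
have hh : (fun m => nrm (u m - (a +i* b)) + d n) @ \oo --> (0 + d n : R).
  by apply: cvgD; [exact/cvgCP|exact: cvg_cst].
rewrite add0r in hh; apply: (cvgr_to_ge hh).
exists n => // m /= nm; rewrite (le_trans (nrm_triangle (u m) _ _))//.
by rewrite nrmBC lerD2l h.
Unshelve. all: end_near.
Qed.

Lemma cvgC_cst (l : C) : cvgC (fun=> l) l.
Proof. by apply/cvgCP; under eq_fun do rewrite subrr nrm0; exact: cvg_cst. Qed.

Lemma cvgC_D (u w : nat -> C) (l m : C) :
  cvgC u l -> cvgC w m ->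
  cvgC (fun n => u n + w n) (l + m).
Proof.
move=> /cvgCP ul /cvgCP wm.
have h : (fun n => nrm (u n - l) + nrm (w n - m)) @ \oo --> (0 + 0 : R) by apply: cvgD.
apply: (cvgC_le _ (d := fun n => nrm (u n - l) + nrm (w n - m))); last by rewrite addr0 in h.
by move=> n; rewrite opprD addrACA nrmD.
Qed.

Lemma cvgC_M (u w : nat -> C) (l m : C) :
  cvgC u l -> cvgC w m ->
  cvgC (fun n => u n * w n) (l * m).
Proof.
move=> ul /cvgCP wm; have nu := cvgC_nrm ul; move/cvgCP in ul.
have h : (fun n => nrm (u n) * nrm (w n - m) + nrm (u n - l) * nrm m) @ \oo
    --> (nrm l * 0 + 0 * nrm m : R).
  by apply: cvgD; apply: cvgM => //; exact: cvg_cst.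
rewrite mulr0 mul0r addr0 in h; apply: (cvgC_le _ h) => n.
rewrite -!nrmM (le_trans _ (nrmD _ _))// mulrBr mulrBl.
by rewrite addrA subrK.
Qed.

Lemma cvgC_N (u : nat -> C) (l : C) :
  cvgC u l -> cvgC (fun n => - u n) (- l).
Proof.
move=> /cvgCP ul; apply: (cvgC_le _ ul) => n.
by rewrite -opprD nrmN.
Qed.

Lemma cvgC_B (u w : nat -> C) (l m : C) :
  cvgC u l -> cvgC w m ->
  cvgC (fun n => u n - w n) (l - m).
Proof. by move=> ul wm; apply: cvgC_D => //; exact: cvgC_N. Qed.

Lemma cvgC_V (u : nat -> C) (l : C) : l != 0 ->
  cvgC u l -> cvgC (fun n => (u n)^-1) (l^-1).
Proof.
move=> l0 ul; have nu := cvgC_nrm ul; move/cvgCP in ul.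
have nl : 0 < nrm l by rewrite nrm_gt0.
have h : (fun n => nrm (u n - l) * (nrm (u n))^-1 * (nrm l)^-1) @ \oo
    --> (0 * (nrm l)^-1 * (nrm l)^-1 : R).
  apply: cvgM; last exact: cvg_cst.
  by apply: cvgM => //; apply: cvgV => //; rewrite gt_eqF.
rewrite !mul0r in h; apply/cvgCP.
apply: (squeeze_cvgr _ (cvg_cst 0) h).
have [N _ hu] := cvgr_gt _ nu _ nl.
exists N => // n /= /hu; rewrite nrm_gt0 => u0; rewrite nrm_ge0 /=.
have -> : (u n)^-1 - l^-1 = - ((u n - l) / u n / l) by field; rewrite u0 l0.
by rewrite nrmN !nrmM !nrmV.
Qed.

Lemma cvgC_prod (I : Type) (s : seq I) (P : pred I) (u : I -> nat -> C) (l : I -> C) :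
  (forall i, P i -> cvgC (u i) (l i)) ->
  cvgC (fun n => \prod_(i <- s | P i) u i n) (\prod_(i <- s | P i) l i).
Proof.
move=> h; elim: s => [|i s IH].
  rewrite big_nil (_ : (fun _ => _) = fun=> 1); first exact: cvgC_cst.
  by apply/funext => n; rewrite big_nil.
rewrite big_cons (_ : (fun _ => _) = fun n => if P i then u i n * \prod_(j <- s | P j) u j n
  else \prod_(j <- s | P j) u j n); last by apply/funext => n; rewrite big_cons.
by case: ifP => // /h hi; exact: cvgC_M.
Qed.

Lemma cvgC_X (u : nat -> C) (l : C) k :
  cvgC u l -> cvgC (fun n => u n ^+ k) (l ^+ k).
Proof.
move=> h; elim: k => [|k IH]; first exact: cvgC_cst.
rewrite exprS (_ : (fun _ => _) = fun n => u n * u n ^+ k); first exact: cvgC_M.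
by apply/funext => n; rewrite exprS.
Qed.

Lemma cvgC_shift (u : nat -> C) (l : C) k :
  cvgC u l -> cvgC (fun n => u (n + k)%N) (l).
Proof. by move=> /cvgCP h; apply/cvgCP; rewrite (cvg_shiftn k (fun n => nrm (u n - l))). Qed.

Lemma cvgC_eq (u w : nat -> C) (l : C) : u =1 w ->
  cvgC u l -> cvgC w l.
Proof. by move=> /funext ->. Qed.

End Complex.

(** * The complex exponential and its quadratic remainder *)

Section Exponential.
Variable R : realType.
Local Notation C := R[i].
Implicit Types (x y z : C) (r s : R).
Hint Resolve nrm_ge0 : core.

Lemma cexpD x y : cexp (x + y) = cexp x * cexp y :> C.
Proof.
case: x => a b; case: y => c d; rewrite /cexp /= expRD cosD sinD.
by apply/eqP; rewrite eq_complex /=; apply/andP; split; apply/eqP; ring.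
Qed.

Lemma cexp0 : cexp 0 = 1 :> C.
Proof.
by rewrite /cexp /= expR0 cos0 sin0; apply/eqP; rewrite eq_complex /=; apply/andP; split; apply/eqP; ring.
Qed.

Lemma nrm_cexp z : nrm (cexp z) = expR (complex.Re z).
Proof.
rewrite /cexp nrmM nrm_real ger0_norm ?expR_ge0// nrm_sqrt /= cos2Dsin2.
by rewrite sqrtr1 mulr1.
Qed.

Lemma cexp_neq0 z : cexp z != 0.
Proof. by rewrite -nrm_gt0 nrm_cexp expR_gt0. Qed.

Lemma cexpN z : cexp (- z) = (cexp z)^-1.
Proof.
by apply: (mulfI (cexp_neq0 z)); rewrite -cexpD subrr cexp0 divff// cexp_neq0.
Qed.

Lemma abs_sin_le r : `|sin r| <= `|r|.
Proof.
wlog r0 : r / 0 <= r => [h|].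
  have [/h//|/ltW r0] := leP 0 r.
  by rewrite -normrN -sinN -[leRHS]normrN h// oppr_ge0.
have [c|c _] := @MVT_segment R sin cos 0 r r0 (fun t _ => is_derive_sin t).
  by apply: continuous_subspaceT; exact: continuous_sin.
by rewrite sin0 !subr0 => ->; rewrite normrM ler_piMl// cos_max.
Qed.

Lemma one_sub_cos_le r : `|1 - cos r| <= r ^+ 2.
Proof.
have -> : r = (r / 2) *+ 2 by rewrite -mulr_natr divfK.
rewrite cos_mulr2n cos2sin2.
have := abs_sin_le (r / 2); rewrite -[_ <= _](@ler_pXn2r _ 2%N)//.
rewrite !real_normK ?num_real// => h; have := sqr_ge0 (sin (r/2)).
set s := sin _ in h *; move=> s0; rewrite ger0_norm; last by nra.
by rewrite -mulr_natr; nra.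
Qed.

Lemma abs_sin_sub_le r : `|r| <= 1 -> `|sin r - r| <= r ^+ 2.
Proof.
wlog r0 : r / 0 <= r => [h|].
  have [/h//|/ltW r0 r1] := leP 0 r.
  have -> : sin r - r = - (sin (- r) - (- r)) by rewrite sinN; ring.
  by rewrite normrN -[r ^+ 2]sqrrN h ?oppr_ge0// normrN.
rewrite ger0_norm// => r1.
have D t : t \in `]0, r[ -> is_derive t 1 (fun u : R => sin u - u) (cos t - 1).
  by move=> _; exact: is_deriveB.
have Ct : {within `[0, r], continuous (fun u : R => sin u - u)}.
  by apply: continuous_subspaceT => t; apply: cvgB; [exact: continuous_sin|exact: cvg_id].
have [c] := MVT_segment r0 D Ct; rewrite in_itv/= => /andP[c0 cr].
rewrite sin0 !subr0 => ->; rewrite normrM distrC.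
have := one_sub_cos_le c; move: `|1 - _| (normr_ge0 (1 - cos c)) => w w0 wc.
rewrite (ger0_norm r0) expr2; apply: ler_wpM2r => //.
nra.
Qed.

(** Both sides of the estimate come from 1 + x <= exp x, taken at [r] and at [- r], since the two
    values are inverse to each other. *)
Lemma abs_expR_sub_le r : `|r| <= 2^-1 -> `|expR r - 1 - r| <= 2 * r ^+ 2.
Proof.
rewrite ler_norml => /andP[r1 r2].
have e1 := expR_ge1Dx r; have e2 := expR_ge1Dx (- r).
have e3 := expR_gt0 r.
have : expR r * expR (- r) = 1 by rewrite -expRD subrr expR0.
move: (expR r) (expR (- r)) e1 e2 e3 => a b e1 e2 e3 ab.
rewrite ger0_norm; nra.
Qed.

(** Needed for differentiating q-expansions and for the limit of n sin(x/n). The constant 9 is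
    crude; only the order 2 matters. *)
Lemma nrm_cexp_sub_le z : nrm z <= 2^-1 -> nrm (cexp z - 1 - z) <= 9 * nrm z ^+ 2.
Proof.
move=> z1; have h1 := le_trans (Re_le_nrm z) z1; have h2 := le_trans (Im_le_nrm z) z1.
have ha := Re_le_nrm z; have hb := Im_le_nrm z.
case: z z1 h1 h2 ha hb => a b; set N := nrm _; rewrite /= => N1 a1 b1 ha hb.
have N0 : 0 <= N by exact: nrm_ge0.
rewrite (le_trans (nrm_le_ReIm _))//=.
have E := abs_expR_sub_le a1; have Cb := one_sub_cos_le b.
have S : `|sin b - b| <= b ^+ 2 by apply: abs_sin_sub_le; lra.
have A2 : a ^+ 2 <= N ^+ 2 by rewrite -real_normK ?num_real// ler_pXn2r ?nnegrE.
have B2 : b ^+ 2 <= N ^+ 2 by rewrite -[b ^+ 2]real_normK ?num_real// ler_pXn2r ?nnegrE.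
have e2 : 0 <= expR a <= 2.
  rewrite expR_ge0/=; move: E; rewrite ler_norml => /andP[_].
  move: a1; rewrite ler_norml => /andP[]; nra.
rewrite [X in `|X| + _](_ : _ = (expR a - 1 - a) - expR a * (1 - cos b)); last by ring.
rewrite [X in _ + `|X|](_ : _ = expR a * (sin b - b) + (expR a - 1) * b); last by ring.
have h1 := ler_normB (expR a - 1 - a) (expR a * (1 - cos b)).
have h2 := ler_normD (expR a * (sin b - b)) ((expR a - 1) * b).
have h3 : `|expR a - 1| <= 2 * N.
  have -> : expR a - 1 = (expR a - 1 - a) + a by ring.
  rewrite (le_trans (ler_normD _ _))//; nra.
move: h1 h2; rewrite !normrM (ger0_norm (expR_ge0 a)).
move: (normr_ge0 (1 - cos b)) (normr_ge0 (sin b - b)) (normr_ge0 (expR a - 1)) (normr_ge0 b).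
move: `|1 - cos b| `|sin b - b| `|expR a - 1| `|b| Cb S h3 hb => p q r t *.
nra.
Qed.

(* Locked, so that rewriting does not unfold it. *)
Definition ex z : C := locked (cexp (2 * (pi : R)%:C * (0 +i* 1) * z)).

Lemma exE z : ex z = cexp (2 * (pi : R)%:C * (0 +i* 1) * z).
Proof. by rewrite /ex -lock. Qed.

Lemma qpowE (tau : C) (x : rat) : qpow tau x = ex (ratr x * tau).
Proof. by rewrite /qpow exE !mulrA. Qed.

Lemma exD x y : ex (x + y) = ex x * ex y.
Proof. by rewrite !exE mulrDr cexpD. Qed.

Lemma ex0 : ex 0 = 1. Proof. by rewrite exE mulr0 cexp0. Qed.

Lemma ex_neq0 z : ex z != 0. Proof. by rewrite exE cexp_neq0. Qed.
Hint Resolve ex_neq0 : core.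

Lemma exN z : ex (- z) = (ex z)^-1. Proof. by rewrite !exE mulrN cexpN. Qed.

Lemma exB x y : ex (x - y) = ex x / ex y. Proof. by rewrite exD exN. Qed.

Lemma ex_arg r s : 2 * (pi : R)%:C * (0 +i* 1) * (r +i* s) =
  (- (2 * pi * s)) +i* (2 * pi * r) :> C.
Proof.
by apply/eqP; rewrite eq_complex /=; apply/andP; split; apply/eqP; ring.
Qed.

Lemma nrm_ex z : nrm (ex z) = expR (- (2 * pi * complex.Im z)).
Proof. by case: z => a b; rewrite exE nrm_cexp ex_arg. Qed.

Lemma ex_real r : ex r%:C = cos (2 * pi * r) +i* sin (2 * pi * r).
Proof.
by rewrite exE ex_arg /cexp /= mulr0 oppr0 expR0 mul1r.
Qed.

Lemma nrm_ex_real r : nrm (ex r%:C) = 1.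
Proof. by rewrite nrm_ex /= mulr0 oppr0 expR0. Qed.

Lemma exMn z n : ex (n%:R * z) = ex z ^+ n.
Proof.
by elim: n => [|n IH]; rewrite ?mul0r ?ex0// exprS -IH -exD -[n.+1]addn1 natrD mulrDl mul1r addrC.
Qed.

Lemma exMz z (n : int) : ex (n%:~R * z) = ex z ^ n.
Proof.
case: n => n; first exact: exMn.
by rewrite NegzE rmorphN mulNr exN exMn.
Qed.

Lemma ex1 : ex 1 = 1.
Proof.
by rewrite -[1]/(1%:C) ex_real mulr1 mulr_natl cos2pi sin2pi.
Qed.

Lemma ex_int (n : int) : ex n%:~R = 1.
Proof. by rewrite -[n%:~R]mulr1 exMz ex1 exp1rz. Qed.

Lemma ex_half : ex 2^-1 = -1.
Proof.
rewrite -[2]/(2%:R) -(rmorph_nat (real_complex R)) -fmorphV ex_real.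
rewrite mulrAC divff ?mul1r// cospi sinpi.
by apply/eqP; rewrite eq_complex /= oppr0 !eqxx.
Qed.

Lemma ex_real_neq1 r : 0 < r < 1 -> ex r%:C != 1.
Proof.
move=> /andP[r0 r1]; rewrite ex_real eq_complex /= negb_and; apply/orP; left.
have -> : 2 * pi * r = (pi * r) *+ 2 by ring.
rewrite cos_mulr2n cos2sin2.
have : 0 < sin (pi * r).
  by apply: sin_gt0_pi; rewrite mulr_gt0 ?pi_gt0//= gtr_pMr ?pi_gt0.
by move=> s0; apply/eqP; rewrite -mulr_natl; nra.
Qed.

Lemma ex_primitive n : (0 < n)%N -> n.-primitive_root (ex n%:R^-1).
Proof.
move=> n0; apply/andP; split=> //; apply/forallP => i; apply/eqP.
rewrite unity_rootE -exMn; apply/idP/eqP => [|->]; last first.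
  by rewrite divff ?pnatr_eq0 -?lt0n// ex1 eqxx.
move: (ltn_ord i); rewrite leq_eqVlt => /orP[/eqP //|ilt /eqP h].
have : ex ((i.+1%:R / n%:R : R)%:C) != 1.
  apply: ex_real_neq1; rewrite divr_gt0 ?ltr0n//= ltr_pdivrMr ?ltr0n//.
  by rewrite mul1r ltr_nat.
by rewrite rmorphM fmorphV !rmorph_nat h eqxx.
Qed.

Lemma ex_small z : nrm (2 * (pi : R)%:C * (0 +i* 1) * z) <= 2^-1 ->
  nrm (ex z - 1 - 2 * (pi : R)%:C * (0 +i* 1) * z) <=
    9 * nrm (2 * (pi : R)%:C * (0 +i* 1) * z) ^+ 2.
Proof. by rewrite exE; exact: nrm_cexp_sub_le. Qed.

End Exponential.

#[local] Hint Extern 0 (is_true (0 <= nrm _)) => solve [apply: nrm_ge0] : core.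
#[local] Hint Extern 0 (is_true (ex _ != 0)) => solve [apply: ex_neq0] : core.

(** * Power series and infinite products *)

Section PowerSeries.
Variable R : realType.
Local Notation C := R[i].
Implicit Types (a b : nat -> C) (s t : C) (r rho : R).

Definition psum a t n : C := \sum_(0 <= m < n) a m * t ^+ m.

Definition sums a t (l : C) : Prop := cvgC (psum a t) l.

(* Equivalent to convergence on the open unit disc, but stable under the
   Cauchy product without any summation argument. *)
Definition disc_series a : Prop :=
  forall rho, 0 < rho < 1 -> exists M, forall n, nrm (a n) * rho ^+ n <= M.

Lemma geometric_bound r n : 0 <= r < 1 -> \sum_(0 <= m < n) r ^+ m <= (1 - r)^-1.
Proof.
move=> /andP[r0 r1].
have r1' : 0 < 1 - r by rewrite subr_gt0.
rewrite -[leRHS]mul1r ler_pdivlMr// mulrC.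
have -> : (1 - r) * \sum_(0 <= m < n) r ^+ m = 1 - r ^+ n.
  elim: n => [|n IH]; first by rewrite big_nil mulr0 expr0 subrr.
  by rewrite big_nat_recr//= mulrDr IH exprS; ring.
by rewrite gerBl exprn_ge0.
Qed.

Lemma geometric_tail r n m : 0 <= r < 1 ->
  \sum_(n <= k < m) r ^+ k <= r ^+ n / (1 - r).
Proof.
move=> r01; have [nm|mn] := leqP n m; last first.
  rewrite big_geq ?(ltnW mn)//; case/andP: r01 => r0 r1.
  by rewrite divr_ge0 ?exprn_ge0// subr_ge0 ltW.
rewrite -{1}[n]addn0 -(subnKC nm) addnC [(n + _)%N]addnC big_addn addnK.
under eq_bigr do rewrite exprD mulrC.
rewrite -mulr_sumr ler_wpM2l ?geometric_bound//.
by case/andP: r01 => r0 _; rewrite exprn_ge0.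
Qed.

(** The last term is the smallest of the first n+1 terms of the geometric series. The factor n+1 is
    the number of terms in a coefficient of a Cauchy product. *)
Lemma succ_mul_expr_le r n : 0 <= r < 1 -> n.+1%:R * r ^+ n <= (1 - r)^-1.
Proof.
move=> r01; apply: (le_trans _ (geometric_bound n.+1 r01)).
rewrite mulr_natl -[in leLHS](subn0 n.+1) -sumr_const_nat ler_sum_nat// => i /andP[_ ilt].
by case/andP: r01 => r0 r1; rewrite ler_wiXn2l// ltW.
Qed.

Lemma cvg_expr0 r (M : R) : 0 <= r < 1 -> (fun n => M * r ^+ n) @ \oo --> (0 : R).
Proof.
move=> /andP[r0 r1]; rewrite -[0](mulr0 M); apply: cvgM; first exact: cvg_cst.
by apply: cvg_expr; rewrite ger0_norm.
Qed.

Lemma psum_tail a (M rho rho' : R) t n m :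
  (forall n, nrm (a n) * rho' ^+ n <= M) -> 0 <= rho < rho' -> nrm t <= rho -> (n <= m)%N ->
  nrm (psum a t m - psum a t n) <= M / (1 - rho / rho') * (rho / rho') ^+ n.
Proof.
move=> hM /andP[r0 rr] tr nm.
have r'0 : 0 < rho' by exact: le_lt_trans rr.
have M0 : 0 <= M by apply: le_trans (hM 0%N); rewrite expr0 mulr1 nrm_ge0.
have q01 : 0 <= rho / rho' < 1.
  by rewrite divr_ge0 ?(ltW r'0)//= ltr_pdivrMr// mul1r.
have -> : psum a t m - psum a t n = \sum_(n <= k < m) a k * t ^+ k.
  by apply/eqP; rewrite subr_eq addrC /psum -big_cat_nat.
rewrite (le_trans (nrm_sum _ _ _))//.
apply: (@le_trans _ _ (\sum_(n <= k < m) M * (rho / rho') ^+ k)).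
  apply: ler_sum => k _; rewrite nrmM nrmX expr_div_n.
  rewrite mulrA ler_pdivlMr ?exprn_gt0// mulrAC.
  have e : nrm t ^+ k <= rho ^+ k by rewrite lerXn2r ?nnegrE ?nrm_ge0.
  have e' := hM k; have e0 : 0 <= rho ^+ k by rewrite exprn_ge0.
  have e1 : 0 <= nrm (a k) * rho' ^+ k by rewrite mulr_ge0 ?nrm_ge0 ?exprn_ge0 ?(ltW r'0).
  by apply: ler_pM; rewrite ?exprn_ge0 ?nrm_ge0.
rewrite -mulr_sumr -mulrA ler_wpM2l// [_^-1 * _]mulrC.
exact: geometric_tail.
Qed.

Lemma sums_tail a (M rho rho' : R) t :
  (forall n, nrm (a n) * rho' ^+ n <= M) -> 0 <= rho < rho' -> nrm t <= rho ->
  exists2 l, sums a t l &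
    forall n, nrm (l - psum a t n) <= M / (1 - rho / rho') * (rho / rho') ^+ n.
Proof.
move=> hM rr tr; have q01 : 0 <= rho / rho' < 1.
  case/andP: rr => r0 rr; have r'0 : 0 < rho' by exact: le_lt_trans rr.
  by rewrite divr_ge0 ?(ltW r'0)//= ltr_pdivrMr// mul1r.
have [l [cl bl]] := cvgC_cauchy (fun n m nm => psum_tail hM rr tr nm) (cvg_expr0 _ q01).
by exists l.
Qed.

Lemma disc_series_sums a rho rho' : disc_series a -> 0 <= rho < rho' -> rho' < 1 ->
  exists2 M : R, 0 <= M & forall t, nrm t <= rho -> exists2 l, sums a t l &
    forall n, nrm (l - psum a t n) <= M * (rho / rho') ^+ n.
Proof.
move=> ha rr r1; have [r0 r0'] := andP rr; have r'0 : 0 < rho' by exact: le_lt_trans r0'.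
have [|M hM] := ha rho'; first by rewrite r'0.
exists (M / (1 - rho / rho')); last by move=> t tr; exact: sums_tail.
have M0 : 0 <= M by apply: le_trans (hM 0%N); rewrite expr0 mulr1 nrm_ge0.
by rewrite divr_ge0// subr_ge0 ler_pdivrMr// mul1r ltW.
Qed.

Lemma disc_series_cvg a t : disc_series a -> nrm t < 1 -> exists l, sums a t l.
Proof.
move=> ha t1; pose rho' := (nrm t + 1) / 2.
have [||M _ /(_ t (lexx _)) [l]] := @disc_series_sums a (nrm t) rho' ha; rewrite ?/rho'.
- by rewrite nrm_ge0 /=; lra.
- by lra.
by exists l.
Qed.

Lemma sums_uniq a t l l' : sums a t l -> sums a t l' -> l = l'.
Proof. exact: cvgC_uniq. Qed.

Lemma sums_eq a b t l : a =1 b -> sums a t l -> sums b t l.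
Proof.
move=> ab; rewrite /sums (_ : psum a t = psum b t)//.
by apply/funext => n; apply: eq_bigr => i _; rewrite ab.
Qed.

Lemma sumsD a b t l l' : sums a t l -> sums b t l' ->
  sums (fun n => a n + b n) t (l + l').
Proof.
move=> ha hb; rewrite /sums (_ : psum _ t = (fun n => psum a t n + psum b t n)); last first.
  by apply/funext => n; rewrite /psum -big_split/=; apply: eq_bigr => i _; rewrite mulrDl.
exact: cvgC_D.
Qed.

Lemma sumsZ (c : C) a t l : sums a t l -> sums (fun n => c * a n) t (c * l).
Proof.
move=> ha; rewrite /sums (_ : psum _ t = (fun n => c * psum a t n)); last first.
  by apply/funext => n; rewrite /psum mulr_sumr; apply: eq_bigr => i _; rewrite mulrA.
by apply: cvgC_M => //; exact: cvgC_cst.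
Qed.

Lemma sums_poly a t N : (forall m, (N <= m)%N -> a m = 0) -> sums a t (psum a t N).
Proof.
move=> aN; apply/cvgCP/cvgrPdist_lt => e e0; exists N => // n /= Nn.
have -> : psum a t n = psum a t N.
  rewrite /psum (big_cat_nat (n := N) (p := n))//= [X in _ + X]big_nat [X in _ + X]big1 ?addr0//.
  by move=> i /andP[/aN -> _]; rewrite mul0r.
by rewrite subrr nrm0 subrr normr0.
Qed.

(** A term is a difference of two partial sums, and these are bounded. One convergent point on each
    circle is enough, which frees every later q-expansion from checking growth. *)
Lemma disc_series_of_cvg a :
  (forall rho, 0 < rho < 1 -> exists t l, nrm t = rho /\ sums a t l) -> disc_series a.
Proof.
move=> h rho /h [t [l [<- cl]]].
have [M hM] : exists M, forall n, nrm (psum a t n) <= M.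
  have /cvg_seq_bounded : cvgn (fun n => nrm (psum a t n)).
    by apply/cvg_ex; exists (nrm l); exact: cvgC_nrm.
  case=> M [_ /(_ (M + 1))]; rewrite ltrDl ltr01 => /(_ isT) hM.
  by exists (M + 1) => n; have /= := hM n I; rewrite ger0_norm.
exists (M + M) => n; rewrite -nrmX -nrmM.
have -> : a n * t ^+ n = psum a t n.+1 - psum a t n.
  by rewrite /psum big_nat_recr//= [X in _ = X - _]addrC addrK.
by rewrite (le_trans (nrmB _ _))// lerD.
Qed.

End PowerSeries.

(** * Cauchy products, division and coefficient bounds *)

Section SeriesProducts.
Variable R : realType.
Local Notation C := R[i].
Implicit Types (a b : nat -> C) (s t : C) (r rho : R).

Definition conv a b n : C := \sum_(i < n.+1) a i * b (n - i)%N.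

Lemma triangle_sum (V : nmodType) (F : nat -> nat -> V) N :
  \sum_(0 <= n < N) \sum_(i < n.+1) F i (n - i)%N =
  \sum_(0 <= i < N) \sum_(0 <= j < N - i) F i j.
Proof.
elim: N => [|N IH]; first by rewrite !big_nil.
rewrite big_nat_recr//= IH [RHS]big_nat_recr//= subSn// subnn big_nat1.
rewrite -(big_mkord xpredT (fun i => F i (N - i)%N)) big_nat_recr//= subnn addrA.
congr (_ + _); rewrite -big_split/=; apply: eq_big_nat => i /andP[_ iN].
by rewrite subSn ?(ltnW iN)// big_nat_recr.
Qed.

Lemma psum_conv a b t N :
  psum (conv a b) t N = \sum_(0 <= i < N) a i * t ^+ i * psum b t (N - i).
Proof.
rewrite /psum; under [RHS]eq_bigr do rewrite mulr_sumr.
rewrite -(triangle_sum (fun i j => a i * t ^+ i * (b j * t ^+ j))).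
apply: eq_big_nat => n _; rewrite /conv mulr_suml; apply: eq_bigr => i _.
have -> : t ^+ n = t ^+ i * t ^+ (n - i) by rewrite -exprD subnKC// -ltnS.
by ring.
Qed.

Lemma disc_series_conv a b : disc_series a -> disc_series b -> disc_series (conv a b).
Proof.
move=> ha hb rho /andP[r0 r1]; pose rho1 := (rho + 1) / 2.
have q0 : 0 < rho1 by rewrite /rho1; lra.
have [|Ma hMa] := ha rho1; first by rewrite /rho1; apply/andP; split; lra.
have [|Mb hMb] := hb rho1; first by rewrite /rho1; apply/andP; split; lra.
have Ma0 : 0 <= Ma by apply: le_trans (hMa 0%N); rewrite expr0 mulr1.
have q01 : 0 <= rho / rho1 < 1.
  by rewrite divr_ge0 ?(ltW r0) ?(ltW q0)//= ltr_pdivrMr// mul1r /rho1; lra.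
exists (Ma * Mb * (1 - rho / rho1)^-1) => n.
have h (u : nat -> C) M i : (forall n, nrm (u n) * rho1 ^+ n <= M) ->
    nrm (u i) * rho ^+ i <= M * (rho / rho1) ^+ i.
  move=> hu; rewrite expr_div_n mulrA ler_pdivlMr ?exprn_gt0// mulrAC.
  by rewrite ler_wpM2r// exprn_ge0// ltW.
apply: (@le_trans _ _ (\sum_(i < n.+1) Ma * Mb * (rho / rho1) ^+ n)).
  apply: (@le_trans _ _ (\sum_(i < n.+1) nrm (a i * b (n - i)%N) * rho ^+ n)).
    by rewrite -mulr_suml ler_wpM2r ?exprn_ge0 ?(ltW r0)// /conv nrm_sum.
  apply: ler_sum => i _; have ni : (i <= n)%N by rewrite -ltnS.
  have e k : k ^+ n = k ^+ i * k ^+ (n - i) :> R by rewrite -exprD subnKC.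
  rewrite !e nrmM mulrACA [leRHS]mulrACA.
  by apply: ler_pM; rewrite ?h ?mulr_ge0 ?exprn_ge0 ?(ltW r0).
rewrite sumr_const card_ord -mulr_natl mulrCA ler_wpM2l//.
  by rewrite mulr_ge0//; apply: le_trans (hMb 0%N); rewrite expr0 mulr1.
exact: succ_mul_expr_le.
Qed.

(** Mertens' argument with rates. By [psum_conv] the error is the sum of a_i t^i times the tail of
    [b] from N-i on; with |t| < r1 < r2 < 1 each term is at most a constant times (|t|/r1)^N
    (r1/r2)^i, which is summable in i and tends to 0 with N. *)
Lemma sums_conv a b t l l' : disc_series a -> disc_series b -> nrm t < 1 ->
  sums a t l -> sums b t l' -> sums (conv a b) t (l * l').
Proof.
move=> ha hb t1 sa sb.
pose r1 := (nrm t + 1) / 2; pose r2 := (r1 + 1) / 2.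
have t0 := nrm_ge0 t.
have q1 : 0 < r1 by rewrite /r1; lra.
have q2 : 0 < r2 by rewrite /r2; lra.
have [||Mb Mb0 /(_ t (lexx _)) [lb sb' hMb]] := @disc_series_sums _ b (nrm t) r1 hb.
- by rewrite t0 /r1 /=; lra.
- by rewrite /r1; lra.
rewrite -(sums_uniq sb sb') {sb'} in hMb *.
have [|Ma hMa] := ha r2; first by rewrite /r2 /r1; apply/andP; split; lra.
have Ma0 : 0 <= Ma by apply: le_trans (hMa 0%N); rewrite expr0 mulr1.
have q01 : 0 <= nrm t / r1 < 1.
  by rewrite divr_ge0 ?(ltW q1)//= ltr_pdivrMr// mul1r /r1; lra.
have q12 : 0 <= r1 / r2 < 1.
  by rewrite divr_ge0 ?(ltW q1) ?(ltW q2)//= ltr_pdivrMr// mul1r /r2 /r1; lra.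
have hA : cvgC (fun N => psum a t N * l') (l * l').
  by apply: cvgC_M => //; exact: cvgC_cst.
suff : cvgC (fun N => psum (conv a b) t N - psum a t N * l') 0.
  move=> h; have := cvgC_D h hA; rewrite add0r; apply: cvgC_eq => N.
  by rewrite subrK.
apply: (cvgC_le _ (@cvg_expr0 _ (nrm t / r1) (Ma * Mb / (1 - r1 / r2)) q01)) => N.
rewrite subr0 psum_conv /psum mulr_suml -sumrB.
rewrite (le_trans (nrm_sum _ _ _))//.
apply: (@le_trans _ _ (\sum_(0 <= i < N) Ma * Mb * (nrm t / r1) ^+ N * (r1 / r2) ^+ i)).
  rewrite !big_nat; apply: ler_sum => i /andP[_ iN].
  rewrite -mulrBr nrmM nrmBC nrmM nrmX.
  have -> : (nrm t / r1) ^+ N = (nrm t / r1) ^+ i * (nrm t / r1) ^+ (N - i).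
    by rewrite -exprD subnKC// ltnW.
  have -> : Ma * Mb * ((nrm t / r1) ^+ i * (nrm t / r1) ^+ (N - i)) * (r1 / r2) ^+ i
     = (Ma * (nrm t / r2) ^+ i) * (Mb * (nrm t / r1) ^+ (N - i)).
    have -> : (nrm t / r2) ^+ i = (nrm t / r1) ^+ i * (r1 / r2) ^+ i.
      by rewrite -exprMn mulrA divfK ?gt_eqF.
    by ring.
  apply: ler_pM => //; [by rewrite mulr_ge0 ?exprn_ge0| |exact: hMb].
  rewrite expr_div_n mulrA ler_pdivlMr ?exprn_gt0// mulrAC.
  by rewrite ler_wpM2r// exprn_ge0.
rewrite -mulr_sumr mulrAC ler_wpM2r ?exprn_ge0//; first by case/andP: q01.
  have := geometric_bound N q12.
  by move=> h; rewrite ler_wpM2l// mulr_ge0.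
Qed.

Lemma div_expr_rescale (M r r' T : R) n : r' != 0 -> T != 0 ->
  M * (T / r') ^+ n.+1 / T ^+ n.+1 * r ^+ n = M / r' * (r / r') ^+ n.
Proof.
move=> r'0 T0; rewrite !expr_div_n !exprS.
have : T ^+ n != 0 by rewrite expf_neq0.
have : r' ^+ n != 0 by rewrite expf_neq0.
move: (T ^+ n) (r' ^+ n) => x y y0 x0.
by field; rewrite y0 x0 r'0 T0.
Qed.

(** Synthetic division: the quotient has the coefficients b_n, the sum of a_m t^(m-n-1) over m > n.
    These are the tails at [t] divided by t^(n+1), so they inherit the geometric decay of the
    tails. *)
Lemma disc_series_quotient a t l : disc_series a -> t != 0 -> nrm t < 1 -> sums a t l ->
  exists2 b, disc_series b & forall s ls h, nrm s < 1 ->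
    sums a s ls -> sums b s h -> ls - l = (s - t) * h.
Proof.
move=> ha t0 t1 sl.
pose c n : C := (l - psum a t n) / t ^+ n.
have cS n : t * c n.+1 = c n - a n.
  rewrite /c /psum big_nat_recr//= exprS.
  by field; rewrite expf_neq0 t0.
have hb : disc_series (fun n => c n.+1).
  move=> rho /andP[r0 r1]; pose m := Num.max rho (nrm t).
  have rm : rho <= m by rewrite le_max lexx.
  have tm : nrm t <= m by rewrite le_max lexx orbT.
  have m1 : m < 1 by rewrite gt_max r1.
  pose r' := (m + 1) / 2.
  have r'0 : 0 < r' by rewrite /r'; lra.
  have [||M M0 /(_ t (lexx _)) [l' sl' hM]] := @disc_series_sums _ a (nrm t) r' ha.
  - by rewrite nrm_ge0 /r' /=; lra.
  - by rewrite /r'; lra.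
  rewrite -(sums_uniq sl sl') in hM; exists (M / r') => n.
  have tn : 0 < nrm t by rewrite nrm_gt0.
  rewrite /c nrmM nrmV nrmX.
  apply: (@le_trans _ _ (M * (nrm t / r') ^+ n.+1 / nrm t ^+ n.+1 * rho ^+ n)).
    rewrite ler_wpM2r ?exprn_ge0 ?(ltW r0)// ler_wpM2r ?invr_ge0 ?exprn_ge0//.
  have -> : M * (nrm t / r') ^+ n.+1 / nrm t ^+ n.+1 * rho ^+ n = M / r' * (rho / r') ^+ n.
    by rewrite div_expr_rescale ?gt_eqF.
  apply: ler_piMr; first by rewrite divr_ge0 ?(ltW r'0).
  apply: exprn_ile1; first by rewrite divr_ge0 ?(ltW r'0) ?(ltW r0).
  by rewrite ler_pdivrMr// mul1r /r'; lra.
exists (fun n => c n.+1) => // s ls h s1 sls sh.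
have E N : (s - t) * psum (fun n => c n.+1) s N = psum a s N - l + c N * s ^+ N.
  elim: N => [|N IH].
    by rewrite /psum !big_nil /c /psum big_nil subr0 !expr0 divr1 mulr1 mulr0 sub0r addNr.
  rewrite /psum big_nat_recr//= mulrDr -/(psum _ _ _) IH big_nat_recr//= -/(psum _ _ _).
  have := cS N; rewrite exprS => /(congr1 (fun x => x * s ^+ N)) /=.
  rewrite mulrBl => e.
  have -> : (s - t) * (c N.+1 * s ^+ N) = c N.+1 * (s * s ^+ N) - t * c N.+1 * s ^+ N by ring.
  by rewrite e; ring.
have L1 : cvgC (fun N => (s - t) * psum (fun n => c n.+1) s N) ((s - t) * h).
  by apply: cvgC_M => //; exact: cvgC_cst.
have L2 : cvgC (fun N => c N.+1 * s ^+ N.+1) 0.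
  pose r1 := (nrm s + 1) / 2.
  have s0 := nrm_ge0 s.
  have [|M hM] := hb r1; first by rewrite /r1; apply/andP; split; lra.
  have r10 : 0 < r1 by rewrite /r1; lra.
  have q01 : 0 <= nrm s / r1 < 1.
    by rewrite divr_ge0 ?(ltW r10)//= ltr_pdivrMr// mul1r /r1; lra.
  apply: (cvgC_le _ (@cvg_expr0 _ (nrm s / r1) M q01)) => N.
  rewrite subr0 nrmM nrmX exprS mulrCA.
  apply: (@le_trans _ _ (nrm (c N.+1) * nrm s ^+ N)).
    by rewrite ler_piMl ?mulr_ge0 ?exprn_ge0// ltW.
  rewrite expr_div_n mulrA ler_pdivlMr ?exprn_gt0// mulrAC.
  by rewrite ler_wpM2r ?exprn_ge0.
have L3 : cvgC (fun N => psum a s (N + 1)%N - l) (ls - l).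
  by apply: cvgC_B; [exact: cvgC_shift|exact: cvgC_cst].
have := cvgC_D L3 L2; rewrite addr0 => L4.
apply: (cvgC_uniq L4); apply: (cvgC_eq _ (cvgC_shift 1 L1)) => N.
by rewrite E addn1.
Qed.

Lemma disc_series_bounded a rho : disc_series a -> 0 <= rho < 1 ->
  exists2 M : R, 0 <= M & forall t l, nrm t <= rho -> sums a t l -> nrm l <= M.
Proof.
move=> ha /andP[r0 r1]; pose r' := (rho + 1) / 2.
have [||M M0 hM] := @disc_series_sums _ a rho r' ha.
- by rewrite r0 /r' /=; lra.
- by rewrite /r'; lra.
exists M => // t l tr sl; have [l' sl' /(_ 0%N)] := hM _ tr.
by rewrite (sums_uniq sl sl') expr0 mulr1 /psum big_nil subr0.
Qed.

(** Dividing by s - t twice gives the Taylor remainder of order 2; the derivative [d] is the value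
    of the first quotient at [t]. *)
Lemma disc_series_diff a t rho : disc_series a -> t != 0 -> nrm t < rho -> rho < 1 ->
  exists d K, forall s ls lt, nrm s <= rho -> sums a s ls -> sums a t lt ->
    nrm (ls - lt - d * (s - t)) <= K * nrm (s - t) ^+ 2.
Proof.
move=> ha t0 tr r1; have t1 := lt_trans tr r1.
have [l sl] := disc_series_cvg ha t1.
have [b hb Eb] := disc_series_quotient ha t0 t1 sl.
have [d sd] := disc_series_cvg hb t1.
have [b' hb' Eb'] := disc_series_quotient hb t0 t1 sd.
have [|K K0 hK] := @disc_series_bounded b' rho hb'.
  by rewrite r1 andbT (le_trans _ (ltW tr)).
exists d, K => s ls lt sr sls slt; rewrite (sums_uniq slt sl).
have s1 := le_lt_trans sr r1.
have [h sh] := disc_series_cvg hb s1; have [h' sh'] := disc_series_cvg hb' s1.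
rewrite (Eb _ _ _ s1 sls sh) [d * _]mulrC -mulrBr (Eb' _ _ _ s1 sh sh') mulrA -expr2.
by rewrite nrmM nrmX mulrC ler_wpM2r ?exprn_ge0// (hK s).
Qed.

(* Averaging over the [N]-th roots of unity isolates one coefficient, so that no
   contour integral is needed. *)
Lemma coeff_bound a t (B : R) m : disc_series a -> nrm t < 1 ->
  (forall (x : R) l, sums a (t * ex x%:C) l -> nrm l <= B) ->
  nrm (a m) * nrm t ^+ m <= B.
Proof.
move=> ha t1 hB; pose r' := (nrm t + 1) / 2; have t0 := nrm_ge0 t.
have r'0 : 0 < r' by rewrite /r'; lra.
have [||M M0 hM] := @disc_series_sums _ a (nrm t) r' ha.
- by rewrite t0 /r' /=; lra.
- by rewrite /r'; lra.
have q01 : 0 <= nrm t / r' < 1.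
  by rewrite divr_ge0 ?(ltW r'0)//= ltr_pdivrMr// mul1r /r'; lra.
(* Truncation after N terms costs a geometric tail but makes the average exact: all exponents are
   below N, so the N-th roots of unity separate them. Then N tends to infinity. *)
have H : forall N, (m < N)%N -> nrm (a m) * nrm t ^+ m <= B + M * (nrm t / r') ^+ N.
  move=> N mN; have N0 : (0 < N)%N by apply: leq_ltn_trans mN.
  have zp := ex_primitive R N0; set z := ex _ in zp.
  have z0 : z != 0 by exact: ex_neq0.
  have nz k : nrm (z ^+ k) = 1.
    rewrite nrmX (_ : nrm z = 1) ?expr1n// /z -(rmorph_nat (real_complex R)) -fmorphV.
    by rewrite nrm_ex_real.
  have avg : \sum_(j < N) z ^- (j * m) * psum a (t * z ^+ j) N = N%:R * (a m * t ^+ m).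
    rewrite /psum; under eq_bigr do rewrite mulr_sumr.
    rewrite exchange_big/=.
    have inner k : \sum_(j < N) z ^- (j * m) * (a k * (t * z ^+ j) ^+ k) =
        a k * t ^+ k * \sum_(j < N) (z ^+ k / z ^+ m) ^+ j.
      rewrite mulr_sumr; apply: eq_bigr => j _.
      rewrite [(t * _) ^+ k]exprMn expr_div_n -!exprM [(k * j)%N]mulnC [(m * j)%N]mulnC.
      by move: (z ^+ (j * k)) (z ^- (j * m)) => x y; ring.
    under eq_bigr do rewrite inner.
    rewrite (bigD1_seq m) ?mem_index_iota ?iota_uniq//= [X in _ + X]big_nat_cond [X in _ + X]big1 ?addr0.
      under eq_bigr do rewrite divff ?expf_neq0// expr1n.
      by rewrite sumr_const card_ord mulrC.
    move=> k /andP[/andP[_ kN] km]; set w := _ / _.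
    have w1 : w != 1.
      apply/eqP => /divr1_eq /eqP; rewrite (eq_prim_root_expr zp) !modn_small//.
      by apply/negP.
    have : (w - 1) * \sum_(j < N) w ^+ j = 0.
      by rewrite -subrX1 /w expr_div_n -!exprM ![(_ * N)%N]mulnC !exprM (prim_expr_order zp) !expr1n divr1 subrr.
    by move/eqP; rewrite mulf_eq0 subr_eq0 (negbTE w1)/= => /eqP ->; rewrite mulr0.
  have : nrm (N%:R * (a m * t ^+ m)) <= N%:R * (B + M * (nrm t / r') ^+ N).
    rewrite -avg (le_trans (nrm_sum _ _ _))//.
    apply: (@le_trans _ _ (\sum_(j < N) (B + M * (nrm t / r') ^+ N))).
      apply: ler_sum => j _; rewrite nrmM nrmV nz invr1 mul1r.
      have tj : nrm (t * z ^+ j) <= nrm t by rewrite nrmM nz mulr1.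
      have [l sl /(_ N) hl] := hM _ tj.
      have -> : psum a (t * z ^+ j) N = l - (l - psum a (t * z ^+ j) N) by ring.
      rewrite (le_trans (nrmB _ _))// lerD// (hB (j%:R / N%:R))//.
      by rewrite rmorphM fmorphV !rmorph_nat exMn.
    by rewrite sumr_const card_ord mulr_natl.
  by rewrite nrmM nrm_nat ler_pM2l ?ltr0n// nrmM nrmX.
have hc : (fun N => B + M * (nrm t / r') ^+ N) @ \oo --> (B + 0 : R).
  by apply: cvgD; [exact: cvg_cst|exact: cvg_expr0].
rewrite addr0 in hc; apply: (cvgr_to_ge hc).
by exists m.+1.
Qed.

End SeriesProducts.

(** * Infinite products of power series *)

Section InfiniteProducts.
Variable R : realType.
Local Notation C := R[i].
Implicit Types (a b : nat -> C) (s t : C) (r rho : R).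

Fixpoint pprod (f : nat -> nat -> C) N : nat -> C :=
  if N is N'.+1 then conv (pprod f N') (f N') else fun m => (m == 0%N)%:R.

Definition iprod f m : C := pprod f m m.

(** The shape 1 + O(t^(n+1)) makes the m-th coefficient of the partial products constant from index
    m on, so that [iprod] is a diagonal; the bound 1 on the coefficients gives a majorant common to
    all products. *)
Definition is_factor n a : Prop :=
  [/\ a 0%N = 1, forall m, (0 < m <= n)%N -> a m = 0 & forall m, nrm (a m) <= 1].

(** A truncated weighted l1 norm; it is submultiplicative for [conv]. *)
Definition wsum a rho L : R := \sum_(0 <= m < L) nrm (a m) * rho ^+ m.

Lemma wsum_conv a b rho L : 0 <= rho ->
  wsum (conv a b) rho L <= wsum a rho L * wsum b rho L.
Proof.
move=> r0; have rn n : 0 <= rho ^+ n by rewrite exprn_ge0.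
pose F i j := (nrm (a i) * rho ^+ i) * (nrm (b j) * rho ^+ j).
have F0 i j : 0 <= F i j by rewrite !mulr_ge0.
apply: (@le_trans _ _ (\sum_(0 <= n < L) \sum_(i < n.+1) F i (n - i)%N)).
  apply: ler_sum => n _.
  apply: (@le_trans _ _ ((\sum_(i < n.+1) nrm (a i * b (n - i)%N)) * rho ^+ n)).
    by rewrite ler_wpM2r// nrm_sum.
  rewrite mulr_suml; apply: ler_sum => i _.
  have -> : rho ^+ n = rho ^+ i * rho ^+ (n - i) by rewrite -exprD subnKC// -ltnS.
  by rewrite nrmM mulrACA.
rewrite triangle_sum {1}/wsum mulr_suml; apply: ler_sum => i _.
rewrite /wsum mulr_sumr (big_cat_nat (n := (L - i)%N) (p := L))//= ?leq_subr//.
by rewrite lerDl sumr_ge0// => j _; exact: F0.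
Qed.

Lemma wsum_factor n a rho L : is_factor n a -> 0 <= rho < 1 ->
  wsum a rho L <= expR (rho ^+ n.+1 / (1 - rho)).
Proof.
move=> [a0 an a1] /andP[r0 r1]; have rn k : 0 <= rho ^+ k by rewrite exprn_ge0.
apply: le_trans (expR_ge1Dx _).
case: L => [|L].
  rewrite /wsum big_nil addr_ge0// divr_ge0// subr_ge0 ltW//.
rewrite /wsum big_nat_recl//= a0 nrm1 mul1r expr0 lerD2l.
rewrite -(big_add1 _ _ 0%N L.+1 xpredT (fun i => nrm (a i) * rho ^+ i)).
have [Ln|nL] := leqP L n.
  rewrite big_nat big1; first by rewrite divr_ge0// subr_ge0 ltW.
  move=> i /andP[i0 iL]; rewrite an ?nrm0 ?mul0r// i0 /=.
  by apply: leq_trans Ln; rewrite -ltnS.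
rewrite (big_cat_nat (n := n.+1) (p := L.+1))//= ?ltnS ?(ltnW nL)// big_nat big1 ?add0r.
  apply: (@le_trans _ _ (\sum_(n.+1 <= i < L.+1) rho ^+ i)).
    by apply: ler_sum => i _; rewrite ler_piMl.
  by apply: geometric_tail; rewrite r0.
by move=> i /andP[i0 iL]; rewrite an ?nrm0 ?mul0r// i0 -ltnS.
Qed.

Section OneProduct.
Variable f : nat -> nat -> C.
Hypothesis ff : forall n, is_factor n (f n).

(** The n-th factor has norm at most exp(rho^(n+1)/(1 - rho)), and the exponents add up to at most
    (1 - rho)^-2, whatever the number of factors. *)
Lemma wsum_pprod N rho L : 0 <= rho < 1 ->
  wsum (pprod f N) rho L <= expR ((1 - rho)^-1 / (1 - rho)).
Proof.
move=> r01; have [r0 r1] := andP r01; have r1' : 0 < 1 - rho by rewrite subr_gt0.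
apply: (@le_trans _ _ (expR (\sum_(0 <= n < N) rho ^+ n.+1 / (1 - rho)))); last first.
  rewrite ler_expR -mulr_suml ler_wpM2r ?invr_ge0 ?(ltW r1')//.
  apply: le_trans (geometric_bound N r01); apply: ler_sum => i _.
  by rewrite exprS ler_piMl ?exprn_ge0// ltW.
elim: N => [|N IH].
  rewrite big_nil expR0 /wsum; case: L => [|L]; first by rewrite big_nil.
  rewrite big_nat_recl//= nrm1 expr0 mulr1 big1 ?addr0// => i _.
  by rewrite nrm0 mul0r.
rewrite big_nat_recr//= expRD; apply: le_trans (wsum_conv _ _ _ r0) _.
apply: ler_pM => //; last exact: wsum_factor.
- by rewrite sumr_ge0// => i _; rewrite mulr_ge0 ?exprn_ge0.
- by rewrite sumr_ge0// => i _; rewrite mulr_ge0 ?exprn_ge0.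
Qed.

Lemma pprod_bound N rho m : 0 <= rho < 1 ->
  nrm (pprod f N m) * rho ^+ m <= expR ((1 - rho)^-1 / (1 - rho)).
Proof.
move=> r01; apply: le_trans (wsum_pprod N m.+1 r01); rewrite /wsum big_nat_recr//=.
rewrite lerDr sumr_ge0// => i _; rewrite mulr_ge0 ?exprn_ge0//.
by case/andP: r01.
Qed.

Lemma disc_series_pprod N : disc_series (pprod f N).
Proof.
move=> rho /andP[/ltW r0 r1]; exists (expR ((1 - rho)^-1 / (1 - rho))) => n.
by apply: pprod_bound; rewrite r0.
Qed.

Lemma disc_series_iprod : disc_series (iprod f).
Proof.
move=> rho /andP[/ltW r0 r1]; exists (expR ((1 - rho)^-1 / (1 - rho))) => n.
by apply: pprod_bound; rewrite r0.
Qed.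

Lemma iprodE N m : (m <= N)%N -> iprod f m = pprod f N m.
Proof.
move=> /subnK <-; elim: (N - m)%N => [//|k ->].
rewrite addSn /= /conv big_ord_recr/= subnn; case: (ff (k + m)%N) => -> f0 _.
rewrite mulr1 big1 ?add0r// => i _.
by rewrite f0 ?mulr0// subn_gt0 ltn_ord /= (leq_trans (leq_subr _ _))// leq_addl.
Qed.

Lemma disc_series_factor n : disc_series (f n).
Proof.
move=> rho /andP[/ltW r0 /ltW r1]; exists 1 => m; case: (ff n) => _ _ h.
by rewrite mulr_ile1// ?exprn_ge0// exprn_ile1.
Qed.

Lemma sums_pprod N t (F : nat -> C) : nrm t < 1 -> (forall n, sums (f n) t (F n)) ->
  sums (pprod f N) t (\prod_(0 <= n < N) F n).
Proof.
move=> t1 hF; elim: N => [|N IH].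
  have -> : \prod_(0 <= n < 0) F n = psum (pprod f 0) t 1.
    by rewrite /psum big_nat1 big_nil /= expr0 mulr1.
  by apply: sums_poly => -[].
rewrite big_nat_recr//=; apply: sums_conv => //; [exact: disc_series_pprod|exact: disc_series_factor].
Qed.

(** The first N coefficients of [pprod f N] are those of [iprod f]. Hence the N-th partial product
    and the sum of the limit series both lie within the same geometric tail of one polynomial
    value. *)
Lemma sums_iprod t (F : nat -> C) : nrm t < 1 -> (forall n, sums (f n) t (F n)) ->
  exists2 l, sums (iprod f) t l & cvgC (fun N => \prod_(0 <= n < N) F n) l.
Proof.
move=> t1 hF; have t0 := nrm_ge0 t.
have [l sl] := disc_series_cvg disc_series_iprod t1.
exists l => //; pose rho := (nrm t + 1) / 2.
have rr : 0 <= nrm t < rho by rewrite t0 /rho /=; lra.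
have r01 : 0 <= rho < 1 by rewrite /rho; lra.
have q01 : 0 <= nrm t / rho < 1.
  have r'0 : 0 < rho by rewrite /rho; lra.
  by rewrite divr_ge0 ?(ltW r'0)//= ltr_pdivrMr// mul1r /rho; lra.
set B := expR ((1 - rho)^-1 / (1 - rho)).
have T N : nrm (\prod_(0 <= n < N) F n - psum (pprod f N) t N) <=
    B / (1 - nrm t / rho) * (nrm t / rho) ^+ N.
  have [l' sl' hl'] := sums_tail (fun m => pprod_bound N m r01) rr (lexx _).
  by rewrite (sums_uniq (sums_pprod N t1 hF) sl').
have [l' sl' hl'] := sums_tail (fun m => pprod_bound m m r01) rr (lexx _).
rewrite -(sums_uniq sl sl') {l' sl'} in hl'.
have e N : psum (fun m => pprod f m m) t N = psum (pprod f N) t N.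
  by apply: eq_big_nat => i /andP[_ /ltnW iN]; rewrite -(iprodE iN).
apply: (cvgC_le _ (cvg_expr0 (B / (1 - nrm t / rho) + B / (1 - nrm t / rho)) q01)) => N.
rewrite mulrDl (le_trans (nrm_triangle (psum (pprod f N) t N) _ _))// lerD//.
by rewrite nrmBC -e hl'.
Qed.

End OneProduct.

End InfiniteProducts.

(** * q-expansions *)

Section QExpansions.
Variable R : realType.
Local Notation C := R[i].
Implicit Types (a b : nat -> C) (s t tau : C) (r rho : R) (f g : C -> C).

Lemma cvgC_subseq (u : nat -> C) (l : C) (p : nat -> nat) :
  (forall n, (n <= p n)%N) -> cvgC u l -> cvgC (fun n => u (p n)) l.
Proof.
move=> hp /cvgCP/cvgrPdist_lt h; apply/cvgCP/cvgrPdist_lt => e /h[N _ hN].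
by exists N => // n /= Nn; apply: hN; apply: leq_trans (hp n).
Qed.

(** The substitution of t^k for t in the series with coefficients [a]. *)
Definition spread k a m : C := if (k %| m)%N then a (m %/ k)%N else 0.

Lemma disc_series_spread k a : (0 < k)%N -> disc_series a -> disc_series (spread k a).
Proof.
move=> k0 ha rho /andP[r0 r1]; have [|M hM] := ha (rho ^+ k).
  by rewrite exprn_gt0//= exprn_ilt1 ?(ltW r0)// -lt0n.
exists M => m; rewrite /spread; case: ifP => [/divnK {2}<-|_].
  by rewrite mulnC exprM.
by rewrite nrm0 mul0r; apply: le_trans (hM 0%N); rewrite expr0 mulr1.
Qed.

Lemma psum_spread k a t N : (0 < k)%N ->
  psum (spread k a) t (k * N)%N = psum a (t ^+ k) N.
Proof.
case: k => // k _; elim: N => [|N IH]; first by rewrite muln0 /psum !big_nil.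
rewrite mulnS addnC /psum (big_cat_nat (n := (k.+1 * N)%N)) ?leq_addr//= -/(psum _ _ _) IH.
rewrite /psum big_nat_recr//=; congr (_ + _).
rewrite -{1}[(k.+1 * N)%N]add0n big_addn addKn big_nat_recl//= add0n /spread dvdn_mulr// mulKn//.
rewrite big_nat big1 ?addr0 ?exprM// => i /andP[_ ik].
by rewrite dvdn_addl ?dvdn_mulr// gtnNdvd// mul0r.
Qed.

Lemma sums_spread k a t l : (0 < k)%N -> disc_series a -> nrm t < 1 ->
  sums a (t ^+ k) l -> sums (spread k a) t l.
Proof.
move=> k0 ha t1 sl.
have [l' sl'] := disc_series_cvg (disc_series_spread k0 ha) t1.
suff -> : l = l' by [].
have := @cvgC_subseq _ _ (fun n => (k * n)%N) (fun n => leq_pmull n k0) sl'.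
by apply: cvgC_uniq; apply: cvgC_eq sl => N; rewrite psum_spread.
Qed.

(** The local parameter q^(1/h). *)
Definition tq (h : nat) tau : C := ex (tau / h%:R).

Lemma Im_divn tau n : complex.Im (tau / n%:R) = complex.Im tau / n%:R.
Proof.
by rewrite -(rmorph_nat (real_complex R)) -fmorphV; case: tau => x y /=; ring.
Qed.

Lemma nrm_tq h tau : nrm (tq h tau) = expR (- (2 * pi * (complex.Im tau / h%:R))).
Proof. by rewrite nrm_ex Im_divn. Qed.

Lemma nrm_tq_lt1 h tau : (0 < h)%N -> 0 < complex.Im tau -> nrm (tq h tau) < 1.
Proof.
move=> h0 t0; rewrite nrm_tq expR_lt1 oppr_lt0 mulr_gt0 ?divr_gt0 ?ltr0n//.
by rewrite mulr_gt0// pi_gt0.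
Qed.

Lemma tq_neq0 h tau : tq h tau != 0. Proof. exact: ex_neq0. Qed.

Lemma qpow_tq h m tau : qpow tau (m%:R / h%:R) = tq h tau ^+ m.
Proof.
rewrite qpowE /tq -exMn; congr ex.
have -> : ratr (m%:R / h%:R) = m%:R / h%:R :> C by rewrite rmorphM/= fmorphV/= !ratr_nat.
by rewrite mulrAC mulrA.
Qed.

(** [has_qexp] with exponent 0, together with the growth condition that products, derivatives and
    coefficient bounds require; [QE_of_sums] shows that the condition is automatic. *)
Definition QE h a f : Prop :=
  disc_series a /\ forall tau, 0 < complex.Im tau -> sums a (tq h tau) (f tau).

(** The points i y of the imaginary axis realise every radius between 0 and 1; [y] solves exp(-2 pi
    y/h) = rho. *)
Lemma QE_of_sums h a f : (0 < h)%N ->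
  (forall tau, 0 < complex.Im tau -> sums a (tq h tau) (f tau)) -> QE h a f.
Proof.
move=> h0 S; split=> //; apply: disc_series_of_cvg => rho /andP[r0 r1].
pose y := - (h%:R * ln rho / (2 * pi)).
have y0 : 0 < y.
  by rewrite oppr_gt0 pmulr_llt0 ?invr_gt0 ?mulr_gt0 ?pi_gt0// pmulr_rlt0 ?ltr0n// ln_lt0// r0.
exists (tq h (0 +i* y)), (f (0 +i* y)); split; last exact: S.
rewrite nrm_tq /= /y -[RHS]lnK ?posrE//; congr expR.
have p0 : (pi : R) != 0 by rewrite gt_eqF ?pi_gt0.
by move: (pi : R) p0 => p p0; field; rewrite p0 pnatr_eq0 -lt0n h0.
Qed.

Lemma has_qexp_QE h a f : (0 < h)%N -> has_qexp h 0 a f -> QE h a f.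
Proof.
move=> h0 hf; apply: QE_of_sums => // tau t0.
have /cvgCE := hf tau t0; apply: cvgC_eq => n.
rewrite qpowE rmorph0 mul0r ex0 mul1r.
by apply: eq_bigr => i _; rewrite qpow_tq.
Qed.

Lemma QE_has_qexp h a f (x : rat) : QE h a f -> has_qexp h x a (fun tau => qpow tau x * f tau).
Proof.
move=> [_ S] tau t0; apply/cvgCE.
apply: (cvgC_eq (u := fun n => qpow tau x * psum a (tq h tau) n)).
  by move=> n; congr (_ * _); apply: eq_bigr => i _; rewrite qpow_tq.
by apply: cvgC_M; [exact: cvgC_cst|exact: S].
Qed.

Lemma QE_eq h a b f g : a =1 b -> (forall tau, 0 < complex.Im tau -> f tau = g tau) ->
  QE h a f -> QE h b g.
Proof. by move=> /funext -> fg [d S]; split=> // tau t0; rewrite -fg//; exact: S. Qed.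

Lemma QE_D h a b f g : QE h a f -> QE h b g -> QE h (fun n => a n + b n) (fun tau => f tau + g tau).
Proof.
move=> [da Sa] [db Sb]; split=> [rho hr|tau t0]; last by apply: sumsD; [exact: Sa|exact: Sb].
have [M hM] := da _ hr; have [M' hM'] := db _ hr; exists (M + M') => n.
have r0 : 0 <= rho by case/andP: hr => /ltW.
rewrite (le_trans (ler_wpM2r (exprn_ge0 _ r0) (nrmD _ _)))// mulrDl lerD//.
Qed.

Lemma QE_Z h (c : C) a f : QE h a f -> QE h (fun n => c * a n) (fun tau => c * f tau).
Proof.
move=> [da Sa]; split=> [rho hr|tau t0]; last by apply: sumsZ; exact: Sa.
have [M hM] := da _ hr; exists (nrm c * M) => n.
by rewrite nrmM -mulrA ler_wpM2l.
Qed.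

Definition delta0 : nat -> C := fun m => (m == 0%N)%:R.

Lemma QE_1 h : QE h delta0 (fun=> 1).
Proof.
split=> [rho /andP[r0 r1]|tau t0].
  exists 1 => -[|n]; first by rewrite nrm1 mul1r expr0.
  by rewrite nrm0 mul0r.
have -> : 1 = psum delta0 (tq h tau) 1 by rewrite /psum big_nat1 expr0 mulr1.
by apply: sums_poly => -[].
Qed.

Lemma QE_M h a b f g : (0 < h)%N -> QE h a f -> QE h b g ->
  QE h (conv a b) (fun tau => f tau * g tau).
Proof.
move=> h0 [da Sa] [db Sb]; split=> [|tau t0]; first exact: disc_series_conv.
by apply: sums_conv; rewrite ?nrm_tq_lt1//; [exact: Sa|exact: Sb].
Qed.

Lemma QE_spread h k a f : (0 < h)%N -> (0 < k)%N -> QE h a f -> QE (h * k) (spread k a) f.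
Proof.
move=> h0 k0 [da Sa]; split=> [|tau t0]; first exact: disc_series_spread.
apply: sums_spread => //; first by rewrite nrm_tq_lt1// muln_gt0 h0.
rewrite (_ : _ ^+ k = tq h tau); first exact: Sa.
rewrite -exMn; congr ex; rewrite natrM; field.
by rewrite !pnatr_eq0 -!lt0n h0 k0.
Qed.

Lemma QE_mulz h k a f : (0 < h)%N -> (0 < k)%N -> QE h a f ->
  QE h (spread k a) (fun tau => f (k%:R * tau)).
Proof.
move=> h0 k0 [da Sa]; split=> [|tau t0]; first exact: disc_series_spread.
apply: sums_spread => //; first by rewrite nrm_tq_lt1.
rewrite (_ : _ ^+ k = tq h (k%:R * tau)); last by rewrite -exMn mulrA.
apply: Sa; rewrite -(rmorph_nat (real_complex R)); case: tau t0 => x y /= y0.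
by rewrite mul0r addr0 mulr_gt0 ?ltr0n.
Qed.

Lemma QE_divz h k a f : (0 < h)%N -> (0 < k)%N -> QE h a f ->
  QE (h * k) a (fun tau => f (tau / k%:R)).
Proof.
move=> h0 k0 [da Sa]; split=> // tau t0.
rewrite (_ : tq _ _ = tq h (tau / k%:R)); first by apply: Sa; rewrite Im_divn divr_gt0 ?ltr0n.
by congr ex; rewrite natrM invfM mulrA mulrAC.
Qed.

Lemma QE_shift h r a f : (0 < h)%N -> QE h a f ->
  QE h (fun m => a m * ex (r%:C / h%:R) ^+ m) (fun tau => f (tau + r%:C)).
Proof.
move=> h0 [da Sa]; split=> [rho hr|tau t0].
  have [M hM] := da _ hr; exists M => n.
  rewrite nrmM nrmX -(rmorph_nat (real_complex R)) -fmorphV -rmorphM nrm_ex_real.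
  by rewrite expr1n mulr1.
have /Sa : 0 < complex.Im (tau + r%:C) by case: tau t0 => x y /=; rewrite addr0.
apply: cvgC_eq => n; apply: eq_bigr => i _.
by rewrite /tq mulrDl exD exprMn mulrA mulrAC.
Qed.

(** Translating by h x turns the parameter by the angle 2 pi x, so a bound on one horizontal line is
    a bound on a full circle. *)
Lemma QE_coeff_bound h a f (y B : R) m : (0 < h)%N -> QE h a f -> 0 < y ->
  (forall x : R, nrm (f (x +i* y)) <= B) ->
  nrm (a m) * expR (- (2 * pi * (y / h%:R))) ^+ m <= B.
Proof.
move=> h0 [da Sa] y0 hB.
have -> : expR (- (2 * pi * (y / h%:R))) = nrm (tq h (0 +i* y)) by rewrite nrm_tq.
apply: (@coeff_bound _ a _ B m da); first exact: nrm_tq_lt1.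
move=> x l sl; have := Sa ((h%:R * x) +i* y) y0.
have -> : tq h ((h%:R * x) +i* y) = tq h (0 +i* y) * ex x%:C.
  rewrite -exD; congr ex.
  have -> : (h%:R * x) +i* y = (0 +i* y) + h%:R * x%:C.
    by rewrite -(rmorph_nat (real_complex R)); apply/eqP; rewrite eq_complex /=; apply/andP; split; apply/eqP; ring.
  by field; rewrite pnatr_eq0 -lt0n h0.
by move=> s'; rewrite (sums_uniq sl s').
Qed.

Lemma QE_0 h a f : (0 < h)%N -> QE h a f ->
  (forall tau, 0 < complex.Im tau -> f tau = 0) -> forall m, a m = 0.
Proof.
move=> h0 qa f0 m; apply/eqP; rewrite -nrm_eq0 eq_le nrm_ge0 andbT.
have := QE_coeff_bound (y := 1) (B := 0) m h0 qa ltr01.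
rewrite pmulr_lle0 ?exprn_gt0 ?expR_gt0//; apply.
by move=> x; rewrite f0 ?nrm0.
Qed.

Lemma QE_inj h a b f g : (0 < h)%N -> QE h a f -> QE h b g ->
  (forall tau, 0 < complex.Im tau -> f tau = g tau) -> a =1 b.
Proof.
move=> h0 qa qb fg m; apply/eqP; rewrite -subr_eq0; apply/eqP.
have := QE_D qa (QE_Z (-1) qb) => /(QE_0 h0) /(_ _ m).
rewrite mulN1r; apply => tau t0; rewrite fg// mulN1r subrr//.
Qed.

Lemma derivable_quadratic f tau (D : C) (K d : R) : 0 < d ->
  (forall e, nrm e < d -> nrm (f (tau + e) - f tau - D * e) <= K * nrm e ^+ 2) ->
  derivable (f : C^o -> C^o) tau 1.
Proof.
move=> d0 h; apply/cvg_ex; exists (D : C^o); apply/cvgrPdist_lt => e e0.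
have er : (complex.Re e)%:C = e by rewrite RRe_real// gtr0_real.
have e0' : 0 < complex.Re e by rewrite -ltcR er.
pose K' := `|K| + 1; have K0 : 0 < K' by rewrite ltr_wpDl.
pose d' := Num.min d (complex.Re e / K').
have d'0 : 0 < d' by rewrite lt_min d0 divr_gt0.
exists d'%:C; first by rewrite /= ltcR.
move=> u /=; rewrite sub0r normrN nrmE ltcR lt_min => /andP[ud ue] u0.
rewrite -[_ *: _]/(u^-1 * _) -[u *: _]/(u * 1) mulr1 [u + tau]addrC.
have -> : D - u^-1 * (f (tau + u) - f tau) = - ((f (tau + u) - f tau - D * u) / u) by field.
rewrite normrN nrmE -er ltcR nrmM nrmV.
have u0' : 0 < nrm u by rewrite nrm_gt0.
rewrite ltr_pdivrMr//; apply: le_lt_trans (h _ ud) _.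
rewrite expr2 mulrA ltr_pM2r//.
move: ue; rewrite ltr_pdivlMr// mulrC; apply: le_lt_trans.
rewrite ler_wpM2r// /K'; apply: le_trans (ler_norm K) _; rewrite lerDl//.
Qed.

(** The chain rule by hand: the quadratic remainders of the power series and of the exponential
    combine into one of the composite. *)
Lemma QE_derivable h a f tau : (0 < h)%N -> QE h a f -> 0 < complex.Im tau ->
  derivable (f : C^o -> C^o) tau 1.
Proof.
move=> h0 [da Sa] t0.
have t1 := nrm_tq_lt1 h0 t0; set t := tq h tau in t1 *.
pose rho := (nrm t + 1) / 2; have tn := nrm_ge0 t.
have [||d [K hK]] := @disc_series_diff _ a t rho da (tq_neq0 _ _); first by rewrite /rho; lra.
  by rewrite /rho; lra.
pose c : C := 2 * (pi : R)%:C * (0 +i* 1) / h%:R.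
have c0 : 0 < nrm c.
  rewrite nrm_gt0 mulf_neq0 ?invr_eq0 ?pnatr_eq0 -?lt0n//.
  by rewrite !mulf_neq0 ?pnatr_eq0//; apply/eqP => -[]/eqP; rewrite ?oner_eq0 ?gt_eqF ?pi_gt0.
have exc e : nrm c * nrm e <= 2^-1 ->
    nrm (ex (e / h%:R) - 1 - c * e) <= 9 * (nrm c * nrm e) ^+ 2.
  have := @ex_small _ (e / h%:R).
  have -> : 2 * (pi : R)%:C * (0 +i* 1) * (e / h%:R) = c * e by rewrite /c mulrA mulrAC.
  by rewrite nrmM.
clearbody c.
(* The three bounds keep [tau + e] in the half-plane, make the estimate of the exponential
   applicable, and keep the parameter within the radius [rho]. *)
pose dl := Num.min (complex.Im tau) (Num.min (2^-1 / nrm c) ((rho - nrm t) / (6 * nrm c))).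
have dl0 : 0 < dl.
  rewrite !lt_min t0 !divr_gt0 ?mulr_gt0 ?invr_gt0//= subr_gt0 /rho; lra.
apply: (@derivable_quadratic f tau (d * t * c) (`|K| * (36 * nrm c ^+ 2) + nrm d * (9 * nrm c ^+ 2)) dl) => //.
move=> e; rewrite !lt_min => /and3P[e1 e2 e3].
have ce : nrm c * nrm e <= 2^-1 by move: e2; rewrite ltr_pdivlMr// mulrC => /ltW.
have ce' : 6 * (nrm c * nrm e) <= rho - nrm t.
  by move: e3; rewrite ltr_pdivlMr ?mulr_gt0// => /ltW; rewrite mulrC mulrA.
have te : 0 < complex.Im (tau + e).
  have := le_lt_trans (Im_le_nrm e) e1; rewrite ltr_norml => /andP[h1 _].
  by case: tau e h1 {t0 t t1 rho tn hK dl dl0 e1 e2 e3 ce ce'} => x y [z w] /=; rewrite -ltrBlDl sub0r.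
have h1 := exc e ce; set w := ex (e / h%:R) in h1.
have tw : tq h (tau + e) = t * w by rewrite /tq mulrDl exD.
have n0 := nrm_ge0 c; have e0 := nrm_ge0 e.
(* The constant 6 arises because 9x^2 + x <= 6x for 0 <= x <= 1/2. *)
have w1 : nrm (w - 1) <= 6 * (nrm c * nrm e).
  have -> : w - 1 = (w - 1 - c * e) + c * e by ring.
  apply: le_trans (nrmD _ _) _; rewrite nrmM.
  have : 0 <= nrm c * nrm e by rewrite mulr_ge0.
  move: (nrm c * nrm e) ce h1 => x x1 h1 x0; nra.
have tw' : nrm (t * w) <= rho.
  have -> : t * w = t * (w - 1) + t by ring.
  apply: le_trans (nrmD _ _) _; rewrite nrmM.
  have := nrm_ge0 (w - 1); nra.
have := hK _ _ _ tw' (_ : sums a (t * w) (f (tau + e))) (Sa _ t0).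
rewrite -tw => /(_ (Sa _ te)); rewrite tw => hq.
have -> : f (tau + e) - f tau - d * t * c * e =
  (f (tau + e) - f tau - d * (t * w - t)) + d * t * (w - 1 - c * e) by ring.
apply: le_trans (nrmD _ _) _; rewrite mulrDl; apply: lerD.
  apply: le_trans hq _; have -> : t * w - t = t * (w - 1) by ring.
  apply: (@le_trans _ _ (`|K| * nrm (t * (w - 1)) ^+ 2)).
    by rewrite ler_wpM2r ?exprn_ge0 ?ler_norm.
  rewrite -[leRHS]mulrA; apply: ler_wpM2l => //; rewrite nrmM.
  have := nrm_ge0 (w - 1); move: w1; rewrite mulrA; move: (nrm (w - 1)) => x x1 x0.
  rewrite [leLHS](_ : _ = nrm t ^+ 2 * x ^+ 2); last by ring.
  have : nrm t ^+ 2 <= 1 by rewrite expr_le1// ltW.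
  have : x ^+ 2 <= (6 * nrm c * nrm e) ^+ 2 by rewrite lerXn2r ?nnegrE ?mulr_ge0.
  have := sqr_ge0 x; have := sqr_ge0 (nrm t).
  have -> : (6 * nrm c * nrm e) ^+ 2 = 36 * nrm c ^+ 2 * nrm e ^+ 2 by ring.
  by move: (nrm t ^+ 2) (x ^+ 2) (36 * nrm c ^+ 2 * nrm e ^+ 2) => *; nra.
rewrite !nrmM -!mulrA; apply: ler_wpM2l => //.
rewrite -[leRHS]mul1r; apply: ler_pM; [exact: nrm_ge0|exact: nrm_ge0|exact: ltW|].
by apply: le_trans h1 _; rewrite exprMn; lra.
Qed.

End QExpansions.

(** * Units among q-expansions and Pochhammer symbols *)

Section Units.
Variable R : realType.
Local Notation C := R[i].
Implicit Types (a b : nat -> C) (s t tau : C) (r rho : R) (f g : C -> C).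
Implicit Types (P : C -> Prop).

Definition is_subring P : Prop :=
  [/\ P 1, forall x y, P x -> P y -> P (x - y) & forall x y, P x -> P y -> P (x * y)].

Section Subring.
Variable P : C -> Prop.
Hypothesis HP : is_subring P.

Lemma subring1 : P 1. Proof. by case: HP. Qed.
Lemma subringM x y : P x -> P y -> P (x * y). Proof. by case: HP => _ _; apply. Qed.
Lemma subring0 : P 0. Proof. by case: HP => h hB _; rewrite -(subrr 1); apply: hB. Qed.
Lemma subringN x : P x -> P (- x).
Proof. by move=> hx; case: HP => _ hB _; rewrite -sub0r; apply: hB => //; exact: subring0. Qed.
Lemma subringD x y : P x -> P y -> P (x + y).
Proof.
by move=> hx hy; case: HP => _ hB _; rewrite -(opprK y); apply: hB => //; exact: subringN.
Qed.
Lemma subringX x n : P x -> P (x ^+ n).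
Proof.
by move=> hx; elim: n => [|n IH]; rewrite ?exprS; [exact: subring1|exact: subringM].
Qed.

Lemma subring_conv a b : (forall m, P (a m)) -> (forall m, P (b m)) -> forall m, P (conv a b m).
Proof.
move=> ha hb m; rewrite /conv; elim/big_ind: _ => //; first exact: subring0.
  exact: subringD.
by move=> i _; exact: subringM.
Qed.

Lemma subring_iprod (F : nat -> nat -> C) :
  (forall n m, P (F n m)) -> forall m, P (iprod F m).
Proof.
move=> hf m; rewrite /iprod; move: {2}m => k.
elim: m k => [|N IH] k /=; last exact: subring_conv.
by case: (k == 0%N); [exact: subring1|exact: subring0].
Qed.

End Subring.

Definition lin_series (c : C) k m : C := if m == 0%N then 1 else if m == k then - c else 0.

Definition geo_series (c : C) k : nat -> C := spread k (fun m => c ^+ m).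

Lemma sums_lin c k t : (0 < k)%N -> sums (lin_series c k) t (1 - c * t ^+ k).
Proof.
move=> k0; have -> : 1 - c * t ^+ k = psum (lin_series c k) t k.+1.
  rewrite /psum big_nat_recl//= /lin_series /= expr0 mulr1; congr (_ + _).
  case: k k0 => // k _; rewrite big_nat_recr//= eqxx big_nat big1 ?add0r ?mulNr//.
  by move=> i /andP[_ ik]; rewrite eqSS ltn_eqF// mul0r.
apply: sums_poly => m km; rewrite /lin_series.
by rewrite (gtn_eqF km) gtn_eqF// (leq_ltn_trans _ km).
Qed.

Lemma sums_geo c k t : (0 < k)%N -> nrm c <= 1 -> nrm t < 1 ->
  sums (geo_series c k) t (1 - c * t ^+ k)^-1.
Proof.
move=> k0 c1 t1; have tk : nrm (c * t ^+ k) < 1.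
  rewrite nrmM nrmX; apply: (@le_lt_trans _ _ (nrm t ^+ k)).
    by rewrite ler_piMl ?exprn_ge0.
  by rewrite exprn_ilt1// -lt0n.
have n0 : 1 - c * t ^+ k != 0.
  by apply: contraTneq tk => /eqP; rewrite subr_eq0 => /eqP <-; rewrite nrm1 ltxx.
apply: sums_spread => //.
  move=> rho /andP[/ltW r0 /ltW r1]; exists 1 => n.
  by rewrite nrmX mulr_ile1 ?exprn_ge0 ?exprn_ile1.
move: (t ^+ k) n0 tk => s n0 tk.
apply: (cvgC_eq (u := fun n => (1 - (c * s) ^+ n) * (1 - c * s)^-1)).
  move=> n; apply: (mulIf n0); rewrite divfK//.
  rewrite /psum; elim: n => [|n IH]; first by rewrite big_nil mul0r expr0 subrr.
  by rewrite big_nat_recr//= mulrDl -IH exprS exprMn; ring.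
rewrite -[X in cvgC _ X]mul1r; apply: cvgC_M; last exact: cvgC_cst.
rewrite -[X in cvgC _ X]subr0; apply: cvgC_B; first exact: cvgC_cst.
have q : 0 <= nrm (c * s) < 1 by rewrite nrm_ge0.
by apply: (cvgC_le _ (cvg_expr0 1 q)) => n; rewrite subr0 nrmX mul1r.
Qed.

Lemma lin_factor c k n : (n < k)%N -> nrm c <= 1 -> is_factor n (lin_series c k).
Proof.
move=> nk c1; split=> // m; rewrite /lin_series.
  by move=> /andP[m0 mn]; rewrite gtn_eqF// ltn_eqF// (leq_ltn_trans mn).
by case: eqP => _; rewrite ?nrm1//; case: eqP => _; rewrite ?nrmN// nrm0.
Qed.

Lemma geo_factor c k n : (n < k)%N -> nrm c <= 1 -> is_factor n (geo_series c k).
Proof.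
move=> nk c1; have k0 : (0 < k)%N by exact: leq_ltn_trans nk.
split=> [|m /andP[m0 mn]|m]; rewrite /geo_series /spread.
- by rewrite dvdn0 div0n expr0.
- by rewrite gtnNdvd// (leq_ltn_trans mn).
- by case: ifP => _; rewrite ?nrm0// nrmX exprn_ile1.
Qed.

Section SmallPochhammer.
Variables (c : C) (i d : nat).
Hypotheses (i0 : (0 < i)%N) (d0 : (0 < d)%N) (c1 : nrm c <= 1).

(** The n-th factor of the Pochhammer symbol starts beyond exponent n, as [is_factor] demands. *)
Let nk n : (n < i + d * n)%N.
Proof.
by apply: (@leq_ltn_trans (d * n)); rewrite ?leq_pmull// -{1}[(d * n)%N]add0n ltn_add2r.
Qed.

Let k0 n : (0 < i + d * n)%N. Proof. exact: leq_ltn_trans (nk n). Qed.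

Definition poch_series n := lin_series c (i + d * n).
Definition inv_poch_series n := geo_series c (i + d * n).

Lemma poch_factor n : is_factor n (poch_series n).
Proof. exact: lin_factor. Qed.

Lemma inv_poch_factor n : is_factor n (inv_poch_series n).
Proof. exact: geo_factor. Qed.

(** The inverse is built as the infinite product of the geometric series of the factors. The partial
    products multiply to 1, hence so do the limits, which also shows that the limit does not
    vanish. *)
Lemma qpochhammer_small t : nrm t < 1 ->
  let l := qpochhammer (c * t ^+ i) (t ^+ d) in
  [/\ sums (iprod poch_series) t l, sums (iprod inv_poch_series) t l^-1, l != 0 &
      cvgC (fun N => \prod_(0 <= m < N) (1 - c * t ^+ i * (t ^+ d) ^+ m)) l].
Proof.
move=> t1 /=.
have [l sl cl] := sums_iprod poch_factor t1 (fun n => sums_lin c t (k0 n)).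
have [l' sl' cl'] := sums_iprod inv_poch_factor t1 (fun n => sums_geo (k0 n) c1 t1).
have cl2 : cvgC (fun N => \prod_(0 <= m < N) (1 - c * t ^+ i * (t ^+ d) ^+ m)) l.
  by apply: cvgC_eq cl => N; apply: eq_bigr => n _; rewrite exprD exprM mulrA.
have -> : qpochhammer (c * t ^+ i) (t ^+ d) = l by exact: limC_eq.
have ll : l * l' = 1.
  apply: (cvgC_uniq (cvgC_M cl cl')).
  apply: cvgC_eq (cvgC_cst 1) => N; rewrite -big_split /= big1// => n _.
  rewrite divff//; apply/eqP => /eqP; rewrite subr_eq0 => /eqP e.
  have := @nrm1 R; rewrite e nrmM nrmX => e1.
  have : nrm c * nrm t ^+ (i + d * n) < 1.
    apply: (@le_lt_trans _ _ (nrm t ^+ (i + d * n))); first by rewrite ler_piMl ?exprn_ge0.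
    by rewrite exprn_ilt1// -lt0n.
  by rewrite e1 ltxx.
have l0 : l != 0 by apply/eqP => l0; move/eqP: ll; rewrite l0 mul0r eq_sym oner_eq0.
by split=> //; rewrite -(mulr1 l^-1) -ll mulKf.
Qed.

End SmallPochhammer.

(** Units 1 + ... in q^(1/h) with coefficients in the subring [P]. Recording the series of the
    inverse makes the notion stable under all integer powers. [P] is the set of integers for the
    integrality of [v j], and everything at the cusps away from infinity. *)
Definition unitQ h P f : Prop := exists a b,
  [/\ QE h a f, QE h b (fun tau => (f tau)^-1), a 0%N = 1 /\ b 0%N = 1,
      forall tau, 0 < complex.Im tau -> f tau != 0 & forall m, P (a m) /\ P (b m)].

Section UnitTheory.
Variables (h : nat) (P : C -> Prop).
Hypothesis (h0 : (0 < h)%N) (HP : is_subring P).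

Lemma unitQ_eq f g : (forall tau, 0 < complex.Im tau -> f tau = g tau) ->
  unitQ h P f -> unitQ h P g.
Proof.
move=> fg [a [b [qa qb ab0 f0 Pab]]]; exists a, b; split=> //.
- exact: QE_eq qa.
- by apply: QE_eq qb => // tau t0; rewrite fg.
- by move=> tau t0; rewrite -fg// f0.
Qed.

Lemma unitQ_1 : unitQ h P (fun=> 1).
Proof.
exists (delta0 R), (delta0 R); split=> //.
- exact: QE_1.
- by apply: QE_eq (QE_1 R h) => // tau _; rewrite invr1.
- by move=> m; rewrite /delta0; case: eqP => _; split; do ?[exact: subring1|exact: subring0].
Qed.

Lemma unitQ_M f g : unitQ h P f -> unitQ h P g -> unitQ h P (fun tau => f tau * g tau).
Proof.
move=> [a [b [qa qb [a0 b0] f0 Pab]]] [a' [b' [qa' qb' [a0' b0'] f0' Pab']]].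
exists (conv a a'), (conv b b'); split.
- exact: QE_M.
- by apply: QE_eq (QE_M h0 qb qb') => // tau _; rewrite invfM.
- by rewrite /conv !big_ord1 /= a0 a0' b0 b0' mul1r.
- by move=> tau t0; rewrite mulf_neq0 ?f0 ?f0'.
- by move=> m; split; apply: subring_conv => // k; case: (Pab k); case: (Pab' k).
Qed.

Lemma unitQ_V f : unitQ h P f -> unitQ h P (fun tau => (f tau)^-1).
Proof.
move=> [a [b [qa qb [a0 b0] f0 Pab]]]; exists b, a; split=> //.
- by apply: QE_eq qa => // tau _; rewrite invrK.
- by move=> tau t0; rewrite invr_eq0 f0.
- by move=> m; case: (Pab m).
Qed.

Lemma unitQ_X f n : unitQ h P f -> unitQ h P (fun tau => f tau ^+ n).
Proof.
move=> hf; elim: n => [|n IH]; first by apply: unitQ_eq unitQ_1.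
by apply: unitQ_eq (unitQ_M hf IH) => tau _; rewrite exprS.
Qed.

Lemma unitQ_Xz f (n : int) : unitQ h P f -> unitQ h P (fun tau => f tau ^ n).
Proof.
move=> hf; case: n => n; first by apply: unitQ_eq (unitQ_X n hf).
by apply: unitQ_eq (unitQ_V (unitQ_X n.+1 hf)) => tau _; rewrite NegzE.
Qed.

Lemma unitQ_spread k f : (0 < k)%N -> unitQ h P f -> unitQ (h * k) P f.
Proof.
move=> k0 [a [b [qa qb [a0 b0] f0 Pab]]].
exists (spread k a), (spread k b); split=> //.
- exact: QE_spread.
- exact: QE_spread.
- by rewrite /spread dvdn0 div0n.
- by move=> m; rewrite /spread; case: ifP => _; [exact: Pab|split; exact: subring0].
Qed.

Lemma unitQ_divz k f : (0 < k)%N -> unitQ h P f -> unitQ (h * k) P (fun tau => f (tau / k%:R)).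
Proof.
move=> k0 [a [b [qa qb [a0 b0] f0 Pab]]].
exists a, b; split=> //.
- exact: QE_divz.
- exact: (QE_divz h0 k0 qb).
- by move=> tau t0; rewrite f0// Im_divn divr_gt0 ?ltr0n.
Qed.

Lemma unitQ_qpochhammer c i d : (0 < i)%N -> (0 < d)%N -> nrm c <= 1 -> P c ->
  unitQ h P (fun tau => qpochhammer (c * tq h tau ^+ i) (tq h tau ^+ d)).
Proof.
move=> i0 d0 c1 Pc.
have key tau (t0 : 0 < complex.Im tau) := qpochhammer_small i0 d0 c1 (nrm_tq_lt1 h0 t0).
exists (iprod (poch_series c i d)), (iprod (inv_poch_series c i d)); split=> //.
- by split; [exact/disc_series_iprod/poch_factor|move=> tau /key[]].
- by split; [exact/disc_series_iprod/inv_poch_factor|move=> tau /key[]].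
- by move=> tau /key[].
- move=> m; split; apply: (subring_iprod HP) => n k.
    rewrite /poch_series /lin_series; case: eqP => _; first exact: subring1.
    by case: eqP => _; [exact: subringN|exact: subring0].
  by rewrite /inv_poch_series /geo_series /spread; case: ifP => _; [exact: subringX|exact: subring0].
Qed.

End UnitTheory.

Lemma unitQ_shift h r f : (0 < h)%N -> unitQ h (fun=> True) f ->
  unitQ h (fun=> True) (fun tau => f (tau + r%:C)).
Proof.
move=> h0 [a [b [qa qb [a0 b0] f0 Pab]]].
exists (fun m => a m * ex (r%:C / h%:R) ^+ m), (fun m => b m * ex (r%:C / h%:R) ^+ m); split=> //.
- exact: QE_shift.
- exact: (QE_shift r h0 qb).
- by rewrite !expr0 !mulr1.
- by move=> tau t0; rewrite f0//; case: tau t0 => x y /=; rewrite addr0.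
Qed.

Definition is_int (c : C) : Prop := exists n : int, c = n%:~R.

Lemma is_int_subring : is_subring is_int.
Proof.
split; first by exists 1.
- by move=> _ _ [n ->] [m ->]; exists (n - m); rewrite rmorphB.
- by move=> _ _ [n ->] [m ->]; exists (n * m); rewrite rmorphM.
Qed.

Lemma trivial_subring : is_subring (fun=> True). Proof. by []. Qed.

End Units.

(** * The product of the sine and Jacobi's imaginary transformation *)

Section SineProduct.
Variable R : realType.
Local Notation C := R[i].
Implicit Types (x z : C) (r : R).

Section ProductBounds.
Variables (I : Type) (u : I -> C).

Lemma prod1D_bound (s : seq I) :
  nrm (\prod_(i <- s) (1 + u i)) <= expR (\sum_(i <- s) nrm (u i)).
Proof.
elim: s => [|i s IH]; first by rewrite !big_nil nrm1 expR0.
rewrite !big_cons nrmM expRD ler_pM//.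
by rewrite (le_trans (nrmD _ _))// nrm1 expR_ge1Dx.
Qed.

Lemma prod1D_sub1_bound (s : seq I) :
  nrm (\prod_(i <- s) (1 + u i) - 1) <=
    (\sum_(i <- s) nrm (u i)) * expR (\sum_(i <- s) nrm (u i)).
Proof.
elim: s => [|i s IH]; first by rewrite !big_nil subrr nrm0 mul0r.
have hb := prod1D_bound s.
rewrite !big_cons; set S := \sum_(j <- s) _ in IH hb *; set p := \prod_(j <- s) _ in IH hb *.
have S0 : 0 <= S by rewrite sumr_ge0.
have -> : (1 + u i) * p - 1 = u i * p + (p - 1) by ring.
rewrite (le_trans (nrmD _ _))// nrmM mulrDl; have h : expR S <= expR (nrm (u i) + S).
  by rewrite ler_expR lerDr.
apply: lerD; first by rewrite ler_wpM2l// (le_trans hb).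
by rewrite (le_trans IH)// ler_wpM2l.
Qed.

(** The Cauchy estimate behind both exchanges of limits, in [esin_product] and in [rect_bound]. *)
Lemma prod1D_cat_bound (s1 s2 : seq I) :
  nrm (\prod_(i <- s1 ++ s2) (1 + u i) - \prod_(i <- s1) (1 + u i)) <=
    (\sum_(i <- s2) nrm (u i)) * expR (\sum_(i <- s1 ++ s2) nrm (u i)).
Proof.
rewrite !big_cat/=; set p := \prod_(i <- s1) _; set p' := \prod_(i <- s2) _.
have -> : p * p' - p = p * (p' - 1) by ring.
rewrite nrmM expRD mulrCA; apply: ler_pM => //; first exact: prod1D_bound.
exact: prod1D_sub1_bound.
Qed.

End ProductBounds.

Lemma sum_inv_sqr_tail n m : (0 < n)%N ->
  \sum_(n <= k < m) (k.+1%:R ^+ 2)^-1 <= n%:R^-1 :> R.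
Proof.
move=> n0; have [nm|/ltnW mn] := leqP n m; last by rewrite big_geq// invr_ge0.
apply: (@le_trans _ _ (n%:R^-1 - m%:R^-1)); last by rewrite gerBl invr_ge0.
elim: m nm => [|m IH]; first by rewrite leqn0 => /eqP n00; rewrite n00 in n0.
rewrite leq_eqVlt => /orP[/eqP ->|nm]; first by rewrite big_geq// subrr.
rewrite big_nat_recr//=; have h1 := IH nm.
have m0 : 0 < m%:R :> R by rewrite ltr0n (leq_trans n0).
suff : (m.+1%:R ^+ 2)^-1 <= m%:R^-1 - m.+1%:R^-1 :> R.
  by move=> h2; apply: le_trans (lerD h1 h2) _; rewrite addrA subrK.
rewrite -[m.+1]addn1 natrD; move: (m%:R : R) m0 => y y0.
have -> : y^-1 - (y + 1)^-1 = (y * (y + 1))^-1 by field; rewrite !gt_eqF//; lra.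
by rewrite lef_pV2 ?posrE ?mulr_gt0 ?exprn_gt0//; try lra; nra.
Qed.

Lemma sum_inv_sqr m : \sum_(0 <= k < m) (k.+1%:R ^+ 2)^-1 <= 2 :> R.
Proof.
case: m => [|m]; first by rewrite big_nil.
rewrite big_ltn// expr1n invr1.
by have := @sum_inv_sqr_tail 1 m.+1 isT; rewrite invr1; lra.
Qed.

(** A crude form of Jordan's inequality: up to 1/2 it follows from sin r >= r - r^2, beyond that
    from monotonicity, since sin(1/2) >= 1/4 and r < 2. *)
Lemma sin_ge r : 0 <= r <= pi / 2 -> r / 8 <= sin r.
Proof.
move=> /andP[r0 r1]; have p1 := @pihalf_lt2 R; have p2 := @pihalf_ge1 R.
have [h|/ltW h] := leP r 2^-1.
  have : `|sin r - r| <= r ^+ 2 by apply: abs_sin_sub_le; rewrite ger0_norm//; lra.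
  by rewrite ler_norml => /andP[h1 _]; nra.
have s1 : sin (2^-1 : R) <= sin r.
  by rewrite leNgt ltr_sin -?leNgt// in_itv/=; apply/andP; split; lra.
have : `|sin (2^-1 : R) - 2^-1| <= 2^-1 ^+ 2 by apply: abs_sin_sub_le; rewrite ger0_norm; lra.
by rewrite ler_norml => /andP[h1 _]; move: (sin r) (sin (2^-1)) s1 h1 => S T *; lra.
Qed.

Lemma pow_sub_factor n (A B : C) (z : C) : n.-primitive_root z ->
  A ^+ n - B ^+ n = \prod_(0 <= k < n) (A - z ^+ k * B).
Proof.
move=> zp; have [->|B0] := eqVneq B 0.
  under eq_bigr do rewrite mulr0 subr0.
  rewrite prodr_const_nat subn0 expr0n gtn_eqF ?subr0//.
  exact: prim_order_gt0 zp.
have := congr1 (fun p => p.[A / B] * B ^+ n) (factor_Xn_sub_1 zp).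
rewrite hornerD hornerXn hornerN hornerC mulrBl mul1r expr_div_n divfK ?expf_neq0// => <-.
rewrite horner_prod -[X in _ * B ^+ X]subn0 -prodr_const_nat -big_split/=.
by apply: eq_bigr => k _; rewrite hornerXsubC mulrBl divfK.
Qed.

End SineProduct.

Section SineFactorisation.
Variable R : realType.
Local Notation C := R[i].
Implicit Types (x z : C) (r : R).

Lemma cvgC_le_from (u : nat -> C) (l : C) (d : nat -> R) N :
  (forall n, (N <= n)%N -> nrm (u n - l) <= d n) -> d @ \oo --> (0 : R) -> cvgC u l.
Proof.
move=> h d0; apply/cvgCP; apply: (squeeze_cvgr _ (cvg_cst 0) d0).
by exists N => // n /= Nn; rewrite nrm_ge0 h.
Qed.

Lemma cvg_invn (M : R) : (fun n => M / n.+1%:R) @ \oo --> (0 : R).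
Proof.
rewrite -[0](mulr0 M); apply: cvgM; first exact: cvg_cst.
exact: cvg_harmonic.
Qed.

Definition kap : C := 2 * (pi : R)%:C * (0 +i* 1).

Lemma kap_neq0 : kap != 0.
Proof.
by rewrite !mulf_neq0 ?pnatr_eq0//; apply/eqP => -[]/eqP; rewrite ?oner_eq0 ?gt_eqF ?pi_gt0.
Qed.

(** This is 2i sin(pi x). *)
Definition esin x : C := ex (x / 2) - ex (- (x / 2)).

Lemma esinN x : esin (- x) = - esin x.
Proof. by rewrite /esin mulNr opprK opprB. Qed.

Lemma esin_factor x : esin x = - ex (- (x / 2)) * (1 - ex x).
Proof.
rewrite /esin mulrBr mulr1 mulNr opprK -exD.
have -> : - (x / 2) + x = x / 2 by field.
by rewrite addrC.
Qed.

Lemma esin_approx x : nrm (kap * x) <= 1 -> nrm (esin x - kap * x) <= 18 * nrm (kap * x) ^+ 2.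
Proof.
move=> h; set w := kap * (x / 2).
have w2 : nrm w <= 2^-1 by rewrite /w mulrA nrmM nrmV nrm_nat ler_pdivrMr// mulVf.
have h1 : nrm (ex (x / 2) - 1 - w) <= 9 * nrm w ^+ 2 by exact: ex_small.
have h2 : nrm (ex (- (x / 2)) - 1 - - w) <= 9 * nrm w ^+ 2.
  by have := @ex_small R (- (x / 2)); rewrite -/kap mulrN -/w nrmN; apply.
have -> : esin x - kap * x = (ex (x / 2) - 1 - w) - (ex (- (x / 2)) - 1 - - w).
  by rewrite /esin /w; move: (ex _) (ex _) kap => a b kp; field.
rewrite (le_trans (nrmB _ _))//.
have : nrm w <= nrm (kap * x).
  rewrite /w mulrA nrmM nrmV nrm_nat ler_pdivrMr//; have := nrm_ge0 (kap * x); lra.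
have := nrm_ge0 w; move: (nrm w) (nrm (kap * x)) h1 h2 => p q *; nra.
Qed.

Lemma esin_scale_cvg x : cvgC (fun n => n.+1%:R * esin (x / n.+1%:R)) (kap * x).
Proof.
have [N hN] : exists N : nat, nrm (kap * x) <= N%:R.
  by exists (Num.bound (nrm (kap * x))); rewrite ltW// archi_boundP.
apply: (cvgC_le_from (N := N) _ (cvg_invn (18 * nrm (kap * x) ^+ 2))) => n Nn.
have n0 : (n.+1%:R : C) != 0 by rewrite pnatr_eq0.
have n0' : 0 < n.+1%:R :> R by rewrite ltr0n.
have e : nrm (kap * (x / n.+1%:R)) = nrm (kap * x) / n.+1%:R.
  by rewrite mulrA nrmM nrmV nrm_nat.
have := @esin_approx (x / n.+1%:R); rewrite e => h.
have -> : n.+1%:R * esin (x / n.+1%:R) - kap * x =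
    n.+1%:R * (esin (x / n.+1%:R) - kap * (x / n.+1%:R)) by field.
rewrite nrmM nrm_nat; apply: le_trans (ler_wpM2l _ (h _)) _ => //.
  by rewrite ler_pdivrMr// mul1r (le_trans hN)// ler_nat (leq_trans Nn).
by rewrite expr_div_n; move: (nrm _) => q; rewrite le_eqVlt; apply/orP; left; apply/eqP; field; rewrite gt_eqF.
Qed.

Lemma esin_sqr x : - esin x ^+ 2 = 2 - ex x - (ex x)^-1.
Proof.
have e : ex x = ex (x / 2) ^+ 2 by rewrite -exMn; congr ex; field.
rewrite e /esin exN; have := ex_neq0 (x / 2); move: (ex _) => u u0.
by field.
Qed.

Lemma nrm_esin_real r : nrm (esin r%:C) = 2 * `|sin (pi * r)|.
Proof.
rewrite /esin -[(2 : C)]/(2%:R) -(rmorph_nat (real_complex R)) -fmorphV -rmorphM -rmorphN !ex_real.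
have -> : 2 * (pi : R) * (r * 2%:R^-1) = pi * r by move: (pi : R) => p; field.
have -> : 2 * (pi : R) * - (r * 2%:R^-1) = - (pi * r) by move: (pi : R) => p; field.
rewrite cosN sinN.
have -> : cos (pi * r) +i* sin (pi * r) - (cos (pi * r) +i* - sin (pi * r)) = (2 * sin (pi * r))%:C * 'i.
  by apply/eqP; rewrite eq_complex /=; apply/andP; split; apply/eqP; ring.
by rewrite nrmM nrm_i mulr1 nrm_real normrM ger0_norm.
Qed.

(** For k < p the argument stays in the range of [sin_ge], and pi >= 2 gives the constant. This is
    the source of the majorant in the sine product. *)
Lemma nrm_esin_ge k p : (k < p)%N ->
  k.+1%:R / 2 <= p.*2.+1%:R * nrm (esin (k.+1%:R / p.*2.+1%:R)).
Proof.
move=> kp; set n := p.*2.+1.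
have n0 : 0 < n%:R :> R by rewrite ltr0n.
have -> : k.+1%:R / n%:R = (k.+1%:R / n%:R : R)%:C :> C by rewrite rmorphM fmorphV !rmorph_nat.
rewrite nrm_esin_real; have p1 := @pihalf_ge1 R.
have q0 : 0 <= (k.+1%:R / n%:R : R) by rewrite divr_ge0.
have q1 : (k.+1%:R / n%:R : R) <= 1 / 2.
  rewrite ler_pdivrMr// mul1r mulrC ler_pdivlMr// -natrM ler_nat /n.
  by rewrite -addnn; lia.
have h : (pi : R) * (k.+1%:R / n%:R) / 8 <= sin (pi * (k.+1%:R / n%:R)).
  by apply: sin_ge; apply/andP; split; nra.
have s0 : 0 <= sin ((pi : R) * (k.+1%:R / n%:R)).
  by apply: le_trans h; rewrite divr_ge0// mulr_ge0// ltW// pi_gt0.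
rewrite ger0_norm//; move: h q0; set s := sin _; set q := k.+1%:R / n%:R => h q0.
have -> : k.+1%:R = n%:R * q by rewrite /q mulrCA divff ?mulr1 ?gt_eqF.
rewrite -mulrA ler_pM2l//.
nra.
Qed.

(** For n = 2p+1 and A = ex(x/2n), B = 1/A, the difference A^n - B^n splits over the n-th roots of
    unity. The roots of index k and n-k are inverse to each other and pair up; as n is odd, only the
    root 1 is left over. *)
Lemma esin_finite x p :
  esin x = p.*2.+1%:R * esin (x / p.*2.+1%:R) *
    \prod_(0 <= k < p) (1 - esin (x / p.*2.+1%:R) ^+ 2 / esin (k.+1%:R / p.*2.+1%:R) ^+ 2).
Proof.
set n := p.*2.+1; have n0 : (0 < n)%N by [].
have nC : (n%:R : C) != 0 by rewrite pnatr_eq0.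
have zp := ex_primitive R n0; set z := ex _ in zp.
have zE k : z ^+ k = ex (k%:R / n%:R) by rewrite -exMn.
have pairing (A B : C) : A * B = 1 ->
    \prod_(0 <= k < p.*2) (A - z ^+ k.+1 * B) =
    \prod_(0 <= k < p) ((A - B) ^+ 2 - esin (k.+1%:R / n%:R) ^+ 2).
  move=> AB; rewrite (big_cat_nat (n := p))//=; last by rewrite -addnn leq_addr.
  rewrite -{2}[p]add0n big_addn -addnn addnK [X in _ * X]big_nat_rev/= add0n -big_split/=.
  apply: eq_big_nat => k /andP[_ kp].
  have -> : (p - k.+1 + p).+1 = (n - k.+1)%N by rewrite /n -addnn; lia.
  have kn : (k.+1 <= n)%N by rewrite /n -addnn; lia.
  have -> : z ^+ (n - k.+1) = (z ^+ k.+1)^-1.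
    have zk : z ^+ k.+1 != 0 by rewrite expf_neq0// ex_neq0.
    apply: (mulIf zk); by rewrite -exprD subnK// (prim_expr_order zp) mulVf// expf_neq0// ex_neq0.
  have := esin_sqr (k.+1%:R / n%:R); rewrite -zE => ->.
  have : z ^+ k.+1 != 0 by rewrite expf_neq0// ex_neq0.
  move: (z ^+ k.+1) => w w0.
  have -> : (A - w * B) * (A - w^-1 * B) = A ^+ 2 + B ^+ 2 - (w + w^-1) * (A * B) by field.
  rewrite AB; have -> : (A - B) ^+ 2 = A ^+ 2 + B ^+ 2 - 2 * (A * B) by ring.
  by rewrite AB; ring.
(* By the pairing at A = B = 1 this is the product of 1 - z^k over 0 < k < n, that is, the
   derivative of X^n - 1 at 1. *)
have pn : \prod_(0 <= k < p) (- esin (k.+1%:R / n%:R) ^+ 2) = n%:R.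
  have := pairing 1 1 (mulr1 1); rewrite subrr expr0n /=.
  under [in X in _ = X -> _]eq_bigr do rewrite sub0r.
  move=> <-.
  have := factor_Xn_sub_1 zp; rewrite big_nat_recl//= expr0 => E.
  have := congr1 (fun q : {poly C} => (q^`()).[1]) E; rewrite /=.
  rewrite derivM !derivB derivX !derivC derivXn !subr0 mul1r hornerD hornerM !hornerE.
  rewrite subrr mul0r addr0. rewrite hornerMn hornerXn expr1n => <-; rewrite horner_prod.
  by apply: eq_bigr => k _; rewrite hornerXsubC mulr1.
have e0 k : (k < p)%N -> esin (k.+1%:R / n%:R) != 0.
  move=> /nrm_esin_ge h; rewrite -nrm_gt0.
  have : 0 < n%:R * nrm (esin (k.+1%:R / n%:R)) by apply: lt_le_trans h; rewrite divr_gt0.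
  by rewrite pmulr_rgt0 ?ltr0n.
have -> : esin x = ex (x / n%:R / 2) ^+ n - ex (- (x / n%:R / 2)) ^+ n.
  by rewrite -!exMn /esin; congr (ex _ - ex _); field.
rewrite (pow_sub_factor _ _ zp) /n big_nat_recl//= -/n expr0 mul1r pairing; last by rewrite exN divff.
rewrite -/(esin (x / n%:R)).
have <- : \prod_(0 <= k < p) (- esin (k.+1%:R / n%:R) ^+ 2) *
    \prod_(0 <= k < p) (1 - esin (x / n%:R) ^+ 2 / esin (k.+1%:R / n%:R) ^+ 2) =
    \prod_(0 <= k < p) (esin (x / n%:R) ^+ 2 - esin (k.+1%:R / n%:R) ^+ 2).
  rewrite -big_split/=; apply: eq_big_nat => k /andP[_ /e0].
  by move: (esin _) (esin _) => w u w0; field.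
by rewrite pn mulrCA mulrA.
Qed.

(* Tannery's theorem for products, with the majorant [4 W^2 / (k+1)^2]. *)
Lemma esin_product x :
  cvgC (fun N => kap * x * \prod_(0 <= k < N) (1 - x ^+ 2 / k.+1%:R ^+ 2)) (esin x).
Proof.
have [W0 hW0] : exists W, forall n, nrm (n.+1%:R * esin (x / n.+1%:R)) <= W.
  have /cvg_seq_bounded : cvgn (fun n => nrm (n.+1%:R * esin (x / n.+1%:R))).
    by apply/cvg_ex; exists (nrm (kap * x)); apply: cvgC_nrm; exact: esin_scale_cvg.
  case=> M [_ /(_ (M + 1))]; rewrite ltrDl ltr01 => /(_ isT) hM.
  by exists (M + 1) => n; have /= := hM n I; rewrite ger0_norm.
have W0_ge0 : 0 <= W0 by apply: le_trans (hW0 0%N).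
pose W2 := 4 * W0 ^+ 2; have W2_ge0 : 0 <= W2 by rewrite mulr_ge0 ?exprn_ge0.
pose u p k : C := - (esin (x / p.*2.+1%:R) ^+ 2 / esin (k.+1%:R / p.*2.+1%:R) ^+ 2).
have ub p k : (k < p)%N -> nrm (u p k) <= W2 * (k.+1%:R ^+ 2)^-1.
  move=> kp; have h1 := hW0 p.*2; have h2 := nrm_esin_ge kp.
  rewrite /u nrmN nrmM nrmV !nrmX; move: h1; rewrite nrmM nrm_nat.
  have n0 : 0 < p.*2.+1%:R :> R by rewrite ltr0n.
  have k0 : 0 < k.+1%:R :> R by rewrite ltr0n.
  move: (nrm_ge0 (esin (x / p.*2.+1%:R))) (nrm_ge0 (esin (k.+1%:R / p.*2.+1%:R))).
  move: (nrm (esin (x / p.*2.+1%:R))) (nrm (esin (k.+1%:R / p.*2.+1%:R))) h2 => e d h2 e0 d0 h1.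
  have d1 : 0 < d by rewrite -(pmulr_rgt0 _ n0); apply: lt_le_trans h2; rewrite divr_gt0.
  rewrite ler_pdivrMr ?exprn_gt0// mulrAC ler_pdivlMr ?exprn_gt0//.
  rewrite /W2 -(ler_pM2l (exprn_gt0 2 n0)).
  have -> : p.*2.+1%:R ^+ 2 * (e ^+ 2 * k.+1%:R ^+ 2) = (p.*2.+1%:R * e) ^+ 2 * k.+1%:R ^+ 2 by ring.
  have -> : p.*2.+1%:R ^+ 2 * (4 * W0 ^+ 2 * d ^+ 2) = W0 ^+ 2 * (2 * (p.*2.+1%:R * d)) ^+ 2 by ring.
  apply: ler_pM; rewrite ?sqr_ge0//; first by rewrite lerXn2r ?nnegrE ?mulr_ge0 ?(ltW n0).
  rewrite lerXn2r ?nnegrE ?(ltW k0) ?mulr_ge0 ?(ltW n0)//.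
  by move: h2; rewrite ler_pdivrMr// mulrC.
have usum p N M : (M <= p)%N -> \sum_(N <= k < M) nrm (u p k) <= W2 * \sum_(N <= k < M) (k.+1%:R ^+ 2)^-1.
  move=> Mp; rewrite mulr_sumr !big_nat; apply: ler_sum => k /andP[_ kM].
  by apply: ub; exact: leq_trans Mp.
pose D p N := \prod_(0 <= k < N) (1 + u p k).
have Dlim N : cvgC (fun p => p.*2.+1%:R * esin (x / p.*2.+1%:R) * D p N)
    (kap * x * \prod_(0 <= k < N) (1 - x ^+ 2 / k.+1%:R ^+ 2)).
  have sub y : cvgC (fun p => p.*2.+1%:R * esin (y / p.*2.+1%:R)) (kap * y).
    apply: (@cvgC_subseq _ (fun n => n.+1%:R * esin (y / n.+1%:R)) _ double) (esin_scale_cvg y).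
    by move=> n; rewrite -addnn leq_addr.
  apply: cvgC_M => //; apply: cvgC_prod => k _.
  have kk : kap * (k.+1%:R : C) != 0 by rewrite mulf_neq0 ?kap_neq0// pnatr_eq0.
  have -> : 1 - x ^+ 2 / k.+1%:R ^+ 2 = 1 - (kap * x) ^+ 2 * ((kap * k.+1%:R) ^+ 2)^-1.
    have := kap_neq0; have : (k.+1%:R : C) != 0 by rewrite pnatr_eq0.
    move: (k.+1%:R : C) kap => a b a0 b0; field; by rewrite a0 b0.
  apply: (cvgC_eq (u := fun p => 1 - (p.*2.+1%:R * esin (x / p.*2.+1%:R)) ^+ 2 *
     ((p.*2.+1%:R * esin (k.+1%:R / p.*2.+1%:R)) ^+ 2)^-1)).
    move=> p; rewrite /u; congr (1 + - _).
    rewrite !exprMn invfM mulrACA divff ?mul1r//.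
  apply: cvgC_B; first exact: cvgC_cst.
  apply: cvgC_M; first exact: cvgC_X.
  by apply: cvgC_V; [rewrite expf_neq0|exact: cvgC_X].
(* A bound, uniform in p, for the effect of the factors beyond N: their majorants sum to at most
   W2/N, and all majorants together to at most 2 W2. *)
apply: (cvgC_le_from (N := 1) (d := fun N => W0 * (W2 * expR (W2 * 2)) / N%:R)); last first.
  have h := cvg_invn (W0 * (W2 * expR (W2 * 2))).
  rewrite -(cvg_shiftn 1 (fun N : nat => W0 * (W2 * expR (W2 * 2)) / N%:R : R)).
  by under eq_fun do rewrite addn1.
move=> N N0; rewrite nrmBC.
have L := cvgC_B (cvgC_cst (esin x)) (Dlim N).
apply: (cvgC_nrm_le (N := N) L) => p Np.
rewrite {1}(esin_finite x p) -mulrBr nrmM -mulrA; apply: ler_pM => //.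
have := @prod1D_cat_bound _ _ (u p) (index_iota 0 N) (index_iota N p).
have <- : index_iota 0 p = index_iota 0 N ++ index_iota N p.
  by rewrite /index_iota !subn0 -{1}(subnKC Np) iotaD.
move=> h; apply: le_trans h _.
have s1 := usum p 0%N p (leqnn _); have s2 := usum p N p (leqnn _).
rewrite -mulrA [expR _ / _]mulrC mulrA; apply: ler_pM; rewrite ?expR_ge0 ?sumr_ge0//.
  by apply: le_trans s2 _; rewrite ler_wpM2l// sum_inv_sqr_tail.
by rewrite ler_expR; apply: le_trans s1 _; rewrite ler_wpM2l// sum_inv_sqr.
Qed.

End SineFactorisation.

(** * Double products and Pochhammer symbols with arbitrary first argument *)

Section DoubleProducts.
Variable R : realType.
Local Notation C := R[i].
Implicit Types (x z a q : C) (r : R).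

Definition wt (n : nat) : R := (n.+1%:R ^+ 2)^-1.

Lemma wt_ge0 n : 0 <= wt n. Proof. by rewrite invr_ge0 exprn_ge0. Qed.

Definition rect (u : nat -> nat -> C) M N : C :=
  \prod_(0 <= m < M) \prod_(0 <= n < N) (1 + u m n).

(** The bound does not depend on the number N of columns. The majorant is symmetric, so columns obey
    the same bound and a square approximates all larger rectangles. *)
Lemma rect_bound (u : nat -> nat -> C) (K : R) :
  (forall m n, nrm (u m n) <= K * (wt m * wt n)) ->
  forall k M N, (0 < k <= M)%N ->
    nrm (rect u M N - rect u k N) <= K * 2 * expR (K * 4) / k%:R.
Proof.
move=> hu k M N /andP[k0 kM].
have K0 : 0 <= K.
  by have := le_trans (nrm_ge0 _) (hu 0%N 0%N); rewrite /wt expr1n invr1 !mulr1.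
pose pairs i j := [seq (m, n) | m <- index_iota i j, n <- index_iota 0 N].
have rE i j : \prod_(i <= m < j) \prod_(0 <= n < N) (1 + u m n) =
    \prod_(p <- pairs i j) (1 + u p.1 p.2) by rewrite /pairs big_allpairs_dep.
have sE i j : \sum_(p <- pairs i j) nrm (u p.1 p.2) <= K * ((\sum_(i <= m < j) wt m) * 2).
  rewrite /pairs big_allpairs_dep mulr_suml mulr_sumr; apply: ler_sum => m _ /=.
  apply: (@le_trans _ _ (\sum_(0 <= n < N) K * (wt m * wt n))).
    by apply: ler_sum => n _; exact: hu.
  rewrite -mulr_sumr ler_wpM2l// -mulr_sumr ler_wpM2l ?wt_ge0//.
  exact: sum_inv_sqr.
have := prod1D_cat_bound (fun p : nat * nat => u p.1 p.2) (pairs 0 k) (pairs k M).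
have -> : pairs 0%N k ++ pairs k M = pairs 0%N M.
  rewrite /pairs.
  have -> : index_iota 0 M = index_iota 0 k ++ index_iota k M.
    by rewrite /index_iota !subn0 -{1}(subnKC kM) iotaD.
  by rewrite allpairs_cat.
rewrite -!rE => h; apply: le_trans h _; rewrite mulrAC.
apply: ler_pM; rewrite ?expR_ge0 ?sumr_ge0//.
  apply: le_trans (sE _ _) _; rewrite -mulrA ler_wpM2l// mulrC ler_wpM2l//.
  exact: sum_inv_sqr_tail.
rewrite ler_expR; apply: le_trans (sE _ _) _; rewrite ler_wpM2l//.
by have := @sum_inv_sqr R M; rewrite -/wt => ?; lra.
Qed.

(* A bound K / ((m+1)^2 (n+1)^2) on the factors allows exchanging the two limits of
   the double product. *)
Lemma rect_limits (u : nat -> nat -> C) (K : R) (r s : nat -> C) (rho sigma : C) :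
  (forall m n, nrm (u m n) <= K * (wt m * wt n)) ->
  (forall M, cvgC (fun N => rect u M.+1 N.+1) (r M)) -> cvgC r rho ->
  (forall N, cvgC (fun M => rect u M.+1 N.+1) (s N)) -> cvgC s sigma ->
  rho = sigma.
Proof.
move=> hu hr hrho hs hsigma; set B := K * 2 * expR (K * 4).
have tr M N : rect u M N = rect (fun n m => u m n) N M by rewrite /rect exchange_big.
have hu' n m : nrm (u m n) <= K * (wt n * wt m) by rewrite [wt n * _]mulrC.
have sq k M N : (0 < k)%N -> (k <= M)%N -> (k <= N)%N ->
    nrm (rect u M N - rect u k k) <= B / k%:R + B / k%:R.
  move=> k0 kM kN; apply: le_trans (nrm_triangle (rect u k N) _ _) (lerD _ _).
    by apply: (rect_bound hu); rewrite k0.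
  by rewrite !(tr k); apply: (rect_bound hu'); rewrite k0.
have lim1 k : (0 < k)%N -> nrm (rho - rect u k k) <= B / k%:R + B / k%:R.
  move=> k0; apply: (cvgC_nrm_le (N := k) (cvgC_B hrho (cvgC_cst _))) => M kM.
  apply: (cvgC_nrm_le (N := k) (cvgC_B (hr M) (cvgC_cst _))) => N kN.
  by apply: sq => //; exact: leqW.
have lim2 k : (0 < k)%N -> nrm (sigma - rect u k k) <= B / k%:R + B / k%:R.
  move=> k0; apply: (cvgC_nrm_le (N := k) (cvgC_B hsigma (cvgC_cst _))) => N kN.
  apply: (cvgC_nrm_le (N := k) (cvgC_B (hs N) (cvgC_cst _))) => M kM.
  by apply: sq => //; exact: leqW.
apply/eqP; rewrite -subr_eq0 -nrm_eq0 eq_le nrm_ge0 andbT.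
apply: (cvgr_to_ge (cvg_invn (B * 4))); exists 0%N => // k _ /=.
apply: le_trans (nrm_triangle (rect u k.+1 k.+1) _ _) _.
have := lim1 k.+1 isT; have := lim2 k.+1 isT; rewrite nrmBC.
have -> : B * 4 / k.+1%:R = B / k.+1%:R + B / k.+1%:R + (B / k.+1%:R + B / k.+1%:R) by ring.
by move=> h1 h2; apply: lerD => //; rewrite nrmBC in h1.
Qed.

(** Allows cutting (a;q) after N factors into a finite product and a symbol that [qpochhammer_small]
    covers. *)
Lemma expr_small a q : nrm q < 1 -> q != 0 -> exists N c, nrm c <= 1 /\ a * q ^+ N = c * q.
Proof.
move=> q1 q0; have qn : 0 < nrm q by rewrite nrm_gt0.
have q01 : 0 <= nrm q < 1 by rewrite nrm_ge0.
have /cvgrPdist_lt /(_ _ qn) [N _ hN] := cvg_expr0 (nrm a) q01.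
exists N, (a * q ^+ N / q); split; last by rewrite divfK.
rewrite nrmM nrmV ler_pdivrMr// mul1r nrmM nrmX; have := hN N (leqnn _).
by rewrite /= sub0r normrN ger0_norm ?mulr_ge0 ?exprn_ge0// => /ltW.
Qed.

Lemma prod_qfactors_shift a q N n :
  \prod_(0 <= m < n + N) (1 - a * q ^+ m) =
  \prod_(0 <= m < N) (1 - a * q ^+ m) * \prod_(0 <= m < n) (1 - a * q ^+ N * q ^+ m).
Proof.
rewrite (big_cat_nat (n := N)) ?leq_addl//=; congr (_ * _).
rewrite -{1}[N]add0n big_addn addnK; apply: eq_bigr => i _.
by rewrite addnC exprD mulrA.
Qed.

Lemma qpochhammerE a q N c : nrm q < 1 -> nrm c <= 1 -> a * q ^+ N = c * q ->
  cvgC (fun n => \prod_(0 <= m < n) (1 - a * q ^+ m)) (qpochhammer a q) /\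
  qpochhammer a q = \prod_(0 <= m < N) (1 - a * q ^+ m) * qpochhammer (c * q) q.
Proof.
move=> q1 c1 aq.
have [_ _ _ cl] := @qpochhammer_small _ c 1 1 isT isT c1 q q1.
rewrite !expr1 in cl.
set l := \prod_(0 <= m < N) (1 - a * q ^+ m) * qpochhammer (c * q) q.
have h : cvgC (fun n => \prod_(0 <= m < n) (1 - a * q ^+ m)) l.
  apply/cvgCP; rewrite -(cvg_shiftn N (fun n => nrm (\prod_(0 <= m < n) (1 - a * q ^+ m) - l))).
  apply/cvgCP; apply: (cvgC_eq _ (cvgC_M (cvgC_cst _) cl)) => n.
  by rewrite prod_qfactors_shift aq.
have e : qpochhammer a q = l by exact: limC_eq h.
by rewrite {1}e.
Qed.

Lemma qpochhammer_cvg a q : nrm q < 1 -> q != 0 ->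
  cvgC (fun n => \prod_(0 <= m < n) (1 - a * q ^+ m)) (qpochhammer a q).
Proof.
by move=> q1 q0; have [N [c [c1 aq]]] := expr_small a q1 q0; have [] := qpochhammerE q1 c1 aq.
Qed.

Lemma qpochhammer_neq0 a q : nrm q < 1 -> q != 0 -> (forall m, a * q ^+ m != 1) ->
  qpochhammer a q != 0.
Proof.
move=> q1 q0 aq1; have [N [c [c1 aq]]] := expr_small a q1 q0.
have [_ ->] := qpochhammerE q1 c1 aq.
have [_ _ + _] := @qpochhammer_small _ c 1 1 isT isT c1 q q1.
rewrite !expr1 => l0; rewrite mulf_neq0// prodf_seq_neq0.
by apply/allP => m _; rewrite /= subr_eq0 eq_sym aq1.
Qed.

Lemma qpochhammer_rec a q : nrm q < 1 -> q != 0 ->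
  qpochhammer a q = (1 - a) * qpochhammer (a * q) q.
Proof.
move=> q1 q0; apply: (cvgC_uniq (cvgC_shift 1 (qpochhammer_cvg a q1 q0))).
apply: (cvgC_eq _ (cvgC_M (cvgC_cst _) (qpochhammer_cvg (a * q) q1 q0))) => n.
by rewrite prod_qfactors_shift big_nat1 expr0 mulr1 expr1.
Qed.

End DoubleProducts.

(** * The theta function as a product over lattice rows *)

Section Theta.
Variable R : realType.
Local Notation C := R[i].
Implicit Types (x z a q w tau : C) (r : R).

Lemma ex_eq1 x : ex x = 1 -> exists n : int, x = n%:~R.
Proof.
move=> x1; have := nrm_ex x; rewrite x1 nrm1 => /esym/eqP.
rewrite -[X in _ == X]expR0 (inj_eq (@expR_inj R)) oppr_eq0 !mulf_eq0 pnatr_eq0 /=.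
rewrite gt_eqF ?pi_gt0//= => /eqP imx.
have xE : x = (complex.Re x)%:C by case: x imx {x1} => a b /= ->.
move: x1; rewrite xE; set r := complex.Re x => x1; exists (Num.floor r).
have fr : r = (Num.floor r)%:~R + (r - (Num.floor r)%:~R) by rewrite addrC subrK.
have [/eqP e0|ne0] := boolP (r - (Num.floor r)%:~R == 0).
  by rewrite {1}fr e0 addr0 rmorph_int.
have : ex ((r - (Num.floor r)%:~R)%:C) != 1.
  apply: ex_real_neq1; rewrite lt_def ne0 /= subr_ge0 floor_le /=.
  by have := floorD1_gt r; rewrite rmorphD /=; lra.
by rewrite rmorphB rmorph_int exB x1 ex_int divr1 eqxx.
Qed.

Definition inL tau z : Prop := exists m n : int, z = m%:~R * tau + n%:~R.

(* sigma-like normalisation: theta_1(z, tau) / eta(tau)^3, up to a constant. *)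
Definition theta z tau : C := esin z *
  (qpochhammer (ex tau * ex z) (ex tau) * qpochhammer (ex tau * (ex z)^-1) (ex tau) /
   qpochhammer (ex tau) (ex tau) ^+ 2).

(** The joint factor (1 - z/w)(1 + z/w) of the opposite lattice points w and -w. *)
Definition fac z w : C := 1 - z ^+ 2 / w ^+ 2.

Lemma fac_scale c z w : c != 0 -> fac (c * z) (c * w) = fac z w.
Proof.
move=> c0; rewrite /fac !exprMn invfM mulrACA divff ?mul1r//.
by rewrite expf_neq0.
Qed.

Lemma facN z w : fac z (- w) = fac z w. Proof. by rewrite /fac sqrrN. Qed.

(* The factor of sigma(z)/z at the lattice points [+- m tau +- n]. *)
Definition lat z tau (m n : nat) : C :=
  if m is _.+1 then
    if n is _.+1 then fac z (m%:R * tau + n%:R) * fac z (m%:R * tau - n%:R)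
    else fac z (m%:R * tau)
  else if n is _.+1 then fac z n%:R else 1.

(** [fac] is homogeneous of degree 0 and even in w, and division by tau maps the lattice of tau to
    that of -1/tau with rows and columns exchanged. The inversion of theta thus becomes an exchange
    of limits. *)
Lemma lat_swap z tau m n : tau != 0 -> lat z tau m n = lat (z / tau) (- tau^-1) n m.
Proof.
move=> t0; have ti : tau^-1 != 0 by rewrite invr_eq0.
have S w : fac z w = fac (z / tau) (w / tau) by rewrite ![_ / tau]mulrC fac_scale.
case: m n => [|m] [|n] //=; rewrite ?(S (_%:R)) ?(S (_ * tau)) ?(S (_ + _)).
- by rewrite mulrN facN.
- by rewrite mulfK.
- rewrite mulrC; congr (_ * _).
    by rewrite mulrBl mulfK// mulrN addrC.
  by rewrite mulrDl mulfK// mulrN -[in RHS]facN opprB opprK addrC.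
Qed.

(** The partial products of [esin] from [esin_product]. *)
Definition pfac N x : C := kap R * x * \prod_(0 <= k < N) (1 - x ^+ 2 / k.+1%:R ^+ 2).

Section FixedTau.
Variable tau : C.
Hypothesis t0 : 0 < complex.Im tau.
Local Notation q := (ex tau).

Lemma tau_neq0 : tau != 0.
Proof. by apply: contraTneq t0 => ->; rewrite ltxx. Qed.

Lemma q_lt1 : nrm q < 1.
Proof. by rewrite nrm_ex expR_lt1 oppr_lt0 !mulr_gt0// pi_gt0. Qed.

Lemma Im_lat (m n : R) : complex.Im (m%:C * tau + n%:C) = m * complex.Im tau.
Proof. by case: (tau) => x y /=; ring. Qed.

Lemma lat_neq0 (m : nat) (n : int) : m.+1%:R * tau + n%:~R != 0.
Proof.
apply/eqP => /(congr1 (@complex.Im _)) /=.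
rewrite -(rmorph_nat (real_complex R)) -(rmorph_int (real_complex R)) Im_lat => /eqP.
by rewrite mulf_eq0 pnatr_eq0 (gt_eqF t0).
Qed.

Lemma lat_neq0D m n : m.+1%:R * tau + n%:R != 0. Proof. exact: (lat_neq0 m n). Qed.
Lemma lat_neq0B m n : m.+1%:R * tau - n%:R != 0.
Proof. by have := lat_neq0 m (- n%:Z); rewrite rmorphN. Qed.
Lemma lat_neq00 m : m.+1%:R * tau != 0.
Proof. by have := lat_neq0 m 0; rewrite addr0. Qed.

Lemma pfac_lat_neq0 N m : pfac N (m.+1%:R * tau) != 0.
Proof.
apply: mulf_neq0; first by rewrite mulf_neq0 ?kap_neq0 ?lat_neq00.
rewrite prodf_seq_neq0; apply/allP => k _ /=; apply/eqP.
have h1 := lat_neq0D m k.+1; have h2 := lat_neq0B m k.+1.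
have k0 : (k.+1%:R : C) != 0 by rewrite pnatr_eq0.
move/eqP; rewrite subr_eq0 eq_sym -subr_eq0.
have -> : (m.+1%:R * tau) ^+ 2 / k.+1%:R ^+ 2 - 1 =
   (m.+1%:R * tau + k.+1%:R) * (m.+1%:R * tau - k.+1%:R) / k.+1%:R ^+ 2.
  by move: (k.+1%:R : C) k0 (m.+1%:R * tau) => K K0 w; field.
by apply/negP; rewrite !mulf_neq0// invr_eq0 expf_neq0.
Qed.

(** Over the points w = m tau + n with -N <= n <= N, the numerators w + z and w - z regroup into
    partial sine products at m tau + z and m tau - z, and the denominators into those at m tau. The
    identity is exact for each N. *)
Lemma lat_row z m N : \prod_(0 <= n < N.+1) lat z tau m.+1 n =
  pfac N (m.+1%:R * tau + z) * pfac N (m.+1%:R * tau - z) / pfac N (m.+1%:R * tau) ^+ 2.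
Proof.
elim: N => [|N IH].
  rewrite big_nat1 /= /fac /pfac !big_nil !mulr1; have := lat_neq00 m; have := kap_neq0 R.
  by move: (m.+1%:R * tau) (kap R) => w k k0 w0; field; rewrite k0 w0.
rewrite big_nat_recr//= IH /pfac ![\prod_(0 <= k < N.+1) _]big_nat_recr//=.
have := pfac_lat_neq0 N m; rewrite /pfac mulf_eq0 negb_or => /andP[_ p0].
have k0 := kap_neq0 R; have w0 := lat_neq00 m.
have h1 := lat_neq0D m N.+1; have h2 := lat_neq0B m N.+1.
have n0 : (N.+1%:R : C) != 0 by rewrite pnatr_eq0.
rewrite /fac.
move: (\prod_(0 <= k < N) _) (\prod_(0 <= k < N) _) (\prod_(0 <= k < N) _) p0 => A B P P0.
move: (m.+1%:R * tau) (N.+1%:R : C) (kap R) k0 w0 h1 h2 n0 => w n k k0 w0 h1 h2 n0.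
have h3 : n ^+ 2 - w ^+ 2 != 0.
  have -> : n ^+ 2 - w ^+ 2 = - ((w + n) * (w - n)) by ring.
  by rewrite oppr_eq0 mulf_neq0.
by field; rewrite n0 h3 P0 w0 k0 h2 h1.
Qed.

Lemma ex_lat (m : nat) : ex (m.+1%:R * tau) = q * q ^+ m.
Proof. by rewrite exMn exprS. Qed.

Lemma qm_neq1 (m : nat) : q * q ^+ m != 1.
Proof.
apply/eqP => e; have : nrm (q ^+ m.+1) < 1 by rewrite nrmX exprn_ilt1// q_lt1.
by rewrite exprS e nrm1 ltxx.
Qed.

Lemma esin_lat_neq0 m : esin (m.+1%:R * tau) != 0.
Proof.
by rewrite esin_factor mulf_neq0 ?oppr_eq0// subr_eq0 eq_sym ex_lat qm_neq1.
Qed.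

Lemma esin_row z m :
  esin (m.+1%:R * tau + z) * esin (m.+1%:R * tau - z) / esin (m.+1%:R * tau) ^+ 2 =
  (1 - q * ex z * q ^+ m) * (1 - q * (ex z)^-1 * q ^+ m) / (1 - q * q ^+ m) ^+ 2.
Proof.
rewrite !esin_factor exD exB ex_lat.
have e : ex (- ((m.+1%:R * tau + z) / 2)) * ex (- ((m.+1%:R * tau - z) / 2)) =
    ex (- (m.+1%:R * tau / 2)) ^+ 2.
  by rewrite -exMn -exD; congr ex; field.
have := qm_neq1 m; rewrite eq_sym -subr_eq0.
rewrite exprMn sqrrN -e.
have := ex_neq0 (- ((m.+1%:R * tau + z) / 2)); have := ex_neq0 (- ((m.+1%:R * tau - z) / 2)).
have := ex_neq0 z.
move: (ex (- ((_ + z) / 2))) (ex (- ((_ - z) / 2))) (q) (q ^+ m) (ex z).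
move=> a b Q Qm Z Z0 b0 a0 Q0.
by field; rewrite a0 b0 Z0 Q0.
Qed.

Definition theta_row z M : C := esin z * \prod_(0 <= m < M)
  ((1 - q * ex z * q ^+ m) * (1 - q * (ex z)^-1 * q ^+ m) / (1 - q * q ^+ m) ^+ 2).

Lemma theta_row_cvg z : cvgC (theta_row z) (theta z tau).
Proof.
have q1 := q_lt1; have q0 := ex_neq0 tau.
apply: cvgC_M; first exact: cvgC_cst.
apply: (cvgC_eq (u := fun M => \prod_(0 <= m < M) (1 - q * ex z * q ^+ m) *
   \prod_(0 <= m < M) (1 - q * (ex z)^-1 * q ^+ m) * ((\prod_(0 <= m < M) (1 - q * q ^+ m)) ^+ 2)^-1)).
  by move=> M; rewrite -prodrXl -prodfV -!big_split.
apply: cvgC_M; first by apply: cvgC_M; exact: qpochhammer_cvg.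
apply: cvgC_V; last by apply: cvgC_X; exact: qpochhammer_cvg.
by rewrite expf_neq0// qpochhammer_neq0// => m; exact: qm_neq1.
Qed.

(** Row 0 without the origin tends to the sine factor of theta, and each further row to one factor
    of the q-product, by [esin_row]. *)
Lemma lat_rows_cvg z M :
  cvgC (fun N => kap R * z * \prod_(0 <= m < M.+1) \prod_(0 <= n < N.+1) lat z tau m n)
    (theta_row z M).
Proof.
apply: (cvgC_eq (u := fun N => pfac N z * \prod_(0 <= m < M)
   (pfac N (m.+1%:R * tau + z) * pfac N (m.+1%:R * tau - z) / pfac N (m.+1%:R * tau) ^+ 2))).
  move=> N; rewrite [in RHS]big_nat_recl//= mulrA; congr (_ * _).
    by rewrite big_nat_recl//= mul1r.
  by apply: eq_bigr => m _; rewrite lat_row.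
apply: cvgC_M; first exact: esin_product.
apply: cvgC_prod => m _; rewrite -esin_row.
apply: cvgC_M; first by apply: cvgC_M; exact: esin_product.
apply: cvgC_V; last by apply: cvgC_X; exact: esin_product.
by rewrite expf_neq0// esin_lat_neq0.
Qed.

Section NonLattice.
Variable z : C.
Hypothesis zL : ~ inL tau z.

Lemma ex_nonlat (m : int) : ex z * q ^ m != 1.
Proof.
apply/eqP; rewrite -exMz -exD => /ex_eq1 [n e]; apply: zL; exists (- m), n.
by rewrite -e rmorphN mulNr addrC addrK.
Qed.

Lemma nonlat_neq0 : z != 0.
Proof. by apply/eqP => z0; apply: zL; exists 0, 0; rewrite mul0r addr0. Qed.

Lemma theta_factor_neq0 m :
  (1 - q * ex z * q ^+ m != 0) /\ (1 - q * (ex z)^-1 * q ^+ m != 0).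
Proof.
split; rewrite subr_eq0 eq_sym.
  by have := ex_nonlat m.+1; rewrite -exprnP exprS mulrA [ex z * _]mulrC.
apply/eqP => e; have /negP := ex_nonlat (- m.+1%:Z); apply.
have e2 : ex z = q * q ^+ m.
  rewrite -[LHS]mulr1 -e; have := ex_neq0 z.
  by move: (ex z) (q ^+ m) (q) => Z Qm Q Z0; field.
by rewrite -exprnN exprS e2 divff// mulf_neq0 ?expf_neq0.
Qed.

Lemma esin_nonlat : esin z != 0.
Proof.
rewrite esin_factor mulf_neq0 ?oppr_eq0// subr_eq0 eq_sym.
by have := ex_nonlat 0; rewrite expr0z mulr1.
Qed.

Lemma theta_row_neq0 M : theta_row z M != 0.
Proof.
rewrite mulf_neq0 ?esin_nonlat// prodf_seq_neq0; apply/allP => m _ /=.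
have [h1 h2] := theta_factor_neq0 m.
rewrite !mulf_neq0// invr_eq0 expf_neq0// subr_eq0 eq_sym qm_neq1//.
Qed.

Lemma theta_neq0 : theta z tau != 0.
Proof.
have q1 := q_lt1; have q0 := ex_neq0 tau.
rewrite /theta !mulf_neq0 ?esin_nonlat//.
- by apply: qpochhammer_neq0 => // m; have [h _] := theta_factor_neq0 m; rewrite subr_eq0 eq_sym in h.
- by apply: qpochhammer_neq0 => // m; have [_ h] := theta_factor_neq0 m; rewrite subr_eq0 eq_sym in h.
- by rewrite invr_eq0 expf_neq0// qpochhammer_neq0// => m; exact: qm_neq1.
Qed.

End NonLattice.

End FixedTau.
End Theta.

(** * Exchange of rows and columns, and theta at -1/tau *)

Section ThetaInversion.
Variable R : realType.
Local Notation C := R[i].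
Implicit Types (x z a q w tau : C) (r : R).

Lemma finite_lower_bound (T : eqType) (s : seq T) (f : T -> R) :
  (forall t, t \in s -> 0 < f t) -> exists2 k : R, 0 < k & forall t, t \in s -> k <= f t.
Proof.
elim: s => [|y s IH] h; first by exists 1.
have [|k k0 hk] := IH; first by move=> t ts; apply: h; rewrite inE ts orbT.
exists (Num.min k (f y)); first by rewrite lt_min k0 h// mem_head.
by move=> t; rewrite inE ge_min => /orP[/eqP ->|/hk ->//]; rewrite lexx orbT.
Qed.

Lemma prod_ratio (a b c a' b' c' : C) : a * a' * (b * b') / (c * c') - 1 =
  (a * b / c - 1) + (a' * b' / c' - 1) + (a * b / c - 1) * (a' * b' / c' - 1).
Proof. by rewrite invfM; move: c^-1 c'^-1 => d d'; ring. Qed.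

Section FixedTau.
Variable tau : C.
Hypothesis t0 : 0 < complex.Im tau.

(** Squared, this is the decay in the separate indices that [rect_limits] requires of terms of order
    w^-4. The sign [s] covers both m tau + n and m tau - n. *)
Lemma lattice_growth : exists2 A : R, 0 < A &
  forall (m n : nat) (s : R), `|s| = 1 -> (0 < m + n)%N ->
    m.+1%:R * n.+1%:R <= A * nrm (m%:R * tau + s%:C * n%:R) ^+ 2.
Proof.
pose y := complex.Im tau; pose x := complex.Re tau.
have y0 : 0 < y by [].
(* The constants [y^-1], [be] and [ga] bound m, n and 1, respectively, by a multiple of the modulus
   of the lattice point. *)
pose ga := 1 + y^-1; pose be := 1 + `|x| / y.
have yi : 0 < y^-1 by rewrite invr_gt0.
have be0 : 0 <= `|x| / y by rewrite divr_ge0// ltW.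
exists ((y^-1 + ga) * (be + ga)); first by rewrite /ga /be; apply: mulr_gt0; lra.
move=> m n s s1 mn; set w := m%:R * tau + s%:C * n%:R.
have imw : complex.Im w = m%:R * y.
  rewrite /w /y -!(rmorph_nat (real_complex R)); case: (tau) => a b /=; ring.
have rew : complex.Re w = m%:R * x + s * n%:R.
  rewrite /w /x -!(rmorph_nat (real_complex R)); case: (tau) => a b /=; ring.
have h1 : m%:R * y <= nrm w by rewrite -imw (le_trans (ler_norm _))// Im_le_nrm.
have h2 : n%:R <= nrm w + m%:R * `|x|.
  have -> : n%:R = `|complex.Re w - m%:R * x|.
    by rewrite rew addrC addKr normrM s1 mul1r ger0_norm.
  by rewrite (le_trans (ler_normB _ _))// normrM [`|m%:R|]ger0_norm// lerD// Re_le_nrm.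
have m1 : m%:R <= y^-1 * nrm w by rewrite mulrC ler_pdivlMr.
have n1 : n%:R <= be * nrm w.
  apply: le_trans h2 _; rewrite /be mulrDl mul1r lerD2l -mulrA mulrC.
  by rewrite ler_wpM2l.
have o1 : 1 <= ga * nrm w.
  rewrite /ga mulrDl mul1r; have W0 := nrm_ge0 w; case: m mn @w imw rew h1 h2 m1 n1 W0 => [|m] mn w imw rew h1 h2 m1 n1 W0.
    have : 1 <= nrm w; last by have := mulr_ge0 (ltW yi) W0; lra.
    have := h2; rewrite mul0r addr0; apply: le_trans.
    by rewrite ler1n; rewrite add0n in mn.
  have : 1 <= m.+1%:R :> R by rewrite ler1n.
  by move=> h; rewrite (le_trans h)// (le_trans m1)// lerDr.
rewrite expr2 mulrACA; apply: ler_pM => //.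
  by rewrite -addn1 natrD mulrDl lerD.
by rewrite -addn1 natrD mulrDl lerD.
Qed.

Lemma inLN z : inL tau (- z) -> inL tau z.
Proof.
move=> [m [n e]]; exists (- m), (- n).
by rewrite !rmorphN mulNr -opprD -e opprK.
Qed.

Lemma fac_nonlat_neq0 z w : ~ inL tau z -> inL tau w -> fac z w != 0.
Proof.
move=> zL wL; have [->|w0] := eqVneq w 0.
  by rewrite /fac expr0n invr0 mulr0 subr0 oner_neq0.
apply/eqP => /eqP; rewrite /fac subr_eq0 eq_sym => /eqP /divr1_eq /eqP.
rewrite eqf_sqr => /orP[/eqP e|/eqP e]; apply: zL; first by rewrite e.
by apply: inLN; rewrite e opprK.
Qed.

Definition lpt (s : R) (m n : nat) : C := m%:R * tau + s%:C * n%:R.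

Lemma lpt_neq0 (s : R) m n : `|s| = 1 -> (0 < m + n)%N -> lpt s m n != 0.
Proof.
move=> s1 mn; have [A A0 hA] := lattice_growth.
rewrite -nrm_gt0 lt_def nrm_ge0 andbT; apply/eqP => e.
have := hA m n s s1 mn; rewrite -/(lpt s m n) e expr0n mulr0.
by rewrite leNgt mulr_gt0.
Qed.

(** Outside a finite box the lattice points are so large that z^2/w^2 is at most 1/2 in modulus;
    inside it there are finitely many values, none of them zero. *)
Lemma fac_lower_bound z (s : R) : `|s| = 1 -> (forall m n, inL tau (lpt s m n)) -> ~ inL tau z ->
  exists2 k : R, 0 < k & forall m n, (0 < m + n)%N -> k <= nrm (fac z (lpt s m n)).
Proof.
move=> s1 sL zL; have [A A0 hA] := lattice_growth.
have [B hB] : exists B : nat, 2 * A * nrm z ^+ 2 <= B%:R.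
  exists (Num.bound (2 * A * nrm z ^+ 2)); rewrite ltW// archi_boundP//.
  by rewrite mulr_ge0 ?sqr_ge0// mulr_ge0// ltW.
pose pairs := [seq (m, n) | m <- iota 0 B, n <- iota 0 B].
have [|k k0 hk] := @finite_lower_bound _ pairs (fun p => nrm (fac z (lpt s p.1 p.2))).
  by move=> p _; rewrite nrm_gt0 fac_nonlat_neq0.
exists (Num.min k 2^-1); first by rewrite lt_min k0 invr_gt0 ltr0n.
move=> m n mn; rewrite ge_min.
have [/andP[mB nB]|] := boolP ((m < B)%N && (n < B)%N).
  by rewrite (hk (m, n))// allpairs_f// mem_iota.
rewrite negb_and -!leqNgt => big; apply/orP; right.
have Bmn : B%:R <= m.+1%:R * n.+1%:R :> R.
  rewrite -natrM ler_nat; case/orP: big => h; apply: leq_trans h _.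
    by rewrite mulnS (leq_trans (leqnSn m))// leq_addr.
  by rewrite mulSn (leq_trans (leqnSn n))// leq_addr.
have w0 : lpt s m n != 0 by exact: lpt_neq0.
have := le_trans hB (le_trans Bmn (hA m n s s1 mn)); rewrite -/(lpt s m n).
rewrite -mulrA mulrCA ler_pM2l// => h.
have W0 : 0 < nrm (lpt s m n) ^+ 2 by rewrite exprn_gt0// nrm_gt0.
have : nrm (z ^+ 2 / lpt s m n ^+ 2) <= 2^-1.
  by rewrite nrmM nrmV !nrmX ler_pdivrMr// mulrC ler_pdivlMr// mulrC.
have := nrm_triangle 0 (1 : C) (z ^+ 2 / lpt s m n ^+ 2).
have := nrmD (fac z (lpt s m n)) (z ^+ 2 / lpt s m n ^+ 2).
by rewrite /fac subrK nrm1 => h1 _ h2; lra.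
Qed.

Lemma lpt1L m n : inL tau (lpt 1 m n).
Proof. by exists m, n; rewrite /lpt mul1r. Qed.

Lemma lptN1L m n : inL tau (lpt (-1) m n).
Proof. by exists m, (- n%:Z); rewrite /lpt rmorphN rmorph1 mulN1r rmorphN. Qed.

Lemma lat_lpt z m n : lat z tau m.+1 n.+1 = fac z (lpt 1 m.+1 n.+1) * fac z (lpt (-1) m.+1 n.+1).
Proof. by rewrite /lat /lpt rmorphN rmorph1 mul1r mulN1r. Qed.

Lemma lat_lpt0 z m : lat z tau m.+1 0 = fac z (lpt 1 m.+1 0).
Proof. by rewrite /lat /lpt mulr0 addr0. Qed.

Lemma lat_0lpt z n : lat z tau 0 n.+1 = fac z (lpt 1 0 n.+1).
Proof. by rewrite /lat /lpt mul0r add0r mul1r. Qed.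

Section Triple.
Variables z1 z2 z3 : C.
Hypotheses (zz : z1 ^+ 2 + z2 ^+ 2 = z3 ^+ 2) (z3L : ~ inL tau z3).

(** The relation between the squares cancels the terms in w^-2, and only one in w^-4 remains, which
    is summable over the lattice. *)
Lemma fac_triple w : w != 0 -> fac z3 w != 0 ->
  fac z1 w * fac z2 w / fac z3 w - 1 = (z1 * z2) ^+ 2 / (w ^+ 2) ^+ 2 / fac z3 w.
Proof.
rewrite /fac -zz => w0 f0.
have := f0.
have -> : 1 - (z1 ^+ 2 + z2 ^+ 2) / w ^+ 2 = (w ^+ 2 - z1 ^+ 2 - z2 ^+ 2) / w ^+ 2.
  by move: w0 {f0}; move=> w0; field.
rewrite mulf_eq0 negb_or => /andP[f1 _].
by field; rewrite w0 f1.
Qed.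

Lemma fac_triple_bound (s : R) : `|s| = 1 -> (forall m n, inL tau (lpt s m n)) ->
  exists2 D : R, 0 <= D & forall m n, (0 < m + n)%N ->
    nrm (fac z1 (lpt s m n) * fac z2 (lpt s m n) / fac z3 (lpt s m n) - 1) <=
      D * (wt R m * wt R n).
Proof.
move=> s1 sL; have [A A0 hA] := lattice_growth.
have [k k0 hk] := fac_lower_bound s1 sL z3L.
exists (nrm (z1 * z2) ^+ 2 * A ^+ 2 / k).
  by rewrite divr_ge0 ?mulr_ge0 ?sqr_ge0// ltW.
move=> m n mn; have w0 := lpt_neq0 s1 mn.
rewrite fac_triple//; last exact: fac_nonlat_neq0.
have h := hA m n s s1 mn; rewrite -/(lpt s m n) in h.
rewrite nrmM nrmM !nrmV !nrmX.
have W0 : 0 < nrm (lpt s m n) by rewrite nrm_gt0.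
have c0 : 0 < (m.+1%:R * n.+1%:R : R) by rewrite mulr_gt0.
have -> : nrm (z1 * z2) ^+ 2 * A ^+ 2 / k * (wt R m * wt R n) =
    nrm (z1 * z2) ^+ 2 * (A ^+ 2 / (m.+1%:R * n.+1%:R) ^+ 2) / k.
  by rewrite exprMn invfM /wt; ring.
apply: ler_pM.
- by rewrite mulr_ge0 ?invr_ge0 ?sqr_ge0.
- by rewrite invr_ge0.
- rewrite ler_wpM2l ?sqr_ge0// ler_pdivlMr ?exprn_gt0// mulrC ler_pdivrMr ?exprn_gt0//.
  rewrite -exprMn lerXn2r// nnegrE ?mulr_ge0 ?sqr_ge0// ltW//.
- by rewrite lef_pV2 ?posrE ?hk// (lt_le_trans k0)// hk.
Qed.

Let u m n := lat z1 tau m n * lat z2 tau m n / lat z3 tau m n - 1.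

Lemma lat_triple_bound : exists K : R, forall m n, nrm (u m n) <= K * (wt R m * wt R n).
Proof.
have [D D0 hD] := fac_triple_bound (normr1 R) lpt1L.
have [|D' D'0 hD'] := @fac_triple_bound (-1) _ lptN1L; first by rewrite normrN normr1.
have W0 m n : 0 <= wt R m * wt R n by rewrite mulr_ge0 ?wt_ge0.
have K0 : D <= D + D' + D * D' by rewrite -addrA lerDl addr_ge0// mulr_ge0.
exists (D + D' + D * D') => -[|m] [|n].
- by rewrite /u /= divr1 mulr1 subrr nrm0 mulr_ge0// (le_trans D0).
- by rewrite /u !lat_0lpt (le_trans (hD 0%N n.+1 _))// ler_wpM2r.
- by rewrite /u !lat_lpt0 (le_trans (hD m.+1 0%N _))// ler_wpM2r.
have h := hD m.+1 n.+1 isT; have h' := hD' m.+1 n.+1 isT.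
rewrite /u !lat_lpt prod_ratio; move: h h'.
set v := _ / _ - 1; set v' := _ / _ - 1; set W := wt R _ * _ => h h'.
have Wge0 : 0 <= W by exact: W0.
have W1 : W <= 1.
  by rewrite /W mulr_ile1 ?wt_ge0// /wt invf_le1 ?exprn_gt0// exprn_ege1// ler1n.
apply: le_trans (nrmD _ _) _; rewrite nrmM mulrDl; apply: lerD.
  by apply: le_trans (nrmD _ _) _; rewrite mulrDl lerD.
apply: (@le_trans _ _ ((D * W) * (D' * W))); first exact: ler_pM.
rewrite mulrACA ler_wpM2l ?mulr_ge0// ler_piMl//.
Qed.

Hypotheses (z10 : z1 != 0) (z20 : z2 != 0).

Lemma lat_triple_cvg M : cvgC (fun N => rect u M.+1 N.+1)
  (theta_row tau z1 M * theta_row tau z2 M / theta_row tau z3 M * (z3 / (kap R * z1 * z2))).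
Proof.
have z30 := nonlat_neq0 z3L.
have k0 := kap_neq0 R.
pose X z N := \prod_(0 <= m < M.+1) \prod_(0 <= n < N.+1) lat z tau m n.
apply: (cvgC_eq (u := fun N => (kap R * z1 * X z1 N) * (kap R * z2 * X z2 N) / (kap R * z3 * X z3 N) *
    (z3 / (kap R * z1 * z2)))).
  move=> N; rewrite [(_ * X z3 N)^-1]invfM /rect.
  have -> : \prod_(0 <= m < M.+1) \prod_(0 <= n < N.+1) (1 + u m n) = X z1 N * X z2 N / X z3 N.
    rewrite /X -prodfV -!big_split; apply: eq_bigr => m _.
    by rewrite -prodfV -!big_split; apply: eq_bigr => n _; rewrite /u addrC subrK.
  move: (X z1 N) (X z2 N) (X z3 N)^-1 (kap R) k0 => a b c k k0.
  by field; rewrite k0 z10 z20 z30.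
apply: cvgC_M; last exact: cvgC_cst.
apply: cvgC_M; first by apply: cvgC_M; exact: lat_rows_cvg.
by apply: cvgC_V; [exact: theta_row_neq0|exact: lat_rows_cvg].
Qed.

Lemma theta_triple_cvg : cvgC (fun M =>
   theta_row tau z1 M * theta_row tau z2 M / theta_row tau z3 M * (z3 / (kap R * z1 * z2)))
  (theta z1 tau * theta z2 tau / theta z3 tau * (z3 / (kap R * z1 * z2))).
Proof.
apply: cvgC_M; last exact: cvgC_cst.
apply: cvgC_M; first by apply: cvgC_M; exact: theta_row_cvg.
by apply: cvgC_V; [exact: theta_neq0|exact: theta_row_cvg].
Qed.

End Triple.

End FixedTau.

Lemma Im_Ninv tau : 0 < complex.Im tau -> 0 < complex.Im (- tau^-1).
Proof.
case: tau => x y /= y0; rewrite opprK divr_gt0//.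
by rewrite ltr_wpDl ?sqr_ge0// exprn_gt0.
Qed.

Lemma inL_inv tau z : tau != 0 -> inL (- tau^-1) (z / tau) -> inL tau z.
Proof.
move=> t0 [m [n e]]; exists n, (- m).
rewrite -[z](divfK t0) e rmorphN mulrDl mulrN mulNr mulfVK//.
by rewrite addrC.
Qed.

Lemma theta_shift1 z w : theta (z + 1) w = - theta z w.
Proof.
rewrite /theta exD ex1 mulr1 -mulNr; congr (_ * _).
rewrite /esin mulrDl mul1r opprD !exD !exN ex_half.
by rewrite invrN1 !mulrN1 opprB opprK addrC.
Qed.

(** The shift removes the first factor of one Pochhammer symbol and adds a factor to the other; the
    sine factor absorbs both. *)
Lemma theta_shift_tau_at tau : 0 < complex.Im tau -> forall z, theta (z + tau) tau = - ex (- z - tau / 2) * theta z tau.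
Proof.
move=> t0 z; have q1 := q_lt1 t0; have q0 := ex_neq0 tau; have Z0 := ex_neq0 z.
rewrite /theta exD.
rewrite (qpochhammer_rec (ex tau * ex z) q1 q0).
have -> : ex tau * (ex z * ex tau)^-1 = (ex z)^-1 by rewrite invfM mulrCA divff// mulr1.
rewrite (qpochhammer_rec (ex z)^-1 q1 q0).
have -> : ex tau * (ex z * ex tau) = ex tau * ex z * ex tau by rewrite mulrA.
rewrite [(ex z)^-1 * ex tau]mulrC !esin_factor exD.
have e1 : ex (- ((z + tau) / 2)) = ex (- z - tau / 2) * ex (z / 2) by rewrite -exD; congr ex; field.
have e2 : ex (- (z / 2)) = ex (z / 2) / ex z by rewrite -exB; congr ex; field.
rewrite e1 e2; move: (qpochhammer _ _) (qpochhammer _ _) (qpochhammer _ _ ^+ 2)^-1 => A B D.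
move: (ex (- z - _)) (ex (z / 2)) (ex tau) (ex z) Z0 => a b Q Z Z0.
by field.
Qed.

Section Inversion.
Variable tau : C.
Hypothesis t0 : 0 < complex.Im tau.
Let tn0 : tau != 0. Proof. exact: tau_neq0. Qed.
Let t0' := Im_Ninv t0.

(** One double product in two orders: rows first gives theta at tau, columns first gives theta at
    -1/tau by [lat_swap]. The factor z3/(2 pi i z1 z2) in the proof stands for the origin, which
    [lat] omits; its scaling produces the factor tau. *)
Lemma theta_triple z1 z2 z3 : z1 ^+ 2 + z2 ^+ 2 = z3 ^+ 2 -> ~ inL tau z3 -> z1 != 0 -> z2 != 0 ->
  theta z1 tau * theta z2 tau / theta z3 tau =
  tau * (theta (z1 / tau) (- tau^-1) * theta (z2 / tau) (- tau^-1) / theta (z3 / tau) (- tau^-1)).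
Proof.
move=> zz z3L z10 z20; have z30 := nonlat_neq0 z3L; have k0 := kap_neq0 R.
have zz' : (z1 / tau) ^+ 2 + (z2 / tau) ^+ 2 = (z3 / tau) ^+ 2 by rewrite !expr_div_n -mulrDl zz.
have z3L' : ~ inL (- tau^-1) (z3 / tau) by move=> /(inL_inv tn0).
have z10' : z1 / tau != 0 by rewrite mulf_neq0 ?invr_eq0.
have z20' : z2 / tau != 0 by rewrite mulf_neq0 ?invr_eq0.
have [K hK] := lat_triple_bound t0 zz z3L.
have E : theta z1 tau * theta z2 tau / theta z3 tau * (z3 / (kap R * z1 * z2)) =
   theta (z1 / tau) (- tau^-1) * theta (z2 / tau) (- tau^-1) / theta (z3 / tau) (- tau^-1) *
     (z3 / tau / (kap R * (z1 / tau) * (z2 / tau))).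
  apply: (rect_limits hK (lat_triple_cvg t0 z3L z10 z20) (theta_triple_cvg t0 z1 z2 z3L) _
    (theta_triple_cvg t0' (z1 / tau) (z2 / tau) z3L')).
  move=> N; apply: (cvgC_eq _ (lat_triple_cvg t0' z3L' z10' z20' N)) => M.
  rewrite /rect exchange_big; apply: eq_bigr => m _; apply: eq_bigr => n _.
  by rewrite -!lat_swap.
have c0 : z3 / (kap R * z1 * z2) != 0.
  by apply: mulf_neq0 => //; rewrite invr_eq0; apply: mulf_neq0 => //; apply: mulf_neq0.
apply: (mulIf c0); rewrite E.
move: (theta _ _ * theta _ _ / theta _ _) (kap R) k0 {E c0} => T k k0.
by field; rewrite k0 z10 z20 tn0.
Qed.

(* The quotient of the two sides of Jacobi's imaginary transformation. Absolutely
   convergent double products only give [jac z1 * jac z2 = jac z3] when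
   z1^2 + z2^2 = z3^2; together with [jac (z + 1) = jac z] this forces [jac = 1]. *)
Definition jac z : C :=
  tau * theta (z / tau) (- tau^-1) * ex (- (z ^+ 2 / (2 * tau))) / theta z tau.

Lemma jac_neq0 z : ~ inL tau z -> jac z != 0.
Proof.
move=> zL; have zL' : ~ inL (- tau^-1) (z / tau) by move=> /(inL_inv tn0).
apply: mulf_neq0; last by rewrite invr_eq0 theta_neq0.
by apply: mulf_neq0; [apply: mulf_neq0 => //; exact: theta_neq0|exact: ex_neq0].
Qed.

Lemma jac_mul z1 z2 z3 : z1 ^+ 2 + z2 ^+ 2 = z3 ^+ 2 ->
  ~ inL tau z1 -> ~ inL tau z2 -> ~ inL tau z3 -> jac z1 * jac z2 = jac z3.
Proof.
move=> zz L1 L2 L3; have nL z : ~ inL tau z -> ~ inL (- tau^-1) (z / tau).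
  by move=> zL /(inL_inv tn0).
have := theta_triple zz L3 (nonlat_neq0 L1) (nonlat_neq0 L2).
have e : ex (- (z3 ^+ 2 / (2 * tau))) = ex (- (z1 ^+ 2 / (2 * tau))) * ex (- (z2 ^+ 2 / (2 * tau))).
  by rewrite -exD -zz mulrDl opprD.
rewrite /jac e.
have := theta_neq0 t0 L1; have := theta_neq0 t0 L2; have := theta_neq0 t0 L3.
have := theta_neq0 t0' (nL _ L1); have := theta_neq0 t0' (nL _ L2); have := theta_neq0 t0' (nL _ L3).
move: (theta z1 tau) (theta z2 tau) (theta z3 tau) => a1 a2 a3.
move: (theta _ _) (theta _ _) (theta _ _) => b1 b2 b3 h3 h2 h1 g3 g2 g1 E.
have -> : a3 = a1 * a2 * b3 / (tau * b1 * b2).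
  have : a1 * a2 * b3 = tau * b1 * b2 * a3.
    have -> : a1 * a2 * b3 = (a1 * a2 / a3) * a3 * b3 by rewrite divfK.
    by rewrite E; field.
  by move=> ->; field; rewrite h1 h2 tn0.
move: (ex _) (ex _) => c d.
by field; rewrite g1 g2 h1 h2 h3 tn0.
Qed.

(** The shift moves z/tau by a lattice vector of -1/tau, and the Gaussian factor is fitted to cancel
    the resulting quasi-period. *)
Lemma jac_shift1 z : jac (z + 1) = jac z.
Proof.
rewrite /jac theta_shift1.
have -> : theta ((z + 1) / tau) (- tau^-1) =
    - ex (z / tau + (2 * tau)^-1) * theta (z / tau) (- tau^-1).
  have := theta_shift_tau_at t0' ((z + 1) / tau).
  have -> : (z + 1) / tau + - tau^-1 = z / tau by rewrite mulrDl mul1r addrK.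
  move=> ->; rewrite mulrA mulrNN -exD.
  have -> : z / tau + (2 * tau)^-1 + (- ((z + 1) / tau) - - tau^-1 / 2) = 0 by field.
  by rewrite ex0 mul1r.
have -> : ex (- ((z + 1) ^+ 2 / (2 * tau))) =
    ex (- (z ^+ 2 / (2 * tau))) / ex (z / tau + (2 * tau)^-1).
  by rewrite -exB; congr ex; field.
have := ex_neq0 (z / tau + (2 * tau)^-1).
rewrite invrN; move: (theta z tau)^-1 => b.
move: (ex (z / tau + (2 * tau)^-1)) => c c0.
move: (theta _ _) (ex _) => a d.
by field.
Qed.

Lemma inL_shift1 z : inL tau (z + 1) -> inL tau z.
Proof. by move=> [m [n e]]; exists m, (n - 1); rewrite rmorphB addrA -e addrK. Qed.

Lemma jac_eq1 y : ~ inL tau (2 * y) -> jac y = 1.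
Proof.
move=> y2L.
have yL z : ~ inL tau (2 * z) -> ~ inL tau z.
  by move=> h [m [n e]]; apply: h; exists (2 * m), (2 * n); rewrite e !rmorphM mulrDr mulrA.
(* With x = (z^2 - 1)/2 one has x^2 + z^2 = (x + 1)^2, so jac x * jac z = jac (x + 1) = jac x, and
   jac x can be cancelled. *)
have key z : ~ inL tau z -> ~ inL tau ((z ^+ 2 - 1) / 2) -> jac z = 1.
  move=> zL hL; set x := _ / 2 in hL.
  have xL' : ~ inL tau (x + 1) by move=> /inL_shift1.
  have /jac_mul /(_ hL zL xL') : x ^+ 2 + z ^+ 2 = (x + 1) ^+ 2 by rewrite /x; field.
  by rewrite jac_shift1 -[RHS]mulr1 => /(mulfI (jac_neq0 hL)).
(* If the auxiliary point of y is a lattice point, that of y + 1 is not: the two differ by y + 1/2,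
   and 2y would lie in the lattice. *)
have [hL|hL] := pselect (inL tau ((y ^+ 2 - 1) / 2)); last exact: key (yL _ y2L) hL.
rewrite -jac_shift1; apply: key; first by move=> /inL_shift1; exact: yL.
move=> [m [n e]]; have [m' [n' e']] := hL; apply: y2L.
exists (2 * (m - m')), (2 * (n - n') - 1).
have -> : 2 * y = 2 * (((y + 1) ^+ 2 - 1) / 2 - (y ^+ 2 - 1) / 2) - 1 by field.
by rewrite e e' !(rmorphB, rmorphM) /= rmorph1; ring.
Qed.

Lemma theta_inversion z : ~ inL tau (2 * z) ->
  theta (z / tau) (- tau^-1) = tau^-1 * ex (z ^+ 2 / (2 * tau)) * theta z tau.
Proof.
move=> zL; have := jac_eq1 zL; rewrite /jac exN.
have zL1 : ~ inL tau z.
  by move=> [m [n e]]; apply: zL; exists (2 * m), (2 * n); rewrite e !rmorphM mulrDr mulrA.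
have := theta_neq0 t0 zL1; have := ex_neq0 (z ^+ 2 / (2 * tau)).
move: (theta _ _) (theta _ _) (ex _) => a b c c0 b0 h.
have -> : a = (tau * a / c / b) * b * c / tau by field; rewrite b0 c0 tn0.
by rewrite h; field.
Qed.

End Inversion.
End ThetaInversion.

(** * Klein forms and the functions v_j *)

Section Klein.
Variable R : realType.
Local Notation C := R[i].
Implicit Types (z w tau : C) (x y : R).

(* The Klein form with characteristics (x, y), up to a constant. *)
Definition klein x y tau : C :=
  ex (x%:C * (x%:C * tau + y%:C) / 2) * theta (x%:C * tau + y%:C) tau.

Lemma kleinE x y tau z : z = x%:C * tau + y%:C ->
  klein x y tau = ex (x%:C * z / 2) * theta z tau.
Proof. by move=> ->. Qed.

Lemma klein_shift2 x y tau : klein x (y + 1) tau = - ex (x%:C / 2) * klein x y tau.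
Proof.
rewrite /klein rmorphD rmorph1 addrA theta_shift1.
have -> : ex (x%:C * (x%:C * tau + y%:C + 1) / 2) = ex (x%:C / 2) * ex (x%:C * (x%:C * tau + y%:C) / 2).
  by rewrite -exD; congr ex; field.
by ring.
Qed.

Lemma klein_shift1 x y tau : 0 < complex.Im tau ->
  klein (x + 1) y tau = - ex (- (y%:C / 2)) * klein x y tau.
Proof.
move=> t0; rewrite (@kleinE _ _ _ ((x%:C * tau + y%:C) + tau)); last first.
  by rewrite rmorphD rmorph1; ring.
rewrite theta_shift_tau_at// /klein rmorphD rmorph1.
set z := x%:C * tau + y%:C.
have -> : ex ((x%:C + 1) * (z + tau) / 2) =
    ex (- (y%:C / 2)) * ex (x%:C * z / 2) / ex (- z - tau / 2).
  by rewrite -exD -exB; congr ex; rewrite /z; field.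
by have := ex_neq0 (- z - tau / 2); move: (ex (- z - _)) => e e0; field.
Qed.

Lemma shift_iter (F : R -> C) e (n : int) x : e != 0 ->
  (forall y, F (y + 1) = e * F y) -> F (x + n%:~R) = e ^ n * F x.
Proof.
move=> e0 F1.
have pos (m : nat) y : F (y + m%:R) = e ^+ m * F y.
  elim: m => [|m IH]; first by rewrite addr0 mul1r.
  by rewrite -addn1 natrD addrA F1 IH addn1 exprS mulrA.
case: n => n; first exact: pos.
apply: (mulfI (expf_neq0 n.+1 e0)); rewrite -pos NegzE rmorphN /= subrK mulrA -exprnN mulfV ?mul1r//.
by rewrite expf_neq0.
Qed.

Lemma klein_shift2z x y (n : int) tau :
  klein x (y + n%:~R) tau = (- ex (x%:C / 2)) ^ n * klein x y tau.
Proof.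
apply: (@shift_iter (fun y => klein x y tau)); first by rewrite oppr_eq0.
by move=> y'; exact: klein_shift2.
Qed.

Lemma klein_shift1z x y (n : int) tau : 0 < complex.Im tau ->
  klein (x + n%:~R) y tau = (- ex (- (y%:C / 2))) ^ n * klein x y tau.
Proof.
move=> t0; apply: (@shift_iter (fun x => klein x y tau)); first by rewrite oppr_eq0.
by move=> x'; exact: klein_shift1.
Qed.

Lemma thetaN z tau : theta (- z) tau = - theta z tau.
Proof.
by rewrite /theta esinN !exN invrK mulNr [X in - (_ * (X / _))]mulrC.
Qed.

Lemma kleinN x y tau : klein (- x) (- y) tau = - klein x y tau.
Proof.
rewrite (@kleinE _ _ _ (- (x%:C * tau + y%:C))); last by rewrite !rmorphN; ring.
by rewrite thetaN mulrN rmorphN mulrNN.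
Qed.

Lemma klein_translate x y (n : int) tau :
  klein x y (tau + n%:~R) = klein x (x * n%:~R + y) tau.
Proof.
rewrite (@kleinE _ _ _ (x%:C * tau + (x * n%:~R + y)%:C)); last first.
  by rewrite rmorphD rmorphM rmorph_int; ring.
by rewrite /klein /theta [ex (tau + _)]exD ex_int mulr1.
Qed.

(** The requirement of [theta_inversion] that 2z avoid the lattice, in coordinates: it no longer
    depends on tau, and the generators of SL_2(Z) preserve it. *)
Definition nonhalf x y : Prop := ~ exists m n : int, 2 * x = m%:~R /\ 2 * y = n%:~R.

Lemma real_coords tau x y x' y' : 0 < complex.Im tau ->
  x%:C * tau + y%:C = x'%:C * tau + y'%:C -> x = x' /\ y = y'.
Proof.
move=> t0 e; have := congr1 (@complex.Im _) e; rewrite !Im_lat => /(mulIf (negbT (gt_eqF t0))) xx.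
by split=> //; move: e; rewrite xx => /addrI [].
Qed.

Lemma nonhalf_nonL tau x y : 0 < complex.Im tau -> nonhalf x y ->
  ~ inL tau (2 * (x%:C * tau + y%:C)).
Proof.
move=> t0 h [m [n e]]; apply: h; exists m, n.
apply: (real_coords t0); rewrite !rmorph_int -e !rmorphM !rmorph_nat; ring.
Qed.

Lemma klein_inversion x y tau : 0 < complex.Im tau -> nonhalf y (- x) ->
  klein x y (- tau^-1) = tau^-1 * klein y (- x) tau.
Proof.
move=> t0 h; have tn0 := tau_neq0 t0.
set z := y%:C * tau + (- x)%:C.
rewrite (@kleinE _ _ _ (z / tau)); last by rewrite /z rmorphN; field.
rewrite (theta_inversion t0 (nonhalf_nonL t0 h)) (@kleinE y (- x) _ z)//.
have -> : ex (y%:C * z / 2) = ex (x%:C * (z / tau) / 2) * ex (z ^+ 2 / (2 * tau)).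
  by rewrite -exD; congr ex; rewrite /z rmorphN; field.
by ring.
Qed.

Lemma Im_div z w : complex.Im (z / w) =
  (complex.Im z * complex.Re w - complex.Re z * complex.Im w) / nrm w ^+ 2.
Proof. by rewrite nrm_sqr; case: z => a b; case: w => c d /=; ring. Qed.

Lemma automorphy_neq0 (a b c d : int) tau : a * d - b * c = 1 -> 0 < complex.Im tau ->
  c%:~R * tau + d%:~R != 0.
Proof.
move=> det t0; apply/eqP => e.
have [c0 d0] : (c%:~R : R) = 0 /\ (d%:~R : R) = 0.
  by apply: (real_coords t0); rewrite !rmorph_int e !rmorph0 mul0r addr0.
move/eqP: c0 d0; rewrite intr_eq0 => /eqP c0 /eqP; rewrite intr_eq0 => /eqP d0.
by move: det; rewrite c0 d0 !mulr0 subr0.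
Qed.

Lemma Im_moebius (a b c d : int) tau : a * d - b * c = 1 ->
  complex.Im ((a%:~R * tau + b%:~R) / (c%:~R * tau + d%:~R)) =
  complex.Im tau / nrm (c%:~R * tau + d%:~R) ^+ 2.
Proof.
move=> det; rewrite Im_div; congr (_ / _).
rewrite -!(rmorph_int (real_complex R)).
have : (a%:~R * d%:~R - b%:~R * c%:~R : R) = 1 by rewrite -!rmorphM -rmorphB det.
case: tau => u v /=; move: (a%:~R) (b%:~R) (c%:~R) (d%:~R) => A B D E h.
by rewrite -[RHS]mulr1 -h; ring.
Qed.

Lemma moebius_in_H (a b c d : int) tau : a * d - b * c = 1 -> 0 < complex.Im tau ->
  0 < complex.Im ((a%:~R * tau + b%:~R) / (c%:~R * tau + d%:~R)).
Proof.
move=> det t0; rewrite Im_moebius// divr_gt0// exprn_gt0// nrm_gt0.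
exact: automorphy_neq0 det t0.
Qed.

Definition klein_law (a b c d : int) : Prop := forall x y tau, 0 < complex.Im tau -> nonhalf x y ->
  klein x y ((a%:~R * tau + b%:~R) / (c%:~R * tau + d%:~R)) =
  (c%:~R * tau + d%:~R)^-1 * klein (x * a%:~R + y * c%:~R) (x * b%:~R + y * d%:~R) tau.

Lemma nonhalf_shift x y (n : int) : nonhalf x y -> nonhalf x (x * n%:~R + y).
Proof.
move=> h [m [k [e1 e2]]]; apply: h; exists m, (k - m * n); split=> //.
by rewrite rmorphB rmorphM /= -e1 -e2; ring.
Qed.

Lemma nonhalf_swap x y : nonhalf x y -> nonhalf y (- x).
Proof.
move=> h [m [k [e1 e2]]]; apply: h; exists (- k), m; split=> //.
by rewrite rmorphN /= -e2; ring.
Qed.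

Lemma klein_eq x x' y y' tau : x = x' -> y = y' -> klein x y tau = klein x' y' tau.
Proof. by move=> -> ->. Qed.

Lemma klein_law_T (a b c d n : int) : a * d - b * c = 1 ->
  klein_law a b c d -> klein_law (a + n * c) (b + n * d) c d.
Proof.
move=> det h x y tau t0 xy; have j0 := automorphy_neq0 det t0.
have -> : ((a + n * c)%:~R * tau + (b + n * d)%:~R) / (c%:~R * tau + d%:~R) =
    (a%:~R * tau + b%:~R) / (c%:~R * tau + d%:~R) + n%:~R.
  rewrite !rmorphD !rmorphM /=; field; exact: j0.
rewrite klein_translate (h _ _ _ t0 (nonhalf_shift (n := n) xy)) !rmorphD !rmorphM /=.
by apply: congr1; apply: klein_eq; ring.
Qed.

Lemma klein_law_S (a b c d : int) : a * d - b * c = 1 ->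
  klein_law a b c d -> klein_law (- c) (- d) a b.
Proof.
move=> det h x y tau t0 xy; have j0 := automorphy_neq0 det t0.
have det' : (- c) * b - (- d) * a = 1 by rewrite -det; ring.
have i0 := automorphy_neq0 det' t0.
have g0 := moebius_in_H det t0.
have -> : ((- c)%:~R * tau + (- d)%:~R) / (a%:~R * tau + b%:~R) =
   - ((a%:~R * tau + b%:~R) / (c%:~R * tau + d%:~R))^-1.
  by rewrite !rmorphN /= invf_div mulNr -opprD mulNr.
have xy' := nonhalf_swap xy.
rewrite (klein_inversion g0 xy') (h _ _ _ t0 xy') invf_div mulrA.
rewrite [X in X * _ = _](_ : _ = (a%:~R * tau + b%:~R)^-1); last first.
  by rewrite mulrAC divff// mul1r.
by apply: congr1; apply: klein_eq; rewrite rmorphN /=; ring.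
Qed.

(** The Euclidean algorithm on the first column, by induction on |c|: [klein_law_T] is the division
    step, [klein_law_S] the swap, and c = 0 leaves translations up to sign. *)
Lemma klein_SL2 (a b c d : int) : a * d - b * c = 1 -> klein_law a b c d.
Proof.
have [n] := ubnP `|c|%N; elim: n a b c d => // n IH a b c d cn det.
have [c0|c0] := eqVneq c 0.
  have base (b' : int) : klein_law 1 b' 0 1.
    move=> x y tau t0 xy.
    rewrite !rmorph0 !rmorph1 mul1r mul0r add0r divr1 invr1 mul1r klein_translate.
    by rewrite mulr0 addr0 !mulr1.
  rewrite c0 mulr0 subr0 in det *.
  have [[-> ->]|[-> ->]] : (a = 1 /\ d = 1) \/ (a = -1 /\ d = -1).
    have : a \is a GRing.unit by apply/unitrPr; exists d.
    rewrite qualifE /= => /orP[]/eqP ea; move: det; rewrite ea; [left|right]; split=> //; lia.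
  - exact: base.
  - move=> x y tau t0 xy.
    have -> : (-1)%:~R * tau + b%:~R = - (tau + (- b)%:~R) by rewrite !rmorphN /=; ring.
    have -> : 0%:~R * tau + (-1)%:~R = -1 by rewrite rmorph0 mul0r add0r rmorphN.
    rewrite invrN1 mulrNN mulr1 mulN1r klein_translate -kleinN.
    by apply: klein_eq; rewrite !rmorphN /=; ring.
have [q [r [e r0 rc]]] : exists q r, [/\ a = r + q * c, 0 <= r & (`|r| < `|c|)%N].
  exists (a %/ c)%Z, (a %% c)%Z; split; first by rewrite addrC -divz_eq.
    exact: modz_ge0.
  by have := ltz_mod a c0; have := modz_ge0 a c0; lia.
rewrite e; pose b' := b - q * d; have -> : b = b' + q * d by rewrite /b' subrK.
have det1 : r * d - b' * c = 1 by rewrite -det e /b'; ring.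
apply: klein_law_T => //.
(* The swap reduces to the matrix with rows (c, d) and (-r, -b'), whose lower left entry is
   smaller. *)
rewrite -[r]opprK -[b']opprK; apply: klein_law_S; first by rewrite -det1; ring.
apply: IH; last by rewrite -det1; ring.
by rewrite abszN (leq_trans rc)// -ltnS.
Qed.

End Klein.

(** * Transformation of [K 5 i] and [v j] under Gamma_0(5) *)

Section KFunctions.
Variable R : realType.
Local Notation C := R[i].
Implicit Types (z w tau : C) (x y : R).

Lemma Im_natM n tau : complex.Im (n%:R * tau) = n%:R * complex.Im tau.
Proof. by rewrite -(rmorph_nat (real_complex R)); case: tau => x y /=; ring. Qed.

(** [K 5 i] without its fractional power of q. *)
Definition Ku (i : nat) tau : C :=
  qpochhammer (ex (i%:R * tau)) (ex (5%:R * tau)) * qpochhammer (ex ((5 - i)%:R * tau)) (ex (5%:R * tau)) /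
  qpochhammer (ex (5%:R * tau)) (ex (5%:R * tau)) ^+ 2.

Lemma KE i tau : (i <= 5)%N ->
  K 5 i tau = ex (i%:R * (i%:R - 5%:R) / 10%:R * tau) * Ku i tau.
Proof.
move=> i5; rewrite /K /Ku !qpowE.
have -> : ratr (i%:R * (i%:R - 5%:R) / (2 * 5%:R) : rat) = i%:R * (i%:R - 5%:R) / 10%:R :> C.
  rewrite rmorphM fmorphV rmorphM rmorphB /= !ratr_nat; congr (_ / _).
  by rewrite rmorphM /= !ratr_nat -natrM.
have -> : ratr (5%:R - i%:R : rat) = (5 - i)%:R :> C by rewrite rmorphB /= !ratr_nat natrB.
by rewrite !ratr_nat.
Qed.

Lemma ex_nat_tq n tau : ex (n%:R * tau) = tq 1 tau ^+ n.
Proof. by rewrite /tq divr1 exMn. Qed.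

Lemma unitQ_Ku i : (0 < i < 5)%N -> unitQ 1 (@is_int R) (Ku i).
Proof.
move=> /andP[i0 i5]; have I := is_int_subring R.
have one : is_int (1 : C) by exists 1.
have n1 : nrm (1 : C) <= 1 by rewrite nrm1.
have U k : (0 < k)%N -> unitQ 1 (@is_int R)
    (fun tau => qpochhammer (ex (k%:R * tau)) (ex (5%:R * tau))).
  move=> k0; have := @unitQ_qpochhammer _ 1 _ isT I _ _ 5 k0 isT n1 one.
  apply: unitQ_eq => tau _.
  by rewrite mul1r !ex_nat_tq.
apply: unitQ_M => //; first by apply: unitQ_M => //; apply: U; rewrite // subn_gt0.
by apply: unitQ_V; apply: unitQ_X => //; exact: U.
Qed.

Lemma K_neq0 i tau : (0 < i < 5)%N -> 0 < complex.Im tau -> K 5 i tau != 0.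
Proof.
move=> i5 t0; rewrite KE; last by case/andP: i5 => _ /ltnW.
by have [a [b [_ _ _ h _]]] := unitQ_Ku i5; rewrite mulf_neq0 ?h.
Qed.

Lemma K_sym i tau : (i <= 5)%N -> K 5 (5 - i) tau = K 5 i tau.
Proof.
move=> i5; have h1 := KE tau (leq_subr i 5); have h2 := KE tau i5.
rewrite h1 h2 {h1 h2} /Ku (subKn i5).
rewrite [X in _ * (X / _) = _]mulrC (natrB _ i5).
have -> : (5%:R - i%:R) * (5%:R - i%:R - 5%:R) / 10%:R = i%:R * (i%:R - 5%:R) / 10%:R :> C by ring.
by [].
Qed.

Lemma K14 tau : K 5 1 tau = K 5 4 tau.
Proof. by rewrite -[RHS](@K_sym 4 tau isT). Qed.

Lemma K23 tau : K 5 2 tau = K 5 3 tau.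
Proof. by rewrite -[RHS](@K_sym 3 tau isT). Qed.

Lemma K_klein i tau : (0 < i < 5)%N -> 0 < complex.Im tau ->
  K 5 i tau = - klein (i%:R / 5) 0 (5%:R * tau).
Proof.
move=> /andP[i0 i5] t0; rewrite KE ?(ltnW i5)//.
have t5 : 0 < complex.Im (5%:R * tau) by rewrite Im_natM mulr_gt0.
rewrite (@kleinE _ _ _ _ (i%:R * tau)); last first.
  by rewrite rmorphM fmorphV !rmorph_nat rmorph0; field.
rewrite /theta esin_factor.
have e : ex (5%:R * tau) * (ex (i%:R * tau))^-1 = ex ((5 - i)%:R * tau).
  by rewrite -exB natrB ?(ltnW i5)// mulrBl.
rewrite e /Ku (qpochhammer_rec (ex (i%:R * tau)) (q_lt1 t5) (ex_neq0 _)).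
rewrite [ex (i%:R * tau) * _]mulrC.
have -> : ex (i%:R * (i%:R - 5) / 10 * tau) =
    ex ((i%:R / 5)%:C * (i%:R * tau) / 2) * ex (- (i%:R * tau / 2)).
  by rewrite -exD; congr ex; rewrite rmorphM fmorphV !rmorph_nat; field.
ring.
Qed.

Lemma vE j tau : 0 < complex.Im tau ->
  v j tau = ex (j%:R * tau / 5) * (Ku 1 tau ^ (j%:Z - 3) * Ku 2 tau ^ (2 - j%:Z)).
Proof.
move=> t0; rewrite /v (@KE 1)// (@KE 2)// !expfzMl mulrACA -!exMz -exD.
have -> : (j%:Z - 3)%:~R * (1%:R * (1%:R - 5%:R) / 10%:R * tau) +
    (2 - j%:Z)%:~R * (2%:R * (2%:R - 5%:R) / 10%:R * tau) = j%:R * tau / 5.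
  by rewrite !rmorphB /=; field.
by [].
Qed.

Definition vu (j : nat) tau : C := Ku 1 tau ^ (j%:Z - 3) * Ku 2 tau ^ (2 - j%:Z).

Lemma unitQ_vu j : unitQ 1 (@is_int R) (vu j).
Proof.
have I := is_int_subring R.
by apply: unitQ_M => //; apply: unitQ_Xz => //; exact: unitQ_Ku.
Qed.

Lemma v_neq0 j tau : 0 < complex.Im tau -> v j tau != 0.
Proof. by move=> t0; rewrite /v mulf_neq0// expfz_neq0// K_neq0. Qed.

Lemma nonhalf_fifth i : (0 < i < 5)%N -> nonhalf (i%:R / 5 : R) 0.
Proof.
move=> i5 [m [n [e _]]].
have : (2 * i%:Z)%:~R = (5 * m)%:~R :> R by rewrite !rmorphM /= -e; field.
by move/intr_inj; case: i i5 {e} => [|[|[|[|[|]]]]]// _; lia.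
Qed.

(** Multiplication by 5 conjugates the matrix to the one with rows (a, 5b) and (c', d). It sends the
    characteristics (i/5, 0) to (ia/5, ib), which differ from (i'/5, 0) by integers; the two shifts
    give the constants. *)
Lemma K_Gamma0 (a b c' d k : int) i i' tau : (0 < i < 5)%N -> (0 < i' < 5)%N ->
  a * d - b * (5 * c') = 1 -> i%:Z * a = i'%:Z + 5 * k -> 0 < complex.Im tau ->
  K 5 i ((a%:~R * tau + b%:~R) / ((5 * c')%:~R * tau + d%:~R)) =
  ((5 * c')%:~R * tau + d%:~R)^-1 *
    ((- ex (i%:R * a%:~R / 10)) ^ (i%:Z * b) * (-1) ^ k * K 5 i' tau).
Proof.
move=> i5 i5' det ia t0.
have t5 : 0 < complex.Im (5%:R * tau) by rewrite Im_natM mulr_gt0.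
have g0 := moebius_in_H det t0; have j0 := automorphy_neq0 det t0.
rewrite !K_klein//.
have det' : a * d - (5 * b) * c' = 1 by rewrite -[RHS]det; ring.
have -> : 5%:R * ((a%:~R * tau + b%:~R) / ((5 * c')%:~R * tau + d%:~R)) =
   (a%:~R * (5%:R * tau) + (5 * b)%:~R) / (c'%:~R * (5%:R * tau) + d%:~R).
  rewrite !rmorphM /= mulrA; congr (_ / _); ring.
rewrite (klein_SL2 det' t5 (nonhalf_fifth i5)).
rewrite !mul0r !addr0.
have -> : i%:R / 5 * (5 * b)%:~R = 0 + (i%:Z * b)%:~R :> R by rewrite !rmorphM /=; field.
have e5 : i%:R / 5 * a%:~R = i'%:R / 5 + k%:~R :> R.
  have : (i%:Z * a)%:~R = (i'%:Z + 5 * k)%:~R :> R by rewrite ia.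
  rewrite rmorphD !rmorphM /= => h; apply: (mulIf (_ : (5 : R) != 0)) => //.
  by rewrite mulrDl divfK// [k%:~R * _]mulrC -h; field.
rewrite klein_shift2z e5 klein_shift1z//.
rewrite rmorph0 mul0r oppr0 ex0.
have -> : (i'%:R / 5 + k%:~R : R)%:C / 2 = i%:R * a%:~R / 10 :> C.
  by rewrite -e5 !rmorphM fmorphV /= !rmorph_nat rmorph_int; field.
have -> : c'%:~R * (5%:R * tau) + d%:~R = (5 * c')%:~R * tau + d%:~R.
  by rewrite rmorphM /=; ring.
ring.
Qed.

Lemma zpow5 w (m n : int) : w != 0 -> w ^ (5 : int) = 1 -> w ^ (m + 5 * n) = w ^ m.
Proof. by move=> w0 w5; rewrite expfzDr// -exprz_exp w5 exp1rz mulr1. Qed.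

Lemma zpowN1_even (n : int) : (-1 : C) ^ (2 * n) = 1.
Proof. by rewrite -exprz_exp (_ : (-1) ^ 2 = 1 :> C) ?exp1rz// -[_ ^ _]/((-1) ^+ 2) sqrrN expr1n. Qed.

Lemma zpowN_even w (n : int) : (- w) ^ (2 * n) = w ^ (2 * n).
Proof. by rewrite -mulN1r expfzMl zpowN1_even mul1r. Qed.

Lemma ex_fifth_pow5 : ex (5^-1 : C) ^ (5 : int) = 1.
Proof. by rewrite -exMz mulfV ?ex1. Qed.

(** The exponents j-3 and 2-j in [v j] sum to -1, so that two functions of weight -1 combine to
    weight 1. *)
Lemma v_scale (J w1 w2 A B : C) (m n : int) : J != 0 -> m + n = -1 ->
  (J^-1 * (w1 * A)) ^ m * (J^-1 * (w2 * B)) ^ n = J * (w1 ^ m * w2 ^ n) * (A ^ m * B ^ n).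
Proof.
move=> J0 mn; rewrite !expfzMl.
have e : J^-1 ^ m * J^-1 ^ n = J by rewrite -expfzDr ?invr_eq0// mn exprN1 invrK.
rewrite -[X in _ = X * _ * _]e {e}.
by move: (J^-1 ^ m) (J^-1 ^ n) (w1 ^ m) (w2 ^ n) (A ^ m) (B ^ n) => *; ring.
Qed.

Lemma v_Gamma1 (a b c' d a' : int) j tau : a = 1 + 5 * a' ->
  a * d - b * (5 * c') = 1 -> 0 < complex.Im tau ->
  v j ((a%:~R * tau + b%:~R) / ((5 * c')%:~R * tau + d%:~R)) =
  ((5 * c')%:~R * tau + d%:~R) * (ex 5^-1 ^ (b * j%:Z) * v j tau).
Proof.
move=> aE det t0; set w := ex 5^-1; set J := (5 * c')%:~R * tau + d%:~R.
have w0 : w != 0 by exact: ex_neq0.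
have J0 : J != 0 by exact: automorphy_neq0 det t0.
have w5 : w ^ (5 : int) = 1 by exact: ex_fifth_pow5.
have k2 : K 5 2 ((a%:~R * tau + b%:~R) / J) = J^-1 * (w ^ (2 * b) * K 5 2 tau).
  rewrite (@K_Gamma0 a b c' d (2 * a') 2 2)//; last by rewrite aE; lia.
  have -> : ex (2%:R * a%:~R / 10) = w ^ a by rewrite -exMz; apply: congr1; field.
  rewrite zpowN1_even mulr1 zpowN_even exprz_exp -/J.
  have -> : a * (2%:Z * b) = 2 * b + 5 * (2 * a' * b) by rewrite aE; ring.
  by rewrite zpow5.
have k1 : K 5 1 ((a%:~R * tau + b%:~R) / J) = J^-1 * (w ^ (8 * b) * K 5 1 tau).
  (* The index 4 instead of 1 makes all exponents even, so that the signs disappear and fifth roots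
     of unity remain. *)
  rewrite (K14 tau) (K14 (_ / _)).
  rewrite (@K_Gamma0 a b c' d (4 * a') 4 4)//; last by rewrite aE; lia.
  have -> : ex (4%:R * a%:~R / 10) = w ^ (2 * a).
    by rewrite -exMz rmorphM /=; apply: congr1; field.
  have -> : 4 * a' = 2 * (2 * a') by ring.
  have -> : 4%:Z * b = 2 * (2 * b) by ring.
  rewrite zpowN1_even mulr1 zpowN_even exprz_exp -/J.
  have -> : 2 * a * (2 * (2 * b)) = 8 * b + 5 * (8 * a' * b) by rewrite aE; ring.
  by rewrite zpow5.
have n1 : K 5 1 tau != 0 by exact: K_neq0.
have n2 : K 5 2 tau != 0 by exact: K_neq0.
rewrite /v k1 k2 v_scale//; last by ring.
have -> : (w ^ (8 * b)) ^ (j%:Z - 3) * (w ^ (2 * b)) ^ (2 - j%:Z) = w ^ (b * j%:Z).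
  rewrite !exprz_exp -expfzDr//.
  have -> : 8 * b * (j%:Z - 3) + 2 * b * (2 - j%:Z) = b * j%:Z + 5 * (b * j%:Z - 4 * b) by ring.
  by rewrite zpow5.
by rewrite -mulrA.
Qed.

Lemma K_Gamma0_const (a b c' d : int) i i' : (0 < i < 5)%N -> (0 < i' < 5)%N ->
  a * d - b * (5 * c') = 1 -> (exists k, i%:Z * a = i'%:Z + 5 * k) ->
  exists2 e : C, e != 0 & forall tau, 0 < complex.Im tau ->
  K 5 i ((a%:~R * tau + b%:~R) / ((5 * c')%:~R * tau + d%:~R)) =
  ((5 * c')%:~R * tau + d%:~R)^-1 * (e * K 5 i' tau).
Proof.
move=> i5 i5' det [k ia].
exists ((- ex (i%:R * a%:~R / 10)) ^ (i%:Z * b) * (-1) ^ k).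
  by rewrite mulf_neq0// expfz_neq0// oppr_eq0// oner_neq0.
by move=> tau t0; rewrite (K_Gamma0 i5 i5' det ia t0).
Qed.

(* At the cusps equivalent to infinity under Gamma_0(5) the functions [v j] are
   permuted, up to constants, by the diamond operators. *)
Lemma v_Gamma0 (a b c' d : int) j : (j <= 5)%N -> a * d - b * (5 * c') = 1 ->
  ((exists q : int, a = 1 + 5 * q \/ a = - 1 + 5 * q) /\
   exists2 e : C, e != 0 & forall tau, 0 < complex.Im tau ->
    v j ((a%:~R * tau + b%:~R) / ((5 * c')%:~R * tau + d%:~R)) =
    ((5 * c')%:~R * tau + d%:~R) * (e * v j tau)) \/
  (exists2 e : C, e != 0 & forall tau, 0 < complex.Im tau ->
    v j ((a%:~R * tau + b%:~R) / ((5 * c')%:~R * tau + d%:~R)) =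
    ((5 * c')%:~R * tau + d%:~R) * (e * v (5 - j) tau)).
Proof.
move=> j5 det.
have K3 tau : K 5 3 tau = K 5 2 tau by rewrite K23.
have K4 tau : K 5 4 tau = K 5 1 tau by rewrite K14.
have key i1 i2 (f1 f2 : C -> C) : K 5 i1 =1 f1 -> K 5 i2 =1 f2 ->
    (0 < i1 < 5)%N -> (0 < i2 < 5)%N ->
    (exists k, 1%:Z * a = i1%:Z + 5 * k) -> (exists k, 2%:Z * a = i2%:Z + 5 * k) ->
    exists2 e : C, e != 0 & forall tau, 0 < complex.Im tau ->
    v j ((a%:~R * tau + b%:~R) / ((5 * c')%:~R * tau + d%:~R)) =
    ((5 * c')%:~R * tau + d%:~R) * (e * (f1 tau ^ (j%:Z - 3) * f2 tau ^ (2 - j%:Z))).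
  move=> F1 F2 h1 h2 k1 k2.
  have [e1 e10 E1] := K_Gamma0_const (isT : (0 < 1 < 5)%N) h1 det k1.
  have [e2 e20 E2] := K_Gamma0_const (isT : (0 < 2 < 5)%N) h2 det k2.
  exists (e1 ^ (j%:Z - 3) * e2 ^ (2 - j%:Z)); first by rewrite mulf_neq0 ?expfz_neq0.
  move=> tau t0; rewrite {1}/v (E1 _ t0) (E2 _ t0) F1 F2.
  rewrite v_scale ?(automorphy_neq0 det t0)//; last by ring.
  by rewrite -mulrA.
have vN tau : K 5 2 tau ^ (j%:Z - 3) * K 5 1 tau ^ (2 - j%:Z) = v (5 - j) tau.
  rewrite /v -subzn// mulrC; congr (_ ^ _ * _ ^ _); ring.
have [q [r [ea r0 r5]]] : exists q r, [/\ a = r + 5 * q, 0 <= r & r < 5].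
  exists (a %/ 5)%Z, (a %% 5)%Z; split; rewrite ?modz_ge0 ?ltz_pmod//.
  by rewrite addrC mulrC -divz_eq.
(* For r = 0 the determinant would be divisible by 5. The residues 1 and 4 keep [K 5 1] and [K 5 2]
   in place; 2 and 3 exchange them, which turns [v j] into [v (5 - j)]. *)
have : [\/ r = 1, r = 2, r = 3 | r = 4].
  case: r r0 r5 ea => // -[|[|[|[|[|r]]]]]// _ _ ea; try by constructor.
  move: det; rewrite ea add0r; set p := q * d => det; exfalso.
  have : 5 * (q * d - b * c') = 1 by rewrite -[RHS]det; ring.
  lia.
case=> er; rewrite er in ea.
- have k1 : exists k, 1%:Z * a = 1%:Z + 5 * k by exists q; rewrite ea; ring.
  have k2 : exists k, 2%:Z * a = 2%:Z + 5 * k by exists (2 * q); rewrite ea; ring.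
  have [e e0 E] := key 1%N 2%N _ _ (frefl _) (frefl _) isT isT k1 k2.
  by left; split; [exists q; left|exists e].
- have k1 : exists k, 1%:Z * a = 2%:Z + 5 * k by exists q; rewrite ea; ring.
  have k2 : exists k, 2%:Z * a = 4%:Z + 5 * k by exists (2 * q); rewrite ea; ring.
  have [e e0 E] := key 2%N 4%N _ _ (frefl _) K4 isT isT k1 k2.
  by right; exists e => // tau t0; rewrite -vN; exact: E.
- have k1 : exists k, 1%:Z * a = 3%:Z + 5 * k by exists q; rewrite ea; ring.
  have k2 : exists k, 2%:Z * a = 1%:Z + 5 * k by exists (1 + 2 * q); rewrite ea; ring.
  have [e e0 E] := key 3%N 1%N _ _ K3 (frefl _) isT isT k1 k2.
  by right; exists e => // tau t0; rewrite -vN; exact: E.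
- have k1 : exists k, 1%:Z * a = 4%:Z + 5 * k by exists q; rewrite ea; ring.
  have k2 : exists k, 2%:Z * a = 3%:Z + 5 * k by exists (1 + 2 * q); rewrite ea; ring.
  have [e e0 E] := key 4%N 3%N _ _ K4 K3 isT isT k1 k2.
  left; split; last by exists e.
  by exists (q + 1); right; rewrite ea; ring.
Qed.

End KFunctions.

(** * Expansions at the cusps not over infinity *)

Section CuspZero.
Variable R : realType.
Local Notation C := R[i].
Implicit Types (z w tau : C) (x y : R).

Lemma unitQ_theta (j : int) y : unitQ 5 (fun=> True)
  (fun tau : C => let t := (tau + j%:~R) / 5%:R in
    qpochhammer (ex t * ex y%:C) (ex t) * qpochhammer (ex t * (ex y%:C)^-1) (ex t) /
    qpochhammer (ex t) (ex t) ^+ 2).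
Proof.
have T := trivial_subring R.
have U (c : C) : nrm c <= 1 -> unitQ 1 (fun=> True)
    (fun t : C => qpochhammer (ex t * c) (ex t)).
  move=> c1; have := @unitQ_qpochhammer _ 1 _ isT T c 1 1 isT isT c1 I.
  by apply: unitQ_eq => t _; rewrite /tq divr1 !expr1 mulrC.
have n1 : nrm (ex y%:C) <= 1 by rewrite nrm_ex_real.
have n2 : nrm (ex y%:C)^-1 <= 1 by rewrite nrmV nrm_ex_real invr1.
have n3 : nrm (1 : C) <= 1 by rewrite nrm1.
pose F (t : C) := qpochhammer (ex t * ex y%:C) (ex t) * qpochhammer (ex t * (ex y%:C)^-1) (ex t) /
    qpochhammer (ex t * 1) (ex t) ^+ 2.
have hF : unitQ 1 (fun=> True) F.
  apply: unitQ_M => //; first by apply: unitQ_M => //; exact: U.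
  by apply: unitQ_V; apply: unitQ_X => //; exact: U.
have := unitQ_shift j%:~R (isT : (0 < 1 * 5)%N) (@unitQ_divz R 1 _ isT 5 F isT hF).
by apply: unitQ_eq => t _; rewrite /F mulr1 rmorph_int.
Qed.

Lemma esin_real_neq0 y : ~ (exists n : int, y = n%:~R) -> esin (y%:C : C) != 0.
Proof.
move=> hy; rewrite esin_factor mulf_neq0 ?oppr_eq0//.
rewrite subr_eq0 eq_sym; apply/eqP => /ex_eq1 [n e]; apply: hy; exists n.
by move/(congr1 (@complex.Re _)): e; rewrite /= -(rmorph_int (real_complex R)).
Qed.

(* [c tau + d = 5 (c t + e)] for [t = (tau + j) / 5] and [d = c j + 5 e]: away from
   the cusps of [Gamma_0(5)] over infinity, [K 5 i] is a unit in [q^(1/5)]. *)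
Lemma K_cusp0 (a b c d j e : int) i : (0 < i < 5)%N -> a * d - b * c = 1 ->
  d = c * j + 5 * e ->
  exists2 k : C, k != 0 & exists2 U : C -> C, unitQ 5 (fun=> True) U &
  forall tau, 0 < complex.Im tau ->
  K 5 i ((a%:~R * tau + b%:~R) / (c%:~R * tau + d%:~R)) =
  (c%:~R * tau + d%:~R)^-1 * (k * U tau).
Proof.
move=> i5 det dE; pose m : int := b - a * j; pose y : R := i%:R / 5 * m%:~R.
have det' : (5 * a) * e - m * c = 1 by rewrite -[RHS]det dE /m; ring.
(* By [det'], m is prime to 5. So y = im/5 is no integer, and the sine factor of theta, here a
   constant, does not vanish. *)
have yn : ~ exists n : int, y = n%:~R.
  move=> [n ey]; have : (i%:Z * m)%:~R = (5 * n)%:~R :> R.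
    by rewrite !rmorphM /= -ey /y; field.
  move/intr_inj => im.
  have : i%:Z = 5 * (i%:Z * (a * e) - n * c).
    transitivity (i%:Z * (5 * a * e) - (5 * n) * c); last by ring.
    by rewrite -im -[LHS]mulr1 -[X in _ * X = _]det'; ring.
  by move: (_ - _ : int) => p; case/andP: i5; lia.
exists (- 5 * ((- ex (- (y%:C / 2))) ^ (i%:Z * a) * esin y%:C)).
  rewrite mulf_neq0 ?oppr_eq0 ?pnatr_eq0// mulf_neq0 ?esin_real_neq0//.
  by rewrite expfz_neq0// oppr_eq0.
refine (ex_intro2 _ _ _ (unitQ_theta j y) _).
move=> tau t0 /=; set t := (tau + j%:~R) / 5%:R; set J := c%:~R * tau + d%:~R.
have J0 : J != 0 by exact: automorphy_neq0 det t0.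
have tt0 : 0 < complex.Im t.
  rewrite /t Im_divn divr_gt0// -(rmorph_int (real_complex R)).
  by case: tau t0 {t J J0} => u v /=; rewrite addr0.
have Jt : c%:~R * t + e%:~R = J / 5.
  by rewrite /t /J dE rmorphD !rmorphM /=; field.
have K0 := moebius_in_H det t0; rewrite K_klein//.
have -> : 5%:R * ((a%:~R * tau + b%:~R) / J) =
    ((5 * a)%:~R * t + m%:~R) / (c%:~R * t + e%:~R).
  rewrite Jt /t /m rmorphB !rmorphM /=; field; exact: J0.
rewrite (klein_SL2 det' tt0 (@nonhalf_fifth R i i5)) Jt !mul0r !addr0.
have -> : i%:R / 5 * (5 * a)%:~R = 0 + (i%:Z * a)%:~R :> R by rewrite !rmorphM /=; field.
rewrite klein_shift1z// -/y (@kleinE _ 0 y t y%:C) ?rmorph0 ?mul0r ?add0r// ex0 mul1r.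
rewrite /theta; move: (_ / qpochhammer _ _ ^+ 2) => W.
move: (_ ^ _) (esin _) => A B; field; exact: J0.
Qed.

(** When 5 does not divide c, j is d times the inverse of c modulo 5; the inverses of 1, 2, 3, 4 are
    1, 3, 2, 4. *)
Lemma cusp0_shift (c d : int) : (exists c', c = 5 * c') \/ exists j e : int, d = c * j + 5 * e.
Proof.
have [q [r [ec r0 r5]]] : exists q r, [/\ c = r + 5 * q, 0 <= r & r < 5].
  exists (c %/ 5)%Z, (c %% 5)%Z; split; rewrite ?modz_ge0 ?ltz_pmod//.
  by rewrite addrC mulrC -divz_eq.
case: r r0 r5 ec => // -[|[|[|[|[|r]]]]]// _ _ ->.
- by left; exists q; rewrite add0r.
- by right; exists d, (- (q * d)); ring.
- by right; exists (3 * d), (- d - 3 * (q * d)); ring.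
- by right; exists (2 * d), (- d - 2 * (q * d)); ring.
- by right; exists (4 * d), (- (3 * d) - 4 * (q * d)); ring.
Qed.

Lemma v_cusp0 (a b c d : int) m : a * d - b * c = 1 -> (exists j e : int, d = c * j + 5 * e) ->
  exists2 k : C, k != 0 & exists2 U : C -> C, unitQ 5 (fun=> True) U &
  forall tau, 0 < complex.Im tau ->
  v m ((a%:~R * tau + b%:~R) / (c%:~R * tau + d%:~R)) =
  (c%:~R * tau + d%:~R) * (k * U tau).
Proof.
move=> det [j [e dE]]; have T := trivial_subring R.
have [k1 k10 [U1 hU1 E1]] := K_cusp0 (isT : (0 < 1 < 5)%N) det dE.
have [k2 k20 [U2 hU2 E2]] := K_cusp0 (isT : (0 < 2 < 5)%N) det dE.
exists (k1 ^ (m%:Z - 3) * k2 ^ (2 - m%:Z)); first by rewrite mulf_neq0 ?expfz_neq0.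
exists (fun tau => U1 tau ^ (m%:Z - 3) * U2 tau ^ (2 - m%:Z)).
  by apply: unitQ_M => //; exact: unitQ_Xz.
move=> tau t0; have J0 := automorphy_neq0 det t0.
rewrite /v (E1 _ t0) (E2 _ t0) v_scale//; last by ring.
by rewrite -mulrA.
Qed.

End CuspZero.

(** * Vanishing theorems for modular forms *)

Section Slash.
Variable R : realType.
Local Notation C := R[i].
Implicit Types (z w tau : C) (x y : R) (g s : 'M[int]_2).

Lemma mulmx2E g s i j : (g *m s) i j = g i ord0 * s ord0 j + g i ord_max * s ord_max j.
Proof.
by rewrite mxE big_ord_recr big_ord1 /=; congr (g i _ * s _ j + _); exact/val_inj.
Qed.

Lemma det_mx2 g : \det g = g ord0 ord0 * g ord_max ord_max - g ord0 ord_max * g ord_max ord0.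
Proof.
rewrite (expand_det_row _ ord0) big_ord_recr big_ord1 /= /cofactor !det_mx11 !mxE /=.
have -> : widen_ord (leqnSn 1) ord0 = ord0 :> 'I_2 by exact/val_inj.
have -> : lift ord0 (0 : 'I_1) = ord_max :> 'I_2 by exact/val_inj.
have -> : lift (ord_max : 'I_2) (0 : 'I_1) = ord0 by exact/val_inj.
by rewrite !addn0 expr0 expr1 !mul1r mulN1r mulrN.
Qed.

Definition mx2 (a b c d : int) : 'M[int]_2 :=
  \matrix_(i, j) if i == ord0 then (if j == ord0 then a else b) else (if j == ord0 then c else d).

Lemma SL2Z_det g : SL2Z g ->
  g ord0 ord0 * g ord_max ord_max - g ord0 ord_max * g ord_max ord0 = 1.
Proof. by rewrite -det_mx2. Qed.

Lemma SL2Z_mx2 (a b c d : int) : a * d - b * c = 1 -> SL2Z (mx2 a b c d).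
Proof. by move=> det; rewrite /SL2Z /= det_mx2 !mxE. Qed.

Lemma moebius_mx2 (a b c d : int) tau :
  moebius (mx2 a b c d) tau = (a%:~R * tau + b%:~R) / (c%:~R * tau + d%:~R).
Proof. by rewrite /moebius /automorphy !mxE. Qed.

Lemma automorphy_mx2 (a b c d : int) tau : automorphy (mx2 a b c d) tau = c%:~R * tau + d%:~R.
Proof. by rewrite /automorphy !mxE. Qed.

Lemma SL2Z_M g s : SL2Z g -> SL2Z s -> SL2Z (g *m s).
Proof. by rewrite /SL2Z /= => dg ds; rewrite det_mulmx dg ds mulr1. Qed.

Lemma SL2Z_1 : SL2Z 1%:M. Proof. exact: det1. Qed.

Definition adj2 g := mx2 (g ord_max ord_max) (- g ord0 ord_max) (- g ord_max ord0) (g ord0 ord0).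

Lemma ord2P (i : 'I_2) : i = ord0 \/ i = ord_max.
Proof. by case: i => [[|[|]]]// ?; [left|right]; exact/val_inj. Qed.

Lemma mx2P g s : g ord0 ord0 = s ord0 ord0 -> g ord0 ord_max = s ord0 ord_max ->
  g ord_max ord0 = s ord_max ord0 -> g ord_max ord_max = s ord_max ord_max -> g = s.
Proof.
move=> e1 e2 e3 e4; apply/matrixP => i j.
by case: (ord2P i) => ->; case: (ord2P j) => ->.
Qed.

Lemma adj2_mul g : SL2Z g -> adj2 g *m g = 1%:M.
Proof.
move=> /SL2Z_det dg; apply: mx2P; rewrite mulmx2E !mxE /=.
- by rewrite -[RHS]dg; ring.
- by ring.
- by ring.
- by rewrite -[RHS]dg; ring.
Qed.

Lemma SL2Z_adj2 g : SL2Z g -> SL2Z (adj2 g).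
Proof. by move=> /SL2Z_det dg; apply: SL2Z_mx2; rewrite -[RHS]dg; ring. Qed.

Lemma SL2Z_automorphy g tau : SL2Z g -> 0 < complex.Im tau -> automorphy g tau != 0.
Proof. by move=> /SL2Z_det dg; exact: automorphy_neq0 dg. Qed.

Lemma SL2Z_moebius g tau : SL2Z g -> 0 < complex.Im tau -> 0 < complex.Im (moebius g tau).
Proof. by move=> /SL2Z_det dg; exact: moebius_in_H dg. Qed.

Lemma Im_moebius_mx g tau : SL2Z g ->
  complex.Im (moebius g tau) = complex.Im tau / nrm (automorphy g tau) ^+ 2.
Proof. by move=> /SL2Z_det dg; exact: Im_moebius dg. Qed.

Lemma automorphyM g s tau : SL2Z s -> 0 < complex.Im tau ->
  automorphy (g *m s) tau = automorphy g (moebius s tau) * automorphy s tau.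
Proof.
move=> hs t0; have := SL2Z_automorphy hs t0; rewrite /moebius /automorphy => j0.
by rewrite !mulmx2E !rmorphD !rmorphM /=; field.
Qed.

Lemma moebiusM g s tau : SL2Z g -> SL2Z s -> 0 < complex.Im tau ->
  moebius (g *m s) tau = moebius g (moebius s tau).
Proof.
move=> hg hs t0; have n1 := SL2Z_automorphy hs t0.
have n2 := SL2Z_automorphy hg (SL2Z_moebius hs t0).
have e : ((g *m s) ord0 ord0)%:~R * tau + ((g *m s) ord0 ord_max)%:~R =
    ((g ord0 ord0)%:~R * moebius s tau + (g ord0 ord_max)%:~R) * automorphy s tau.
  rewrite mulrDl -mulrA /moebius divfK// !mulmx2E !rmorphD !rmorphM /= /automorphy.
  by ring.
rewrite {1}/moebius e automorphyM// [RHS]/moebius.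
by rewrite -mulf_div divff// mulr1.
Qed.

Lemma moebius1 tau : moebius 1%:M tau = tau.
Proof. by rewrite /moebius /automorphy !mxE /= mul1r mul0r addr0 add0r divr1. Qed.

Lemma automorphy1 tau : automorphy 1%:M tau = 1.
Proof. by rewrite /automorphy !mxE /= mul0r add0r. Qed.

Lemma slash1 k (f : C -> C) tau : slash k 1%:M f tau = f tau.
Proof. by rewrite /slash automorphy1 moebius1 exp1rz mul1r. Qed.

Lemma slashMx k g s (f : C -> C) tau : SL2Z g -> SL2Z s -> 0 < complex.Im tau ->
  slash k (g *m s) f tau = slash k s (slash k g f) tau.
Proof.
move=> hg hs t0; rewrite /slash moebiusM// automorphyM// expfzMl.
by rewrite mulrAC mulrA mulrC mulrA [_ ^ _ * _ ^ _]mulrC.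
Qed.

Lemma slash_eq k g (f f' : C -> C) tau : SL2Z g -> 0 < complex.Im tau ->
  (forall t, 0 < complex.Im t -> f t = f' t) -> slash k g f tau = slash k g f' tau.
Proof. by move=> hg t0 ff; rewrite /slash ff//; exact: SL2Z_moebius. Qed.

Lemma slash_mul k l g (f f' : C -> C) tau : SL2Z g -> 0 < complex.Im tau ->
  slash (k + l) g (fun t => f t * f' t) tau = slash k g f tau * slash l g f' tau.
Proof.
move=> hg t0; rewrite /slash opprD expfzDr ?SL2Z_automorphy//.
by rewrite mulrACA.
Qed.

Lemma eqz_modP (m n : int) : (m = n %[mod 5%N])%Z <-> exists k, m = n + 5 * k.
Proof.
split=> [/eqP|[k ->]]; last by apply/eqP; rewrite eqz_mod_dvd addrAC subrr add0r dvdz_mulr.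
by rewrite eqz_mod_dvd => /dvdzP[k e]; exists k; rewrite mulrC -e; ring.
Qed.

Lemma GammaP g : Gamma 5 g <-> SL2Z g /\ exists a b c d : int,
  [/\ g ord0 ord0 = 1 + 5 * a, g ord0 ord_max = 5 * b, g ord_max ord0 = 5 * c &
      g ord_max ord_max = 1 + 5 * d].
Proof.
split=> [[hg [/eqz_modP[a ea] /eqz_modP[b eb] /eqz_modP[c ec] /eqz_modP[d ed]]]|].
  by split=> //; exists a, b, c, d; rewrite ea eb ec ed !add0r.
move=> [hg [a [b [c [d [ea eb ec ed]]]]]]; split=> //; split; apply/eqz_modP.
- by exists a.
- by exists b; rewrite add0r.
- by exists c; rewrite add0r.
- by exists d.
Qed.

Lemma Gamma1P g : Gamma1 5 g <-> SL2Z g /\ exists a c d : int,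
  [/\ g ord0 ord0 = 1 + 5 * a, g ord_max ord0 = 5 * c & g ord_max ord_max = 1 + 5 * d].
Proof.
split=> [[hg [/eqz_modP[a ea] /eqz_modP[c ec] /eqz_modP[d ed]]]|].
  by split=> //; exists a, c, d; rewrite ea ec ed !add0r.
move=> [hg [a [c [d [ea ec ed]]]]]; split=> //; split; apply/eqz_modP.
- by exists a.
- by exists c; rewrite add0r.
- by exists d.
Qed.

Lemma Gamma_sub g : Gamma 5 g -> Gamma1 5 g.
Proof. by case=> hg [h1 _ h3 h4]; split. Qed.

Lemma Gamma_div g s : SL2Z g -> SL2Z s -> (forall i j, exists k, s i j = g i j + 5 * k) ->
  Gamma 5 (s *m adj2 g).
Proof.
move=> hg hs gs; apply/GammaP; split; first exact: SL2Z_M (SL2Z_adj2 hg).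
have [a ea] := gs ord0 ord0; have [b eb] := gs ord0 ord_max.
have [c ec] := gs ord_max ord0; have [d ed] := gs ord_max ord_max.
have dg := SL2Z_det hg.
exists (a * g ord_max ord_max - b * g ord_max ord0), (b * g ord0 ord0 - a * g ord0 ord_max),
  (c * g ord_max ord_max - d * g ord_max ord0), (d * g ord0 ord0 - c * g ord0 ord_max).
split; rewrite mulmx2E !mxE /= ?ea ?eb ?ec ?ed.
- by rewrite -[X in _ = X + _]dg; ring.
- by ring.
- by ring.
- by rewrite -[X in _ = X + _]dg; ring.
Qed.

End Slash.

(** * Vanishing in weight -1 *)

Section Vanishing.
Variable R : realType.
Local Notation C := R[i].
Implicit Types (z w tau : C) (x y : R) (g s : 'M[int]_2).

Lemma QE_bounded h a (f : C -> C) : (0 < h)%N -> QE h a f ->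
  exists2 M : R, 0 <= M & forall tau, 1 / 2 <= complex.Im tau -> nrm (f tau) <= M.
Proof.
move=> h0 [da Sa]; have p0 : 0 < (pi : R) by exact: pi_gt0.
pose rho : R := expR (- (pi / h%:R)).
have r01 : 0 <= rho < 1 by rewrite /rho expR_ge0 expR_lt1 oppr_lt0 divr_gt0 ?ltr0n.
have [M M0 hM] := disc_series_bounded da r01.
exists M => // tau t12; have t0 : 0 < complex.Im tau by lra.
apply: (hM (tq h tau)); last exact: Sa.
rewrite nrm_tq ler_expR lerN2 mulrA ler_pM2r ?invr_gt0 ?ltr0n//.
by move: (pi : R) p0 => p p0; nra.
Qed.

Lemma QE_coeff0 h a (f : C -> C) tau : QE h a f -> (forall m, a m = 0) ->
  0 < complex.Im tau -> f tau = 0.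
Proof.
move=> [_ S] a0 t0; apply: sums_uniq (S _ t0) _.
apply: (@sums_eq _ (fun=> 0)) => [m|]; first by rewrite a0.
have := @sums_poly _ (fun=> 0) (tq h tau) 0 (fun _ _ => erefl).
by rewrite [X in sums _ _ X]big_nil.
Qed.

Lemma nearest_int x : exists m : int, (x + m%:~R) ^+ 2 <= 1 / 4.
Proof.
exists (- Num.floor (x + 1 / 2)); have /andP[] := floor_itv (x + 1 / 2).
rewrite rmorphN intrD mulr1z /=; move: (Num.floor _) => k k1 k2.
have {}k1 : k%:~R <= x + 1 / 2 := k1.
have {}k2 : x + 1 / 2 < k%:~R + 1 := k2.
move: (k%:~R : R) k1 k2 => r r1 r2.
have u1 : - 1 / 2 <= x - r by lra.
have u2 : x - r <= 1 / 2 by lra.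
by move: (x - r) u1 u2 => u *; nra.
Qed.

(** If Im tau < 1/2, a translation brings |Re tau| to at most 1/2, so |tau + m|^2 <= 1/2 and the
    inversion at least doubles the imaginary part. The induction is on the number of doublings
    needed. *)
Lemma moebius_reduce tau : 0 < complex.Im tau ->
  exists g (s : C), [/\ SL2Z g, 1 / 2 <= complex.Im s & moebius g s = tau].
Proof.
move=> t0; have [n hn] : exists n, 1 / 2 <= 2 ^+ n * complex.Im tau.
  pose n := Num.bound (1 / (2 * complex.Im tau)); exists n.
  rewrite -ler_pdivrMr//; have -> : 1 / 2 / complex.Im tau = 1 / (2 * complex.Im tau).
    by rewrite !mul1r invfM.
  rewrite ltW// (lt_trans (archi_boundP _))//; first by rewrite divr_ge0// mulr_ge0// ltW.
  by rewrite -natrX ltr_nat ltn_expl.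
elim: n tau t0 hn => [|n IH] tau t0 hn.
  by exists 1%:M, tau; rewrite moebius1 -[X in _ <= X]mul1r; split=> //; exact: SL2Z_1.
have [t12|t12] := leP (1 / 2) (complex.Im tau).
  by exists 1%:M, tau; rewrite moebius1; split=> //; exact: SL2Z_1.
have [m hm] := nearest_int (complex.Re tau).
pose s := mx2 0 (-1) 1 m.
have hs : SL2Z s by apply: SL2Z_mx2; ring.
have j2 : nrm (automorphy s tau) ^+ 2 <= 1 / 2.
  rewrite automorphy_mx2 mulr1z mul1r -(rmorph_int (real_complex R) m) nrm_sqr.
  have addE (x : R) : complex.Re (tau + x%:C) = complex.Re tau + x /\
      complex.Im (tau + x%:C) = complex.Im tau.
    by case: tau {t0 hn hm s hs t12} => u w /=; rewrite addr0.
  rewrite !(addE _).1 !(addE _).2; move: (complex.Im tau) ((_ + _) ^+ 2) t0 t12 hm.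
  by move=> y u *; nra.
have j0 : 0 < nrm (automorphy s tau) ^+ 2.
  by rewrite exprn_gt0// nrm_gt0 SL2Z_automorphy.
have s0 := SL2Z_moebius hs t0.
have hn' : 1 / 2 <= 2 ^+ n * complex.Im (moebius s tau).
  rewrite Im_moebius_mx// mulrA ler_pdivlMr//; move: hn.
  rewrite exprS -mulrA; have u0 : 0 <= 2 ^+ n * complex.Im tau by rewrite mulr_ge0 ?exprn_ge0 ?ltW.
  by move: (2 ^+ n * _) (nrm _ ^+ 2) u0 j2 => *; nra.
have [g [t [hg ht e]]] := IH _ s0 hn'.
exists (adj2 s *m g), t; split=> //; first by apply: SL2Z_M => //; exact: SL2Z_adj2.
have t00 : 0 < complex.Im t by lra.
rewrite moebiusM ?e//; last exact: SL2Z_adj2.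
by rewrite -moebiusM ?adj2_mul ?moebius1//; exact: SL2Z_adj2.
Qed.

Lemma uniform_bound (T : finType) (P : T -> R -> Prop) :
  (forall t x y, x <= y -> P t x -> P t y) -> (forall t, exists x, P t x) ->
  exists M, forall t, P t M.
Proof.
move=> mono ex; have [f hf] := choice ex.
exists (\sum_(t : T) `|f t|) => t; apply: mono (hf t).
by rewrite (bigD1 t)//= (le_trans (ler_norm _))// lerDl sumr_ge0.
Qed.

Lemma slash_congr k (f : C -> C) g s tau :
  (forall g tau, Gamma 5 g -> 0 < complex.Im tau -> slash k g f tau = f tau) ->
  SL2Z g -> SL2Z s -> (forall i j, exists m, s i j = g i j + 5 * m) ->
  0 < complex.Im tau -> slash k s f tau = slash k g f tau.
Proof.
move=> inv hg hs gs t0; have G := Gamma_div hg hs gs.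
have -> : s = (s *m adj2 g) *m g by rewrite -mulmxA adj2_mul// mulmx1.
rewrite slashMx//; last by case: G.
by apply: slash_eq => // t t1; exact: inv.
Qed.

Variable F : C -> C.
Hypothesis FG : forall g tau, Gamma 5 g -> 0 < complex.Im tau -> slash (-1) g F tau = F tau.
Hypothesis FQ : forall g, SL2Z g -> exists2 h, (0 < h)%N & exists a, QE h a (slash (-1) g F).

(** A translate of F depends only on the matrix modulo 5, so there are finitely many, and each is
    bounded for Im tau >= 1/2 by its q-expansion. *)
Lemma slash_bounded : exists M : R, forall g tau, SL2Z g -> 1 / 2 <= complex.Im tau ->
  nrm (slash (-1) g F tau) <= M.
Proof.
pose red g : 'M['I_5]_2 := \matrix_(i, j) inord `|(g i j %% 5)%Z|.
have redE g s : red g = red s -> forall i j, exists k, s i j = g i j + 5 * k.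
  move=> /matrixP e i j; have := e i j; rewrite !mxE => /(congr1 val) /=.
  have b (m : int) : (`|(m %% 5)%Z| < 5)%N.
    by rewrite -ltz_nat gez0_abs ?modz_ge0// ltz_pmod.
  rewrite !inordK// => /(congr1 Posz); rewrite !gez0_abs ?modz_ge0// => e'.
  exists ((s i j %/ 5)%Z - (g i j %/ 5)%Z).
  by rewrite [LHS](divz_eq _ 5) [X in _ = X + _](divz_eq _ 5) e'; ring.
pose P (t : 'M['I_5]_2) (M : R) := forall g tau, SL2Z g -> red g = t -> 1 / 2 <= complex.Im tau ->
  nrm (slash (-1) g F tau) <= M.
have [| |M hM] := @uniform_bound _ P.
- by move=> t x y xy h g tau hg hr ht; exact: le_trans (h _ _ hg hr ht) xy.
- move=> t; have [[g [hg hr]]|no] := pselect (exists g, SL2Z g /\ red g = t); last first.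
    by exists 0 => g tau hg hr; case: no; exists g.
  have [h h0 [a qa]] := FQ hg; have [M M0 hM] := QE_bounded h0 qa.
  exists M => s tau hs hr' ht; have t0 : 0 < complex.Im tau by lra.
  by rewrite (slash_congr FG hg)//; [exact: hM|apply: redE; rewrite hr hr'].
by exists M => g tau hg ht; exact: hM ht.
Qed.

(* [|F|^2 / Im] is invariant under SL_2(Z), up to passing to one of the finitely many
   translates of [F], and every orbit meets [Im >= 1/2]. *)
Lemma weight_m1_bound : exists2 M : R, 0 <= M & forall tau, 0 < complex.Im tau ->
  nrm (F tau) ^+ 2 <= M * complex.Im tau.
Proof.
have [M hM] := slash_bounded; exists (2 * M ^+ 2); first by rewrite mulr_ge0// sqr_ge0.
move=> tau t0; have [g [s [hg hs <-]]] := moebius_reduce t0.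
have s0 : 0 < complex.Im s by lra.
have j0 : 0 < nrm (automorphy g s) ^+ 2 by rewrite exprn_gt0// nrm_gt0 SL2Z_automorphy.
rewrite Im_moebius_mx// mulrA ler_pdivlMr// mulrC -exprMn -nrmM.
have := hM g s hg hs; rewrite /slash opprK expr1z => h.
have h0 := nrm_ge0 (automorphy g s * F (moebius g s)).
move: (nrm _) h h0 => u h h0; move: (complex.Im s) hs => y hy.
have : u ^+ 2 <= M ^+ 2 by nra.
by have := sqr_ge0 M; move: (M ^+ 2) (u ^+ 2) => *; nra.
Qed.

Lemma weight_m1_vanish tau : 0 < complex.Im tau -> F tau = 0.
Proof.
have [h h0 [a qa]] := FQ SL2Z_1.
have qF : QE h a F by apply: QE_eq qa => // t t0; rewrite slash1.
have [M M0 hM] := weight_m1_bound.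
suff a0 : forall m, a m = 0.
  exact: QE_coeff0 qF a0.
move=> m; apply/eqP; rewrite -nrm_eq0; apply/eqP.
pose c0 : R := expR (- (2 * pi * (1 / h%:R))) ^+ m.
have c00 : 0 < c0 by rewrite exprn_gt0// expR_gt0.
have p0 : 0 < (pi : R) by exact: pi_gt0.
have key e : 0 < e -> e < 1 -> nrm (a m) * c0 <= e.
  (* At this height [weight_m1_bound] gives |F| <= e, while y <= 1 keeps the exponential weight of
     the coefficient at least [c0]. *)
  move=> e0 e1; pose y := e ^+ 2 / (M + 1).
  have M1 : 0 < M + 1 by lra.
  have y0 : 0 < y by rewrite divr_gt0// exprn_gt0.
  have y1 : y <= 1 by rewrite ler_pdivrMr// mul1r; nra.
  have B x : nrm (F (x +i* y)) <= e.
    rewrite -(ler_pXn2r (n := 2))// ?nnegrE ?(ltW e0)//.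
    rewrite (le_trans (hM (x +i* y) y0))//= /y mulrA ler_pdivrMr//.
    by have := sqr_ge0 e; move: (e ^+ 2) => *; nra.
  apply: le_trans (QE_coeff_bound m h0 qF y0 B); rewrite ler_wpM2l//.
  rewrite lerXn2r ?nnegrE ?expR_ge0// ler_expR lerN2 ler_pM2l ?mulr_gt0//.
  by rewrite ler_pM2r ?invr_gt0 ?ltr0n.
apply/eqP; rewrite eq_le nrm_ge0 andbT leNgt; apply/negP => am0.
have am : 0 < nrm (a m) * c0 by rewrite mulr_gt0.
move: (nrm (a m) * c0) am key => u u0 key.
pose e := Num.min (u / 2) (1 / 2).
have e0 : 0 < e by rewrite /e lt_min; apply/andP; split; lra.
have e1 : e <= 1 / 2 by rewrite /e ge_min lexx orbT.
have e2 : e <= u / 2 by rewrite /e ge_min lexx.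
have e3 : e < 1 by lra.
by have := key e e0 e3; lra.
Qed.

End Vanishing.

(** * Modularity of [v j] *)

Section VModular.
Variable R : realType.
Local Notation C := R[i].
Implicit Types (z w tau : C) (x y : R) (g s : 'M[int]_2) (f : C -> C).

Definition hasQ f : Prop := exists2 h, (0 < h)%N & exists a, QE h a f.

Lemma hasQ_eq f f' : (forall tau, 0 < complex.Im tau -> f tau = f' tau) -> hasQ f -> hasQ f'.
Proof. by move=> ff [h h0 [a qa]]; exists h => //; exists a; apply: QE_eq qa. Qed.

Lemma hasQ_common f f' : hasQ f -> hasQ f' ->
  exists2 h, (0 < h)%N & exists a a', QE h a f /\ QE h a' f'.
Proof.
move=> [h h0 [a qa]] [h' h0' [a' qa']]; exists (h * h')%N; first by rewrite muln_gt0 h0.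
exists (spread h' a), (spread h a'); split; first exact: QE_spread.
by rewrite mulnC; exact: QE_spread.
Qed.

Lemma hasQ_1 : hasQ (fun=> 1).
Proof. by exists 1%N => //; exists (delta0 R); exact: QE_1. Qed.

Lemma hasQ_lin (c : C) f f' : hasQ f -> hasQ f' -> hasQ (fun tau => c * f tau + f' tau).
Proof.
move=> hf hf'; have [h h0 [a [a' [qa qa']]]] := hasQ_common hf hf'.
exists h => //; exists (fun m => c * a m + a' m); apply: QE_D => //; exact: QE_Z.
Qed.

Lemma hasQ_M f f' : hasQ f -> hasQ f' -> hasQ (fun tau => f tau * f' tau).
Proof.
move=> hf hf'; have [h h0 [a [a' [qa qa']]]] := hasQ_common hf hf'.
by exists h => //; exists (conv a a'); apply: QE_M.
Qed.

Lemma hasQ_Z (c : C) f : hasQ f -> hasQ (fun tau => c * f tau).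
Proof. by move=> [h h0 [a qa]]; exists h => //; exists (fun m => c * a m); exact: QE_Z. Qed.

Lemma hasQ_X f n : hasQ f -> hasQ (fun tau => f tau ^+ n).
Proof.
move=> hf; elim: n => [|n IH]; first exact: hasQ_1.
by apply: hasQ_eq (hasQ_M hf IH) => tau _; rewrite exprS.
Qed.

Lemma hasQ_unit h P f : (0 < h)%N -> unitQ h P f -> hasQ f.
Proof. by move=> h0 [a [b [qa _ _ _ _]]]; exists h => //; exists a. Qed.

Definition delta (k : nat) : nat -> C := fun m => (m == k)%:R.

Lemma QE_monomial h k : (0 < h)%N -> QE h (delta k) (fun tau => tq h tau ^+ k).
Proof.
move=> h0; apply: QE_of_sums => // tau t0.
have -> : tq h tau ^+ k = psum (delta k) (tq h tau) k.+1.
  rewrite /psum big_nat_recr//= big_nat big1 ?add0r /delta ?eqxx ?mul1r//.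
  by move=> i /andP[_ ik]; rewrite ltn_eqF// mul0r.
by apply: sums_poly => m km; rewrite /delta gtn_eqF.
Qed.

Lemma tq5 j tau : tq 5 tau ^+ j = ex (j%:R * tau / 5).
Proof. by rewrite /tq -exMn mulrA. Qed.

Lemma v_tq j tau : 0 < complex.Im tau -> v j tau = tq 5 tau ^+ j * vu j tau.
Proof. by move=> t0; rewrite (vE j t0) tq5. Qed.

Lemma v_hasQ j : hasQ (@v R j).
Proof.
have h1 : hasQ (fun tau : C => tq 5 tau ^+ j).
  by exists 5%N => //; exists (delta j); exact: QE_monomial.
have h2 := hasQ_unit (isT : (0 < 1)%N) (unitQ_vu R j).
by apply: hasQ_eq (hasQ_M h1 h2) => tau t0; rewrite (v_tq j t0).
Qed.

Lemma holomorphic_at_infinityE f : holomorphic_at_infinity f <-> hasQ f.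
Proof.
split=> [[h h0 [a qa]]|[h h0 [a qa]]].
  by exists h => //; exists a; exact: has_qexp_QE.
exists h => //; exists a => tau t0; have := @QE_has_qexp R h a f 0 qa tau t0.
by rewrite qpowE rmorph0 mul0r ex0 !mul1r.
Qed.

(* The expansion at the cusp infinity already gives holomorphy on the upper
   half-plane. *)
Lemma modular_formsP (G : set 'M[int]_2) k f :
  modular_forms G k f <->
  (forall g tau, G g -> 0 < complex.Im tau -> slash k g f tau = f tau) /\
  (forall g, SL2Z g -> hasQ (slash k g f)).
Proof.
split=> [[_ inv cusp]|[inv cusp]].
  split=> [g tau hg t0|g hg]; first by apply: inv.
  by apply/holomorphic_at_infinityE; exact: cusp.
split=> [tau t0|g hg tau t0|g hg].
- have [h h0 [a qa]] := cusp _ SL2Z_1.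
  have qf : QE h a f by apply: QE_eq qa => // t _; rewrite slash1.
  exact: QE_derivable qf t0.
- exact: inv.
- by apply/holomorphic_at_infinityE; exact: cusp.
Qed.

Lemma modular_forms_hasQ (G : set 'M[int]_2) k f : modular_forms G k f -> hasQ f.
Proof.
move=> /modular_formsP[_ /(_ _ SL2Z_1)]; apply: hasQ_eq => tau _; exact: slash1.
Qed.

Lemma modular_forms_graded (G : set 'M[int]_2) : G `<=` SL2Z ->
  graded_subalgebra (fun k => @modular_forms R G k).
Proof.
move=> GS; split.
- move=> k f f' ff /modular_formsP[inv cusp]; apply/modular_formsP; split.
    move=> g tau hg t0; rewrite -[RHS]ff// -(inv g tau hg t0); apply: slash_eq => //.
      exact: GS.
    by move=> t tt; rewrite ff.
  move=> g hg; apply: hasQ_eq (cusp g hg) => tau t0; exact: slash_eq.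
- move=> k; split=> [|c f f'].
    apply/modular_formsP; split=> [g tau _ _|g _]; first by rewrite /slash mulr0.
    by apply: hasQ_eq (hasQ_Z 0 hasQ_1) => tau _; rewrite /slash mul0r mulr0.
  move=> /modular_formsP[inv cusp] /modular_formsP[inv' cusp'].
  have slashD g tau : slash k g (fun t => c * f t + f' t) tau =
      c * slash k g f tau + slash k g f' tau by rewrite /slash mulrDr mulrCA.
  apply/modular_formsP; split=> [g tau hg t0|g hg].
    by rewrite slashD (inv g tau hg t0) (inv' g tau hg t0).
  by apply: hasQ_eq (hasQ_lin c (cusp g hg) (cusp' g hg)) => tau _; rewrite slashD.
- have s1 g tau : slash 0 g (fun=> 1) tau = 1 :> C by rewrite /slash oppr0 expr0z mulr1.
  apply/modular_formsP; split=> [g tau _ _|g _]; first exact: s1.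
  by apply: hasQ_eq hasQ_1 => tau _; rewrite s1.
- move=> k l f f' /modular_formsP[inv cusp] /modular_formsP[inv' cusp'].
  apply/modular_formsP; split=> [g tau hg t0|g hg].
    by rewrite (slash_mul _ _ _ _ (GS _ hg) t0) (inv g tau hg t0) (inv' g tau hg t0).
  apply: hasQ_eq (hasQ_M (cusp g hg) (cusp' g hg)) => tau t0.
  by rewrite (slash_mul _ _ _ _ hg t0).
Qed.

Lemma Gamma_SL2Z : Gamma 5 `<=` SL2Z. Proof. by move=> g []. Qed.
Lemma Gamma1_SL2Z : Gamma1 5 `<=` SL2Z. Proof. by move=> g []. Qed.

Lemma slash_v_cusp0 g j : SL2Z g ->
  (exists m e, g ord_max ord_max = g ord_max ord0 * m + 5 * e) ->
  exists2 k : C, k != 0 & exists2 U : C -> C, unitQ 5 (fun=> True) U &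
  forall tau, 0 < complex.Im tau -> slash 1 g (v j) tau = k * U tau.
Proof.
move=> hg he; have [k k0 [U hU E]] := v_cusp0 R j (SL2Z_det hg) he.
refine (ex_intro2 _ _ k k0 (ex_intro2 _ _ U hU _)) => tau t0; have J0 := SL2Z_automorphy hg t0.
by rewrite /slash exprN1 /moebius (E _ t0) mulKf.
Qed.

Lemma slash_v_cusp_inf g j c' : (j <= 5)%N -> SL2Z g -> g ord_max ord0 = 5 * c' ->
  ((exists q : int, g ord0 ord0 = 1 + 5 * q \/ g ord0 ord0 = - 1 + 5 * q) /\
   exists2 e : C, e != 0 & forall tau, 0 < complex.Im tau -> slash 1 g (v j) tau = e * v j tau) \/
  (exists2 e : C, e != 0 & forall tau, 0 < complex.Im tau ->
    slash 1 g (v j) tau = e * v (5 - j) tau).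
Proof.
move=> j5 hg ec; have det := SL2Z_det hg; rewrite ec in det.
have red tau (t0 : 0 < complex.Im tau) : slash 1 g (v j) tau =
    ((5 * c')%:~R * tau + (g ord_max ord_max)%:~R)^-1 *
    v j (((g ord0 ord0)%:~R * tau + (g ord0 ord_max)%:~R) /
         ((5 * c')%:~R * tau + (g ord_max ord_max)%:~R)).
  by rewrite /slash exprN1 /moebius /automorphy ec.
have [[hq [e e0 E]]|[e e0 E]] := v_Gamma0 R j5 det; [left; split=> //|right]; refine (ex_intro2 _ _ e e0 _);
  move=> tau t0; have J0 := automorphy_neq0 det t0.
- by rewrite (red tau t0) (E tau t0) mulKf.
- by rewrite (red tau t0) (E tau t0) mulKf.
Qed.

Lemma slash_v_hasQ g j : (j <= 5)%N -> SL2Z g -> hasQ (slash 1 g (@v R j)).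
Proof.
move=> j5 hg; have [[c' ec]|he] := cusp0_shift (g ord_max ord0) (g ord_max ord_max).
  have [[_ [e _ E]]|[e _ E]] := slash_v_cusp_inf j5 hg ec.
    by apply: hasQ_eq (hasQ_Z e (v_hasQ j)) => tau t0; rewrite (E tau t0).
  by apply: hasQ_eq (hasQ_Z e (v_hasQ (5 - j))) => tau t0; rewrite (E tau t0).
have [k _ [U hU E]] := slash_v_cusp0 j hg he.
have hQ := hasQ_unit (isT : (0 < 5)%N) hU.
by apply: hasQ_eq (hasQ_Z k hQ) => tau t0; rewrite (E tau t0).
Qed.

Lemma slash_v_Gamma1 g j tau : Gamma1 5 g -> 0 < complex.Im tau ->
  slash 1 g (v j) tau = ex 5^-1 ^ (g ord0 ord_max * j%:Z) * v j tau.
Proof.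
move=> /Gamma1P[hg [a [c [d [ea ec ed]]]]] t0; have det := SL2Z_det hg; rewrite ec in det.
have J0 := automorphy_neq0 det t0.
by rewrite /slash exprN1 /moebius /automorphy ec (v_Gamma1 j ea det t0) mulKf.
Qed.

Lemma v_Gamma_modular j : (j <= 5)%N -> modular_forms (Gamma 5) 1 (@v R j).
Proof.
move=> j5; apply/modular_formsP; split=> [g tau hg t0|g hg]; last exact: slash_v_hasQ.
rewrite (slash_v_Gamma1 j (Gamma_sub hg) t0).
have /GammaP[_ [a [b [c [d [_ -> _ _]]]]]] := hg.
by rewrite -mulrA -exprz_exp ex_fifth_pow5 exp1rz mul1r.
Qed.

Lemma v0_Gamma1_modular : modular_forms (Gamma1 5) 1 (@v R 0).
Proof.
apply/modular_formsP; split=> [g tau hg t0|g hg]; last exact: slash_v_hasQ.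
by rewrite (slash_v_Gamma1 0 hg t0) mulr0 expr0z mul1r.
Qed.

Lemma v5_Gamma1_modular : modular_forms (Gamma1 5) 1 (@v R 5).
Proof.
apply/modular_formsP; split=> [g tau hg t0|g hg]; last exact: slash_v_hasQ.
by rewrite (slash_v_Gamma1 5 hg t0) mulrC [_ * 5%:Z]mulrC -exprz_exp ex_fifth_pow5 exp1rz mulr1.
Qed.

End VModular.

(** * The Sturm bound and widths of expansions *)

Section Sturm.
Variable R : realType.
Local Notation C := R[i].
Implicit Types (z w tau : C) (x y : R) (g s : 'M[int]_2) (f : C -> C).

Lemma QE_order h a f N : (0 < h)%N -> QE h a f -> (forall m, (m < N)%N -> a m = 0) ->
  exists b F, QE h b F /\ forall tau, 0 < complex.Im tau -> f tau = tq h tau ^+ N * F tau.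
Proof.
move=> h0 [da S] aN; exists (fun m => a (m + N)%N), (fun tau => (tq h tau ^+ N)^-1 * f tau).
split; last by move=> tau t0; rewrite mulVKf// expf_neq0// tq_neq0.
apply: QE_of_sums => // tau t0; have n0 : tq h tau ^+ N != 0 by rewrite expf_neq0// tq_neq0.
have S' : cvgC (fun n => (tq h tau ^+ N)^-1 * psum a (tq h tau) (n + N))
    ((tq h tau ^+ N)^-1 * f tau).
  by apply: cvgC_M; [exact: cvgC_cst|apply: cvgC_shift; exact: S].
apply: cvgC_eq S' => n; rewrite /psum (big_cat_nat (n := N))//= ?leq_addl//.
rewrite [X in X + _]big_nat [X in X + _]big1 ?add0r; last first.
  by move=> i /andP[_ iN]; rewrite aN// mul0r.
have -> : \sum_(N <= i < n + N) a i * tq h tau ^+ i =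
    \sum_(0 <= i < n) a (i + N)%N * tq h tau ^+ (i + N).
  by rewrite -{1}[N]add0n big_addn addnK.
rewrite mulr_sumr; apply: eq_bigr => i _.
by rewrite exprD; move: (a _) (_ ^+ i) (_ ^+ N) n0 => A B D n0; field.
Qed.

Lemma slash_weight_m1 (k : int) g f tau : SL2Z g -> 0 < complex.Im tau ->
  slash (-1) g (fun t => f t ^+ 5 * v 5 t ^ (- (5 * k + 1))) tau =
  slash k g f tau ^+ 5 * slash 1 g (v 5) tau ^ (- (5 * k + 1)).
Proof.
move=> hg t0; have J0 := SL2Z_automorphy hg t0; rewrite /slash opprK.
move: (automorphy g tau) (f (moebius g tau)) (v 5 (moebius g tau)) J0 => J A B J0.
rewrite [(_ * _) ^+ 5]exprMn [(_ * B) ^ _]expfzMl mulrACA; congr (_ * _).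
rewrite -[(J ^ (- k)) ^+ 5]/((J ^ (- k)) ^ (5 : int)) !exprz_exp -expfzDr//.
by congr (_ ^ _); ring.
Qed.

Lemma slash_translate (k : int) (e b : int) f tau : e = 1 \/ e = -1 ->
  slash k (mx2 e b 0 e) f tau = (e%:~R : C) ^ (- k) * f (tau + (e * b)%:~R).
Proof.
move=> he; rewrite /slash moebius_mx2 automorphy_mx2 mul0r add0r.
congr (_ * f _); rewrite rmorphM /=.
by case: he => ->; rewrite ?mulrN1z ?mulr1z; field.
Qed.

(** Modulo 5 the matrix is upper triangular with equal diagonal entries e = 1 or e = -1, so the
    translate of f is a multiple of f shifted by an integer. *)
Lemma slash_cusp_inf (k : int) g f c' (q : int) : modular_forms (Gamma 5) k f ->
  SL2Z g -> g ord_max ord0 = 5 * c' ->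
  g ord0 ord0 = 1 + 5 * q \/ g ord0 ord0 = - 1 + 5 * q ->
  exists (e : C) (n : int), forall tau, 0 < complex.Im tau ->
    slash k g f tau = e * f (tau + n%:~R).
Proof.
move=> /modular_formsP[inv _] hg ec ea; have det := SL2Z_det hg.
have [e [he ea']] : exists e : int, (e = 1 \/ e = -1) /\ g ord0 ord0 = e + 5 * q.
  by case: ea => ea; [exists 1|exists (-1)]; split=> //; [left|right].
have ee : e * e = 1 by case: he => ->.
have hs : SL2Z (mx2 e (g ord0 ord_max) 0 e) by apply: SL2Z_mx2; rewrite mulr0 subr0.
exists (e%:~R ^ (- k)), (e * g ord0 ord_max) => tau t0.
rewrite -slash_translate//; apply: slash_congr => // i j; rewrite mxE.
case: (ord2P i) => ->; case: (ord2P j) => ->; first by exists q.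
- by exists 0; rewrite mulr0 addr0.
- by exists c'; rewrite /= add0r.
(* The determinant and e * e = 1 force the lower right entry to be e modulo 5. *)
exists (e * (g ord0 ord_max * c' - q * g ord_max ord_max)) => /=.
transitivity (e * e * g ord_max ord_max); first by rewrite ee mul1r.
have -> : e * e * g ord_max ord_max =
  e * ((g ord0 ord0 * g ord_max ord_max - g ord0 ord_max * g ord_max ord0) +
       (g ord0 ord_max * g ord_max ord0 - 5 * q * g ord_max ord_max)).
  by rewrite ea'; ring.
by rewrite det ec; ring.
Qed.

(* [f ^ 5 * v 5 ^ (- (5 k + 1))] has weight -1; the only zeros of [v 5] are at the cusps
   equivalent to infinity under +-Gamma_1(5), where [f] vanishes to order 5 k + 1. *)
Lemma sturm (k : int) f a : modular_forms (Gamma 5) k f -> QE 5 a f ->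
  (forall m : nat, m%:Z <= 5 * k -> a m = 0) -> forall tau, 0 < complex.Im tau -> f tau = 0.
Proof.
move=> fM qa a0 tau t0; have T := trivial_subring R.
have v50 (t : C) : 0 < complex.Im t -> v 5 t != 0 by move=> ?; exact: v_neq0.
suff : f tau ^+ 5 * v 5 tau ^ (- (5 * k + 1)) = 0.
  by move/eqP; rewrite mulf_eq0 [X in _ || X]expfz_eq0 (negbTE (v50 _ t0)) andbF orbF expf_eq0 => /eqP.
apply: (@weight_m1_vanish R (fun t => f t ^+ 5 * v 5 t ^ (- (5 * k + 1)))) t0.
  move=> g t hg t1; have [inv _] := (iffLR (modular_formsP _ _ _)) fM.
  have [inv5 _] := (iffLR (modular_formsP _ _ _)) (v_Gamma_modular R (isT : (5 <= 5)%N)).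
  by rewrite slash_weight_m1 ?(inv _ _ hg t1) ?(inv5 _ _ hg t1)//; case: hg.
move=> g hg; have [_ /(_ g hg) fQ] := (iffLR (modular_formsP _ _ _)) fM.
suff : hasQ (fun t => slash k g f t ^+ 5 * slash 1 g (v 5) t ^ (- (5 * k + 1))).
  by apply: hasQ_eq => t t1; rewrite slash_weight_m1.
have [[c' ec]|he] := cusp0_shift (g ord_max ord0) (g ord_max ord_max); last first.
  have [e _ [U hU E]] := slash_v_cusp0 R 5 hg he.
  have hU' := unitQ_Xz (isT : (0 < 5)%N) T (- (5 * k + 1)) hU.
  apply: hasQ_eq (hasQ_M (hasQ_X 5 fQ) (hasQ_Z (e ^ (- (5 * k + 1))) (hasQ_unit (isT : (0 < 5)%N) hU'))).
  by move=> t t1; rewrite (E t t1) [(e * _) ^ _]expfzMl.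
(* Where the diamond operator is nontrivial, [v 5] becomes a multiple of [v 0], which is a unit in
   q. *)
have [[[q hq] [e e0 E]]|[e e0 E]] := slash_v_cusp_inf R (isT : (5 <= 5)%N) hg ec; last first.
  have hU' := unitQ_Xz (isT : (0 < 1)%N) (is_int_subring R) (- (5 * k + 1)) (unitQ_vu R 0).
  apply: hasQ_eq (hasQ_M (hasQ_X 5 fQ) (hasQ_Z (e ^ (- (5 * k + 1))) (hasQ_unit (isT : (0 < 1)%N) hU'))).
  move=> t t1; rewrite (E t t1) [(e * _) ^ _]expfzMl.
  by rewrite [v (5 - 5) t](v_tq 0 t1) expr0 mul1r.
have [e' [n En]] := slash_cusp_inf fM hg ec hq.
have qs := QE_shift n%:~R (isT : (0 < 5)%N) qa.
(* For k < 0 the exponent -(5k+1) is positive, and no vanishing of f is needed. *)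
case: (lerP 0 k) => k0; last first.
  have [M eM] : exists M : nat, - (5 * k + 1) = M%:Z by exists `|(5 * k + 1)%R|%N; lia.
  have fQ' : hasQ (fun t => slash 1 g (@v R 5) t ^+ M) by apply: hasQ_X; exact: slash_v_hasQ.
  by apply: hasQ_eq (hasQ_M (hasQ_X 5 fQ) fQ') => t t1; rewrite eM.
(* In q^(1/5), f vanishes to order at least N and [v 5] to order 5, so the powers of the parameter
   in f^5 and v_5^(-N) cancel. *)
have [N eN] : exists N : nat, 5 * k + 1 = N%:Z by exists `|(5 * k + 1)%R|%N; lia.
have [m mN|b [F [qF EF]]] := QE_order (N := N) (isT : (0 < 5)%N) qs.
  by rewrite a0 ?mul0r//; lia.
have hU' := unitQ_Xz (isT : (0 < 1)%N) (is_int_subring R) (- N%:Z) (unitQ_vu R 5).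
have hF : hasQ F by exists 5%N => //; exists b.
apply: hasQ_eq (hasQ_Z (e' ^+ 5 * e ^ (- N%:Z)) (hasQ_M (hasQ_X 5 hF) (hasQ_unit (isT : (0 < 1)%N) hU'))).
move=> t t1; rewrite (E t t1) (En t t1) (v_tq 5 t1) -(rmorph_int (real_complex R)) (EF t t1) eN.
have n0 : tq 5 t != 0 by exact: tq_neq0.
move: (tq 5 t) (F t) (vu 5 t) n0 => w A B n0.
rewrite [(e * _) ^ _]expfzMl [(w ^+ 5 * B) ^ _]expfzMl.
have -> : (w ^+ 5) ^ (- N%:Z) = ((w ^+ N) ^+ 5)^-1 by rewrite -invr_expz -exprnP -!exprM mulnC.
rewrite [(e' * _) ^+ 5]exprMn [(w ^+ N * A) ^+ 5]exprMn.
move: (e ^ _) (e' ^+ 5) (B ^ _) (A ^+ 5) => x y z u.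
by field; rewrite !expf_neq0.
Qed.

(** In the parameter q^(1/(hr)), translation by r multiplies the m-th coefficient by the m-th power
    of a primitive h-th root of unity. So only exponents divisible by h survive. *)
Lemma QE_period h a f r : (0 < h)%N -> (0 < r)%N -> QE h a f ->
  (forall tau, 0 < complex.Im tau -> f (tau + r%:R) = f tau) -> exists b, QE r b f.
Proof.
move=> h0 r0 qa fr; pose a' := spread r a.
have hr : (0 < h * r)%N by rewrite muln_gt0 h0.
have qa' : QE (h * r) a' f by exact: QE_spread.
have qs := QE_shift r%:R hr qa'.
have prim := ex_primitive R h0.
have a'0 m : ~~ (h %| m)%N -> a' m = 0.
  move=> hm; have e := QE_inj hr qs qa' _ m.
  have {e} : a' m * (ex (r%:R / (h * r)%:R) ^+ m - 1) = 0.
    rewrite mulrBr mulr1; apply/eqP; rewrite subr_eq0; apply/eqP.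
    by rewrite -{1}(rmorph_nat (real_complex R)) e// => t t0; rewrite rmorph_nat fr.
  have -> : r%:R / (h * r)%:R = h%:R^-1 :> C.
    by rewrite natrM; field; rewrite !pnatr_eq0 -!lt0n h0 r0.
  move/eqP; rewrite mulf_eq0 subr_eq0 => /orP[/eqP//|].
  by rewrite -(prim_order_dvd prim) (negbTE hm).
pose b n := a' (h * n)%N; exists b; apply: QE_of_sums => // tau t0.
have [_ /(_ _ t0) S] := qa'.
have := cvgC_subseq (p := fun n => (h * n)%N) (fun n => leq_pmull n h0) S.
apply: cvgC_eq => n.
have -> : psum a' (tq (h * r) tau) (h * n) = psum (spread h b) (tq (h * r) tau) (h * n).
  apply: eq_bigr => i _; congr (_ * _); rewrite /spread; case: ifP => hi.
    by rewrite /b mulnC divnK.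
  by rewrite a'0 ?hi.
rewrite psum_spread//; congr psum; rewrite -exMn; apply: congr1.
by rewrite natrM; field; rewrite !pnatr_eq0 -!lt0n h0 r0.
Qed.

Lemma modular_forms_QE (G : set 'M[int]_2) k f (r : nat) : (0 < r)%N -> G (mx2 1 r%:Z 0 1) ->
  modular_forms G k f -> exists a, QE r a f.
Proof.
move=> r0 hG fM; have [h h0 [a qa]] := modular_forms_hasQ fM.
apply: QE_period qa _ => // tau t0.
have [inv _] := (iffLR (modular_formsP _ _ _)) fM.
by rewrite -[RHS](inv _ _ hG t0) slash_translate ?mul1r ?exp1rz ?mul1r//; left.
Qed.

Lemma Gamma_QE k f : modular_forms (Gamma 5) k f -> exists a, QE 5 a f.
Proof.
apply: modular_forms_QE => //; apply/GammaP; split; first by apply: SL2Z_mx2.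
by exists 0, 1, 0, 0; rewrite !mxE.
Qed.

Lemma Gamma1_QE k f : modular_forms (Gamma1 5) k f -> exists a, QE 1 a f.
Proof.
apply: modular_forms_QE => //; apply/Gamma1P; split; first by apply: SL2Z_mx2.
by exists 0, 0, 0; rewrite !mxE.
Qed.

End Sturm.

(** * Bases, generators and decomposition formulas *)

Section Span.
Variable R : realType.
Local Notation C := R[i].
Implicit Types (z w tau : C) (x y : R) (f : C -> C).

Lemma QE_mul_tq h j a f : (0 < h)%N -> QE h a f ->
  QE h (fun m => if (m < j)%N then 0 else a (m - j)%N) (fun tau => tq h tau ^+ j * f tau).
Proof.
move=> h0 qa; apply: QE_eq (QE_M h0 (QE_monomial R j h0) qa) => // m.
rewrite /conv; case: ltnP => [mj|jm].
  by rewrite big1// => i _; rewrite /delta ltn_eqF ?mul0r// (leq_ltn_trans _ mj)// -ltnS.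
rewrite (bigD1 (Ordinal (jm : (j < m.+1)%N)))//= /delta eqxx mul1r big1 ?addr0// => i ij.
by rewrite (negbTE (_ : i != j :> nat)) ?mul0r.
Qed.

Definition leading h j f : Prop :=
  exists u, [/\ QE h u f, forall m, (m < j)%N -> u m = 0 & u j = 1].

Lemma leading_unit h P j f U : (0 < h)%N -> unitQ h P U ->
  (forall tau, 0 < complex.Im tau -> f tau = tq h tau ^+ j * U tau) -> leading h j f.
Proof.
move=> h0 [a [b [qa _ [a0 _] _ _]]] fE.
exists (fun m => if (m < j)%N then 0 else a (m - j)%N); split=> [|m ->//|].
  by apply: QE_eq (QE_mul_tq j h0 qa) => // tau t0; rewrite fE.
by rewrite ltnn subnn.
Qed.

(** Gaussian elimination with the pivot of [V j] at exponent j: later steps leave the earlier zeros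
    untouched. *)
Lemma eliminate h N (V : nat -> C -> C) f a : (0 < h)%N ->
  (forall j, (j < N)%N -> leading h j (V j)) -> QE h a f ->
  exists (c : nat -> C) b, QE h b (fun tau => f tau - \sum_(0 <= j < N) c j * V j tau) /\
    forall m, (m < N)%N -> b m = 0.
Proof.
move=> h0 hV qa; elim: N hV => [|N IH] hV.
  exists (fun=> 0), a; split=> //; apply: QE_eq qa => // tau _.
  by rewrite big_nil subr0.
have [j jN|c [b [qb b0]]] := IH; first by apply: hV; exact: ltnW.
have [u [qu u0 u1]] := hV N (ltnSn N).
exists (fun j => if j == N then b N else c j), (fun m => b m + - b N * u m); split.
  apply: QE_eq (QE_D qb (QE_Z (- b N) qu)) => // tau _.
  rewrite big_nat_recr//= eqxx mulNr -addrA -opprD; congr (_ - (_ + _)).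
  by apply: eq_big_nat => i /andP[_ iN]; rewrite ltn_eqF.
move=> m; rewrite ltnS leq_eqVlt => /orP[/eqP->|mN]; first by rewrite u1 mulr1 subrr.
by rewrite b0// u0// mulr0 addr0.
Qed.

Lemma leading_free h N (V : nat -> C -> C) (c : nat -> C) : (0 < h)%N ->
  (forall j, (j < N)%N -> leading h j (V j)) ->
  (forall tau, 0 < complex.Im tau -> \sum_(0 <= j < N) c j * V j tau = 0) ->
  forall j, (j < N)%N -> c j = 0.
Proof.
move=> h0 hV V0.
have [u hu] : exists u, forall j, (j < N)%N ->
    [/\ QE h (u j) (V j), forall m, (m < j)%N -> u j m = 0 & u j j = 1].
  have /choice[u hu] : forall j, exists uj, (j < N)%N ->
    [/\ QE h uj (V j), forall m, (m < j)%N -> uj m = 0 & uj j = 1].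
    move=> j; have [jN|jN] := ltnP j N; last by exists (fun=> 0).
    by have [uj huj] := hV j jN; exists uj.
  by exists u.
have q n : (n <= N)%N -> QE h (fun m => \sum_(0 <= j < n) c j * u j m)
    (fun tau => \sum_(0 <= j < n) c j * V j tau).
  elim: n => [|n IH] nN.
    by apply: QE_eq (QE_Z 0 (QE_1 R h)) => [m|tau _]; rewrite big_nil mul0r.
  have [qn _ _] := hu n nN.
  apply: QE_eq (QE_D (IH (ltnW nN)) (QE_Z (c n) qn)) => [m|tau _]; by rewrite big_nat_recr.
have z := QE_0 h0 (q N (leqnn N)) V0.
elim/ltn_ind => j IH jN; have := z j.
rewrite (bigD1_seq j) ?mem_index_iota ?iota_uniq//= big_nat_cond big1 ?addr0.
  by have [_ _ ->] := hu j jN; rewrite mulr1.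
move=> i /andP[/andP[_ iN] ij]; have [ilt|ige] := ltnP i j; first by rewrite IH// mul0r.
have [_ hi _] := hu i iN; rewrite hi ?mulr0// ltn_neqAle eq_sym ij//.
Qed.

Section Graded.
Variable A : int -> set (C -> C).
Hypothesis gA : graded_subalgebra A.

Lemma graded_eq k f f' : (forall tau, 0 < complex.Im tau -> f tau = f' tau) -> A k f -> A k f'.
Proof. by case: gA => h _ _ _ ff; apply: h => tau t0; exact: ff. Qed.

Lemma graded_lin k (c : C) f f' : A k f -> A k f' -> A k (fun tau => c * f tau + f' tau).
Proof. by case: gA => _ /(_ k)[_ h] _ _; exact: h. Qed.

Lemma graded_0 k : A k (fun=> 0). Proof. by case: gA => _ /(_ k)[]. Qed.

Lemma graded_1 : A 0 (fun=> 1). Proof. by case: gA. Qed.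

Lemma graded_M k l f f' : A k f -> A l f' -> A (k + l) (fun tau => f tau * f' tau).
Proof. by case: gA => _ _ _; apply. Qed.

Lemma graded_X f (n : nat) : A 1 f -> A n%:Z (fun tau => f tau ^+ n).
Proof.
move=> hf; elim: n => [|n IH]; first exact: graded_1.
have := graded_M hf IH; rewrite -PoszD add1n; apply: graded_eq => tau _.
by rewrite exprS.
Qed.

Lemma graded_sum k N (c : nat -> C) (V : nat -> C -> C) : (forall j, (j < N)%N -> A k (V j)) ->
  A k (fun tau => \sum_(0 <= j < N) c j * V j tau).
Proof.
elim: N => [|N IH] hV.
  by apply: graded_eq (graded_0 k) => tau _; rewrite big_nil.
have h1 := IH (fun j jN => hV j (ltnW jN)).
apply: graded_eq (graded_lin (c N) (hV N (ltnSn N)) h1) => tau _.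
by rewrite big_nat_recr//= addrC.
Qed.

End Graded.

(* For [j <= 5 k] these are the products of [k] of the functions [v 0, .., v 5]
   with leading term q^(j/5). *)
Definition mono (k j : nat) tau : C :=
  if k is n.+1 then
    let i := minn (j %/ 5) n in v 5 tau ^+ i * v (j - 5 * i) tau * v 0 tau ^+ (n - i)
  else 1.

Lemma mono_graded A k j : graded_subalgebra A -> (forall i, (i <= 5)%N -> A 1 (@v R i)) ->
  (j <= 5 * k)%N -> A k%:Z (mono k j).
Proof.
move=> gA hv; case: k => [|n] jk; first exact: graded_1.
rewrite /mono; set i := minn _ _.
have i_n : (i <= n)%N by exact: geq_minr.
(* The cap n in [mono] matters only for j = 5(n+1), where the middle factor is [v 5]. *)
have r5 : (j - 5 * i <= 5)%N by rewrite /i; lia.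
have e : n.+1%:Z = i%:Z + 1 + (n - i)%N%:Z by lia.
rewrite e; apply: graded_M => //; last by apply: graded_X => //; exact: hv.
by apply: graded_M => //; [apply: graded_X => //; exact: hv|exact: hv].
Qed.

Lemma mono_leading k j : (j <= 5 * k)%N -> leading 5 j (mono k j).
Proof.
have T := is_int_subring R.
have sp U : unitQ 1 (@is_int R) U -> unitQ 5 (@is_int R) U.
  by move=> hU; have := @unitQ_spread R 1 _ isT T 5 U isT hU; rewrite mul1n.
case: k => [|n] jk.
  move: jk; rewrite muln0 leqn0 => /eqP ->.
  apply: (leading_unit (isT : (0 < 5)%N) (unitQ_1 5 T)) => tau _; by rewrite expr0 mulr1.
rewrite /mono; set i := minn _ _.
pose U tau : C := vu 5 tau ^+ i * vu (j - 5 * i) tau * vu 0 tau ^+ (n - i).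
have hU : unitQ 1 (@is_int R) U.
  apply: unitQ_M => //; last by apply: unitQ_X => //; exact: unitQ_vu.
  apply: unitQ_M => //; last exact: unitQ_vu.
  by apply: unitQ_X => //; exact: unitQ_vu.
apply: (leading_unit (isT : (0 < 5)%N) (sp _ hU)) => tau t0; rewrite /U (v_tq 5 t0) (v_tq (j - 5 * i) t0) (v_tq 0 t0).
have -> : tq 5 tau ^+ j = (tq 5 tau ^+ 5) ^+ i * tq 5 tau ^+ (j - 5 * i).
  by rewrite -exprM -exprD subnKC// /i; lia.
rewrite expr0 mul1r [(tq 5 tau ^+ 5 * _) ^+ i]exprMn.
move: ((tq 5 tau ^+ 5) ^+ i) (tq 5 tau ^+ (j - 5 * i)) (vu 5 tau ^+ i) (vu (j - 5 * i) tau).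
by move: (vu 0 tau ^+ (n - i)) => a b c d e; ring.
Qed.

(** In negative weight the condition of [sturm] on the coefficients is void. *)
Lemma Gamma_neg (k : int) f tau : k < 0 -> modular_forms (Gamma 5) k f ->
  0 < complex.Im tau -> f tau = 0.
Proof.
move=> k0 fM; have [a qa] := Gamma_QE fM.
by apply: (sturm fM qa) => m; lia.
Qed.

Lemma Gamma_Gamma1 k f : modular_forms (Gamma1 5) k f -> modular_forms (Gamma 5) k f.
Proof.
move=> /modular_formsP[inv cusp]; apply/modular_formsP; split=> // g tau hg.
by apply: inv; exact: Gamma_sub.
Qed.

Lemma Gamma_span (k : nat) f : modular_forms (Gamma 5) k f ->
  exists c : nat -> C, forall tau, 0 < complex.Im tau ->
    f tau = \sum_(0 <= j < (5 * k).+1) c j * mono k j tau.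
Proof.
move=> fM; have gM := @modular_forms_graded R _ Gamma_SL2Z.
have [a qa] := Gamma_QE fM.
have [|c [b [qb b0]]] := eliminate (N := (5 * k).+1) (V := mono k) (isT : (0 < 5)%N) _ qa.
  by move=> j jN; exact: mono_leading.
exists c => tau t0; apply/eqP; rewrite -subr_eq0; apply/eqP.
have b0' (m : nat) : m%:Z <= 5 * k%:Z -> b m = 0 by move=> mk; apply: b0; lia.
refine (sturm (k := k%:Z) _ qb b0' t0).
have hs := graded_sum gM (k := k) (N := (5 * k).+1) c
  (fun j jN => mono_graded gM (@v_Gamma_modular R) (jN : (j <= 5 * k)%N)).
apply: (graded_eq gM) (graded_lin gM (-1) hs fM) => t _.
by rewrite mulN1r addrC.
Qed.

Lemma leading1_v0v5 k i : (i <= k)%N -> leading 1 i (fun tau => @v R 0 tau ^+ (k - i) * v 5 tau ^+ i).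
Proof.
have T := is_int_subring R => ik.
pose U tau : C := vu 0 tau ^+ (k - i) * vu 5 tau ^+ i.
have hU : unitQ 1 (@is_int R) U.
  by apply: unitQ_M => //; apply: unitQ_X => //; exact: unitQ_vu.
apply: (leading_unit (isT : (0 < 1)%N) hU) => tau t0; rewrite /U (v_tq 5 t0) (v_tq 0 t0) expr0 mul1r.
have -> : tq 5 tau ^+ 5 = tq 1 tau by rewrite tq5 /tq divr1; apply: congr1; field.
rewrite [(tq 1 tau * _) ^+ i]exprMn.
by rewrite mulrCA.
Qed.

Lemma v0v5_graded A k i : graded_subalgebra A -> A 1 (@v R 0) -> A 1 (@v R 5) -> (i <= k)%N ->
  A k%:Z (fun tau => v 0 tau ^+ (k - i) * v 5 tau ^+ i).
Proof.
move=> gA h0 h5 ik; have -> : k%:Z = (k - i)%N%:Z + i%:Z by lia.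
by apply: graded_M => //; exact: graded_X.
Qed.

Lemma Gamma1_span (k : nat) f : modular_forms (Gamma1 5) k f ->
  exists c : nat -> C, forall tau, 0 < complex.Im tau ->
    f tau = \sum_(0 <= i < k.+1) c i * (v 0 tau ^+ (k - i) * v 5 tau ^+ i).
Proof.
move=> fM; have gM := @modular_forms_graded R _ Gamma1_SL2Z.
have [a qa] := Gamma1_QE fM.
have [|c [b [qb b0]]] := eliminate (N := k.+1)
  (V := fun i tau => v 0 tau ^+ (k - i) * v 5 tau ^+ i) (isT : (0 < 1)%N) _ qa.
  by move=> j jN; exact: leading1_v0v5.
exists c => tau t0; apply/eqP; rewrite -subr_eq0; apply/eqP.
(* Read in q^(1/5), k+1 vanishing coefficients in q become 5k+5 of them, enough for [sturm]. *)
have qb' := QE_spread (isT : (0 < 1)%N) (isT : (0 < 5)%N) qb.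
have b0' (m : nat) : m%:Z <= 5 * k%:Z -> spread 5 b m = 0.
  by move=> mk; rewrite /spread; case: ifP => // m5; apply: b0; lia.
refine (sturm (k := k%:Z) (Gamma_Gamma1 _) qb' b0' t0).
have hs := graded_sum gM (k := k) (N := k.+1) c
  (fun j jN => v0v5_graded gM (v0_Gamma1_modular R) (v5_Gamma1_modular R) (jN : (j <= k)%N)).
apply: (graded_eq gM) (graded_lin gM (-1) hs fM) => t _.
by rewrite mulN1r addrC.
Qed.

End Span.

(** * Forms in tau/5 and coefficients modulo q^6 *)

Section Decomposition.
Variable R : realType.
Local Notation C := R[i].
Implicit Types (z w tau : C) (x y : R) (f : C -> C).

(** Conjugation by diag(1, 5) maps Gamma(5) into Gamma_1(5). At the cusps, diag(1, 5) g is rewritten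
    as s times an upper triangular matrix of determinant 5 with s in SL_2(Z), as for Hecke
    operators. *)
Lemma modular_div5 k f : modular_forms (Gamma1 5) k f ->
  modular_forms (Gamma 5) k (fun tau => f (tau / 5)).
Proof.
move=> /modular_formsP[inv cusp]; apply/modular_formsP; split=> [g tau hg t0|g hg].
  have /GammaP[hg' [a [b [c [d [ea eb ec ed]]]]]] := hg.
  pose s := mx2 (1 + 5 * a) b (25 * c) (1 + 5 * d).
  have hs : Gamma1 5 s.
    apply/Gamma1P; split; last by exists a, (5 * c), d; rewrite !mxE /=; split=> //; ring.
    by apply: SL2Z_mx2; have := SL2Z_det hg'; rewrite ea eb ec ed => e; rewrite -[RHS]e; ring.
  have t5 : 0 < complex.Im (tau / 5%:R) by rewrite Im_divn divr_gt0.
  rewrite -[RHS](inv s _ hs t5) /slash; have J0 := SL2Z_automorphy hg' t0.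
  have eJ : automorphy s (tau / 5) = automorphy g tau.
    by rewrite automorphy_mx2 /automorphy ec ed !rmorphM /=; field.
  rewrite eJ; congr (_ * f _).
  by rewrite /moebius eJ mulrAC; congr (_ / _); rewrite !mxE /= ea eb !rmorphM /=; field.
have det := SL2Z_det hg.
(* If 5 divides the upper left entry, the triangular matrix is diag(5, 1); otherwise it has rows (1,
   j) and (0, 5). *)
have [[a' ea]|[j [e eb]]] := cusp0_shift (g ord0 ord0) (g ord0 ord_max).
- pose s := mx2 a' (g ord0 ord_max) (g ord_max ord0) (5 * g ord_max ord_max).
  have hs : SL2Z s by apply: SL2Z_mx2; rewrite -[RHS]det ea; ring.
  have [h h0 [a qa]] := cusp s hs.
  have Q : hasQ (fun tau => slash k s f (5%:R * tau)).
    by exists h => //; exists (spread 5 a); exact: QE_mulz.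
  apply: hasQ_eq (hasQ_Z (5 ^ k) Q) => tau t0; have J0 := SL2Z_automorphy hg t0.
  rewrite /slash; have eJ : automorphy s (5%:R * tau) = 5 * automorphy g tau.
    by rewrite automorphy_mx2 /automorphy rmorphM /=; ring.
  have -> : moebius s (5%:R * tau) = moebius g tau / 5.
    rewrite /moebius eJ !mxE /= ea rmorphM /=; field; exact: J0.
  rewrite eJ expfzMl !mulrA -expfzDr ?pnatr_eq0// subrr expr0z mul1r//.
- pose s := mx2 (g ord0 ord0) e (5 * g ord_max ord0) (g ord_max ord_max - g ord_max ord0 * j).
  have hs : SL2Z s by apply: SL2Z_mx2; rewrite -[RHS]det eb; ring.
  have [h h0 [a qa]] := cusp s hs.
  have Q : hasQ (fun tau => slash k s f ((tau + (j%:~R : R)%:C) / 5%:R)).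
    have h5 : (0 < h * 5)%N by rewrite muln_gt0 h0.
    exists (h * 5)%N => //.
    exists (fun m => a m * ex ((j%:~R : R)%:C / (h * 5)%:R) ^+ m).
    exact: (QE_shift _ h5 (QE_divz h0 (isT : (0 < 5)%N) qa)).
  apply: hasQ_eq Q => tau t0; have J0 := SL2Z_automorphy hg t0.
  rewrite rmorph_int; set t := (tau + _) / _.
  have eJ : automorphy s t = automorphy g tau.
    by rewrite /t automorphy_mx2 /automorphy rmorphB !rmorphM /=; field.
  rewrite /slash eJ; congr (_ * f _).
  by rewrite /moebius eJ mulrAC; congr (_ / _); rewrite /t !mxE /= eb rmorphD !rmorphM /=; field.
Qed.

(** Six is the number of coefficients in q^(1/5) that [sturm] requires in weight 1. Those of
    [vu 0 (tau / 5)] in q^(1/5) are those of [vu 0] in q. *)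
Definition trunc6 (s : seq int) f :=
  exists2 a, QE 1 a f & forall m, (m < 6)%N -> a m = (s`_m)%:~R :> C.

(** Multiplication modulo q^6 on integer lists, in a form that [vm_compute] evaluates. *)
Definition cmul (s t : seq int) : seq int :=
  [seq foldr (fun i acc => s`_i * t`_(m - i) + acc) 0 (iota 0 m.+1) | m <- iota 0 6].

Lemma trunc6_M s t f f' : trunc6 s f -> trunc6 t f' ->
  trunc6 (cmul s t) (fun tau => f tau * f' tau).
Proof.
move=> [a qa ha] [b qb hb]; exists (conv a b); first exact: QE_M.
move=> m m6; rewrite /cmul (nth_map 0%N) ?size_iota// nth_iota// add0n.
have foldE r : foldr (fun i acc => s`_i * t`_(m - i) + acc) 0 r =
    \sum_(i <- r) s`_i * t`_(m - i) :> int.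
  by elim: r => [|i r /= ->]; rewrite ?big_nil ?big_cons.
rewrite foldE rmorph_sum /conv -(big_mkord xpredT (fun i => a i * b (m - i)%N)).
rewrite /index_iota subn0 [LHS]big_seq [RHS]big_seq.
apply: eq_bigr => i; rewrite mem_iota add0n ltnS => /andP[_ im].
by rewrite ha ?hb ?rmorphM//; [exact: leq_ltn_trans (leq_subr _ _) m6|exact: leq_ltn_trans im m6].
Qed.

Definition Poch (k : nat) tau : C := qpochhammer (ex (k%:R * tau)) (ex (5%:R * tau)).

Definition lin6 k : seq int := [seq ((m == 0%N)%:R - (m == k)%:R : int) | m <- iota 0 6].
Definition geo6 k : seq int := [seq ((k %| m)%:R : int) | m <- iota 0 6].

Lemma iprod6 (F : nat -> nat -> C) m : (forall n, is_factor n (F n)) ->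
  (forall n m, (0 < n)%N -> (m < 6)%N -> F n m = (m == 0%N)%:R) -> (m < 6)%N ->
  iprod F m = F 0%N m.
Proof.
move=> ff F0 m6; rewrite (iprodE ff (leqnSn m)).
have conv1 (a b : nat -> C) n : (n < 6)%N ->
    (forall m, (m < 6)%N -> b m = (m == 0%N)%:R) -> conv a b n = a n.
  move=> n6 hb; rewrite /conv (bigD1 ord_max)//= subnn hb// mulr1 big1 ?addr0// => i ij.
  rewrite hb ?(leq_ltn_trans (leq_subr _ _) n6)// subn_eq0 leqNgt.
  by rewrite ltn_neqAle -ltnS ltn_ord andbT ij mulr0.
suff H k n : (n < 6)%N -> pprod F k.+1 n = F 0%N n by exact: H.
elim: k n {m6} => [|k IH] n n6.
  rewrite /= /conv (bigD1 ord0)//= mul1r subn0 big1 ?addr0// => i ij.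
  by rewrite (negbTE (_ : i != 0%N :> nat)) ?mul0r.
by rewrite -[pprod _ _]/(conv (pprod F k.+1) (F k.+1)) conv1 ?IH// => l l6; apply: F0.
Qed.

(* Modulo q^6 only the first factor 1 - q^k of (q^k; q^5) counts. *)
Lemma trunc6_Poch k : (0 < k < 6)%N -> trunc6 (lin6 k) (Poch k) /\
  trunc6 (geo6 k) (fun tau => (Poch k tau)^-1) /\
  forall tau, 0 < complex.Im tau -> Poch k tau != 0.
Proof.
move=> /andP[k0 k6]; have n1 : nrm (1 : C) <= 1 by rewrite nrm1.
have key tau (t0 : 0 < complex.Im tau) :=
  qpochhammer_small k0 (isT : (0 < 5)%N) n1 (nrm_tq_lt1 (isT : (0 < 1)%N) t0).
have E tau : qpochhammer (1 * tq 1 tau ^+ k) (tq 1 tau ^+ 5) = Poch k tau.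
  by rewrite /Poch !ex_nat_tq mul1r.
split; [|split].
- exists (iprod (poch_series (1 : C) k 5)).
    by apply: QE_of_sums => // tau t0; rewrite -E; have [] := key tau t0.
  move=> m m6; rewrite iprod6//; last 2 first.
  + by move=> n; exact: poch_factor.
  + move=> [//|n] m' _ m'6; rewrite /poch_series /lin_series; case: eqP => // _.
    by rewrite ifF//; apply/eqP; lia.
  rewrite /poch_series /lin_series mulr0 addr0 (nth_map 0%N) ?size_iota// nth_iota// add0n.
  by case: m m6 => [|m] m6; rewrite ?eqxx /= ?(gtn_eqF k0) ?(ltn_eqF k0)//;
    rewrite ?subr0//; case: (_ == k); rewrite ?sub0r ?subrr ?mulrN1z ?mulr1z ?mulr0z.
- exists (iprod (inv_poch_series (1 : C) k 5)).
    by apply: QE_of_sums => // tau t0; rewrite -E; have [] := key tau t0.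
  move=> m m6; rewrite iprod6//; last 2 first.
  + by move=> n; exact: inv_poch_factor.
  + move=> [//|n] m' _ m'6; rewrite /inv_poch_series /geo_series /spread expr1n.
    case: m' m'6 => [|m'] m'6; first by rewrite dvdn0.
    by rewrite gtnNdvd//; lia.
  have -> : inv_poch_series (1 : C) k 5 0%N = geo_series 1 k by congr geo_series; rewrite muln0 addn0.
  rewrite /geo_series /spread (nth_map 0%N) ?size_iota// nth_iota// add0n.
  by case: (k %| m)%N => //; rewrite expr1n.
- by move=> tau t0; have [_ _] := key tau t0; rewrite E.
Qed.

Lemma trunc6_eq s s' f f' : s = s' -> (forall tau, 0 < complex.Im tau -> f tau = f' tau) ->
  trunc6 s f -> trunc6 s' f'.
Proof. by move=> -> ff [a qa ha]; exists a => //; apply: QE_eq qa. Qed.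

(** [vu 0] is (q^2, q^3, q^5; q^5)^2 / (q, q^4; q^5)^3. *)
Lemma trunc6_vu0 : trunc6 [:: 1; 3; 4; 2; 1; 3] (vu 0).
Proof.
have [p1 [q1 n1]] := trunc6_Poch (isT : (0 < 1 < 6)%N).
have [p2 [q2 n2]] := trunc6_Poch (isT : (0 < 2 < 6)%N).
have [p3 [q3 n3]] := trunc6_Poch (isT : (0 < 3 < 6)%N).
have [p4 [q4 n4]] := trunc6_Poch (isT : (0 < 4 < 6)%N).
have [p5 [q5 n5]] := trunc6_Poch (isT : (0 < 5 < 6)%N).
have c1 := trunc6_M q1 (trunc6_M q1 q1); have c4 := trunc6_M q4 (trunc6_M q4 q4).
have c23 := trunc6_M (trunc6_M p2 p3) p5.
apply: trunc6_eq (trunc6_M (trunc6_M c1 c4) (trunc6_M c23 c23)); first by vm_compute.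
move=> tau t0; move: (n1 _ t0) (n2 _ t0) (n3 _ t0) (n4 _ t0) (n5 _ t0).
rewrite /vu /Ku -/(Poch 1 tau) -/(Poch 2 tau) -/(Poch 3 tau) -/(Poch 4 tau) -/(Poch 5 tau).
move: (Poch 1 tau) (Poch 2 tau) (Poch 3 tau) (Poch 4 tau) (Poch 5 tau) => a b c d e *.
rewrite -[X in _ = X * _]/(((a * d / e ^+ 2) ^+ 3)^-1) -[X in _ = _ * X]/((b * c / e ^+ 2) ^+ 2).
by field; do !(apply/andP; split).
Qed.

(** [vu 5] is (q, q^4, q^5; q^5)^2 / (q^2, q^3; q^5)^3. *)
Lemma trunc6_vu5 : trunc6 [:: 1; -2; 4; -3; 1; 2] (vu 5).
Proof.
have [p1 [q1 n1]] := trunc6_Poch (isT : (0 < 1 < 6)%N).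
have [p2 [q2 n2]] := trunc6_Poch (isT : (0 < 2 < 6)%N).
have [p3 [q3 n3]] := trunc6_Poch (isT : (0 < 3 < 6)%N).
have [p4 [q4 n4]] := trunc6_Poch (isT : (0 < 4 < 6)%N).
have [p5 [q5 n5]] := trunc6_Poch (isT : (0 < 5 < 6)%N).
have c2 := trunc6_M q2 (trunc6_M q2 q2); have c3 := trunc6_M q3 (trunc6_M q3 q3).
have c14 := trunc6_M (trunc6_M p1 p4) p5.
apply: trunc6_eq (trunc6_M (trunc6_M c2 c3) (trunc6_M c14 c14)); first by vm_compute.
move=> tau t0; move: (n1 _ t0) (n2 _ t0) (n3 _ t0) (n4 _ t0) (n5 _ t0).
rewrite /vu /Ku -/(Poch 1 tau) -/(Poch 2 tau) -/(Poch 3 tau) -/(Poch 4 tau) -/(Poch 5 tau).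
move: (Poch 1 tau) (Poch 2 tau) (Poch 3 tau) (Poch 4 tau) (Poch 5 tau) => a b c d e *.
rewrite -[X in _ = X * _]/((a * d / e ^+ 2) ^+ 2) -[X in _ = _ * X]/(((b * c / e ^+ 2) ^+ 3)^-1).
by field; do !(apply/andP; split).
Qed.

End Decomposition.

Section Final.
Variable R : realType.
Local Notation C := R[i].
Implicit Types (z w tau : C) (x y : R) (f : C -> C).

Lemma QE_v j a : QE 1 a (@vu R j) ->
  QE 5 (fun m => if (m < j)%N then 0 else spread 5 a (m - j)%N) (@v R j).
Proof.
move=> qa; have qs := QE_spread (isT : (0 < 1)%N) (isT : (0 < 5)%N) qa.
by apply: QE_eq (QE_mul_tq j (isT : (0 < 5)%N) qs) => // tau t0; rewrite (v_tq j t0).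
Qed.

Lemma vu_series j : exists2 a, QE 1 a (@vu R j) & a 0%N = 1.
Proof. by have [a [b [qa _ [a0 _] _ _]]] := unitQ_vu R j; exists a. Qed.

Lemma sturm_combination f a (c : nat -> C) (b : nat -> nat -> C) :
  modular_forms (Gamma 5) 1 f -> QE 5 a f ->
  (forall j, (j < 6)%N -> QE 5 (b j) (@v R j)) ->
  (forall m, (m < 6)%N -> a m = \sum_(0 <= j < 6) c j * b j m) ->
  forall tau, 0 < complex.Im tau -> f tau = \sum_(0 <= j < 6) c j * v j tau.
Proof.
move=> fM qa qb e tau t0; have gM := @modular_forms_graded R _ Gamma_SL2Z.
have hs := graded_sum gM (k := 1) (N := 6) c (fun j jN => v_Gamma_modular R (jN : (j <= 5)%N)).
have q n : (n <= 6)%N -> QE 5 (fun m => \sum_(0 <= j < n) c j * b j m)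
    (fun t => \sum_(0 <= j < n) c j * v j t).
  elim: n => [|n IH] n6.
    by apply: QE_eq (QE_Z 0 (QE_1 R 5)) => [m|t _]; rewrite big_nil mul0r.
  apply: QE_eq (QE_D (IH (ltnW n6)) (QE_Z (c n) (qb n n6))) => [m|t _]; by rewrite big_nat_recr.
have hM := graded_lin gM (-1) hs fM.
have qd := QE_D (QE_Z (-1) (q 6 (leqnn 6))) qa.
have z (m : nat) : m%:Z <= 5 * 1 -> -1 * (\sum_(0 <= j < 6) c j * b j m) + a m = 0.
  by move=> m5; rewrite e ?mulN1r ?addNr//; lia.
have := sturm hM qd z t0; rewrite mulN1r addrC => /eqP.
by rewrite subr_eq0 => /eqP.
Qed.

Lemma v0_div5 tau : 0 < complex.Im tau -> v 0 (tau / 5) =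
  v 0 tau + 3 * v 1 tau + 4 * v 2 tau + 2 * v 3 tau + v 4 tau.
Proof.
move=> t0; have [a0 q0 e0] := trunc6_vu0 R.
have [a1 q1 e1] := vu_series 1; have [a2 q2 e2] := vu_series 2.
have [a3 q3 e3] := vu_series 3; have [a4 q4 e4] := vu_series 4.
have [a5 q5 e5] := vu_series 5.
pose A j := nth a0 [:: a0; a1; a2; a3; a4; a5] j.
have qA j : (j < 6)%N -> QE 1 (A j) (@vu R j) by case: j => [|[|[|[|[|[|]]]]]].
have A0 j : (0 < j < 6)%N -> A j 0%N = 1 by case: j => [|[|[|[|[|[|]]]]]].
(* As [v j] is q^(j/5) times a series in q, the entries below 5 are coefficients of [v 0]. The last
   is 0 because the coefficient 3 of q on the left is already supplied by [v 0]. *)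
pose c (j : nat) : C := ([:: 1; 3; 4; 2; 1; 0] : seq C)`_j.
have qf : QE 5 a0 (fun t => @v R 0 (t / 5)).
  apply: QE_eq (QE_divz (isT : (0 < 1)%N) (isT : (0 < 5)%N) q0) => // t t1.
  by rewrite (@v_tq _ 0) ?expr0 ?mul1r// Im_divn divr_gt0.
have fM := modular_div5 (v0_Gamma1_modular R).
rewrite (sturm_combination (c := c) fM qf (fun j j6 => QE_v (qA j j6)) _ t0).
  by rewrite !big_nat_recr//= big_nil /c /=; ring.
move=> m m6; rewrite !big_nat_recr//= big_nil /c /= e0//.
have aA : A 0%N = a0 by [].
case: m m6 => [|[|[|[|[|[|]]]]]]//= _;
  rewrite /spread ?dvdn0 ?div0n //= ?aA ?e0// ?A0//=; ring.
Qed.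

Lemma v5_div5 tau : 0 < complex.Im tau -> v 5 (tau / 5) =
  v 5 tau + v 1 tau - 2 * v 2 tau + 4 * v 3 tau - 3 * v 4 tau.
Proof.
move=> t0; have [b5 r5 f5] := trunc6_vu5 R.
have [a0 q0 e0] := vu_series 0.
have [a1 q1 e1] := vu_series 1; have [a2 q2 e2] := vu_series 2.
have [a3 q3 e3] := vu_series 3; have [a4 q4 e4] := vu_series 4.
have [a5 q5 e5] := vu_series 5.
pose A j := nth a0 [:: a0; a1; a2; a3; a4; a5] j.
have qA j : (j < 6)%N -> QE 1 (A j) (@vu R j) by case: j => [|[|[|[|[|[|]]]]]].
have A0 j : (j < 6)%N -> A j 0%N = 1 by case: j => [|[|[|[|[|[|]]]]]].
(* The expansion of [v 5 (tau / 5)] starts at q^(1/5), so the coefficients of [vu 5] appear shifted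
   by one place. *)
pose c (j : nat) : C := ([:: 0; 1; -2; 4; -3; 1] : seq C)`_j.
have qd : QE 5 b5 (fun t => @vu R 5 (t / 5)).
  by apply: QE_eq (QE_divz (isT : (0 < 1)%N) (isT : (0 < 5)%N) r5).
have qf := QE_mul_tq 1 (isT : (0 < 5)%N) qd.
have {}qf : QE 5 (fun m => if (m < 1)%N then 0 else b5 (m - 1)%N) (fun t => @v R 5 (t / 5)).
  apply: QE_eq qf => // t t1; rewrite (@v_tq _ 5); last by rewrite Im_divn divr_gt0.
  by rewrite expr1 tq5 /tq; congr (ex _ * _); field.
have fM := modular_div5 (v5_Gamma1_modular R).
rewrite (sturm_combination (c := c) fM qf (fun j j6 => QE_v (qA j j6)) _ t0).
  by rewrite !big_nat_recr//= big_nil /c /=; ring.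
move=> m m6; rewrite !big_nat_recr//= big_nil /c /=.
case: m m6 => [|[|[|[|[|[|]]]]]]//= _;
  rewrite /spread ?dvdn0 ?div0n //= ?f5// ?A0//=; ring.
Qed.

Lemma v_integral j : exists a : nat -> int,
  has_qexp 1 (j%:R / 5) (fun n => (a n)%:~R) (@v R j).
Proof.
have [a [b [qa _ _ _ Pa]]] := unitQ_vu R j.
have /choice[n hn] : forall m, exists n : int, a m = n%:~R.
  by move=> m; have [[n ->] _] := Pa m; exists n.
exists n; have {}qa : QE 1 (fun m => (n m)%:~R) (@vu R j) by apply: QE_eq qa.
move=> tau t0; have := @QE_has_qexp R 1 _ _ (j%:R / 5) qa tau t0.
rewrite (v_tq j t0) qpowE tq5.
have -> : ratr (j%:R / 5 : rat) * tau = j%:R * tau / 5 :> C.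
  by rewrite rmorphM fmorphV /= !ratr_nat mulrAC.
by [].
Qed.

Lemma is_basis_leading (M : set (C -> C)) (V : nat -> C -> C) (h : nat) (s : seq (C -> C)) :
  (0 < h)%N -> (forall i, (i < size s)%N -> nth (fun=> 0) s i = V i) ->
  (forall i, (i < size s)%N -> M (V i)) -> (forall i, (i < size s)%N -> leading h i (V i)) ->
  (forall f, M f -> exists c : nat -> C, forall tau, 0 < complex.Im tau ->
    f tau = \sum_(0 <= i < size s) c i * V i tau) ->
  is_basis M s.
Proof.
move=> h0 sV MV lV span.
have combE (c : nat -> C) tau : \sum_(i < size s) c i * nth (fun=> 0) s i tau =
    \sum_(0 <= i < size s) c i * V i tau.
  by rewrite big_mkord; apply: eq_bigr => i _; rewrite sV.
split=> [i|c c0 i|f fM]; first by rewrite sV//; exact: MV.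
  (* The default 0 is harmless: only indices below [size s] are read. *)
  pose d n : C := if insub n is Some k then c k else 0.
  have dE (k : 'I_(size s)) : d k = c k by rewrite /d valK.
  rewrite -dE; apply: (leading_free h0 lV) => // tau t0.
  by rewrite -combE -[RHS](c0 tau t0); apply: eq_bigr => k _; rewrite dE.
have [c fc] := span f fM; exists (fun i => c i) => tau t0.
by rewrite fc// -combE.
Qed.

End Final.

Theorem lemma5p1 (R : realType) :
  [/\ is_basis (modular_forms (Gamma1 5) 1) [:: @v R 0; @v R 5],

      is_basis (modular_forms (Gamma 5) 1) [seq @v R j | j <- iota 0 6] /\
      (forall j : nat, (j <= 5)%N ->
        exists a : nat -> int,
          has_qexp 1 (j%:R / 5) (fun n => (a n)%:~R) (@v R j)),

      generated_in_weight1 (modular_forms (Gamma1 5)) [set @v R 0; @v R 5] /\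
      generated_in_weight1 (modular_forms (Gamma 5))
        [set @v R j | j in [set j : nat | (j <= 5)%N]] &

      forall tau : R[i], tau \in @upper_half_plane R ->
        v 0 (tau / 5) =
          v 0 tau + 3 * v 1 tau + 4 * v 2 tau + 2 * v 3 tau + v 4 tau /\
        v 5 (tau / 5) =
          v 5 tau + v 1 tau - 2 * v 2 tau + 4 * v 3 tau - 3 * v 4 tau].
Proof.
have m0 := v0_Gamma1_modular R; have m5 := v5_Gamma1_modular R; have mG := @v_Gamma_modular R.
split.
- refine (@is_basis_leading R _ (fun i tau => v 0 tau ^+ (1 - i) * v 5 tau ^+ i) 1 _ isT _ _ _ _).
  + case=> [_|[_|//]]; apply/funext => tau; first by rewrite /= expr1 expr0 mulr1.
    by rewrite /= expr1 expr0 mul1r.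
  + move=> i i2; exact: (v0v5_graded (@modular_forms_graded R _ Gamma1_SL2Z) m0 m5 (i2 : (i <= 1)%N)).
  + by move=> i i2; exact: leading1_v0v5.
  + by move=> f fM; exact: (Gamma1_span (k := 1) fM).
- split; last by move=> j _; exact: v_integral.
  have gM := @modular_forms_graded R _ Gamma_SL2Z.
  refine (@is_basis_leading R _ (mono 1) 5 _ isT _ _ _ _); rewrite size_map size_iota.
  + move=> j j6; rewrite (nth_map 0%N) ?size_iota// nth_iota// add0n.
    apply/funext => tau; rewrite /mono minn0 muln0 subn0 subnn !expr0 mul1r mulr1//.
  + by move=> j j6; exact: (mono_graded gM mG (j6 : (j <= 5 * 1)%N)).
  + by move=> j j6; exact: (mono_leading R (j6 : (j <= 5 * 1)%N)).
  + by move=> f fM; exact: (Gamma_span (k := 1) fM).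
- split; split.
  + exact: (@modular_forms_graded R _ Gamma1_SL2Z).
  + by move=> f [->|->].
  + move=> A gA hA; have A0 : A 1 (@v R 0) by apply: hA; left.
    have A5 : A 1 (@v R 5) by apply: hA; right.
    (* Components of negative weight consist of functions that vanish on the half-plane. *)
    case=> k f fM; last first.
      apply: (graded_eq gA) (graded_0 gA _) => tau t0.
      by rewrite (Gamma_neg _ (Gamma_Gamma1 fM) t0).
    have [c fc] := Gamma1_span fM.
    have hs := graded_sum gA (k := k) (N := k.+1) c
      (fun j jN => v0v5_graded gA A0 A5 (jN : (j <= k)%N)).
    by apply: (graded_eq gA) hs => tau t0; rewrite -fc.
  + exact: (@modular_forms_graded R _ Gamma_SL2Z).
  + by move=> f [j j5 <-]; exact: mG.
  + move=> A gA hA; have AV j : (j <= 5)%N -> A 1 (@v R j) by move=> j5; apply: hA; exists j.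
    case=> k f fM; last first.
      apply: (graded_eq gA) (graded_0 gA _) => tau t0.
      by rewrite (Gamma_neg _ fM t0).
    have [c fc] := Gamma_span fM.
    have hs := graded_sum gA (k := k) (N := (5 * k).+1) c
      (fun j jN => mono_graded gA AV (jN : (j <= 5 * k)%N)).
    by apply: (graded_eq gA) hs => tau t0; rewrite -fc.
- by move=> tau t0; split; [exact: v0_div5|exact: v5_div5].
Qed.
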